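(* Assume the standing hypotheses (H), (L) and (g) below. Let $u\in W^{1,1}(0,T;X)$ and $x_0\in X$ be such that $x_0\in Z(g(0,u(0),u(0)-x_0))$. Then there exists a unique solution $\xi\in\Omega_{x_0}(u)$ of the state-dependent sweeping process with input $u$ and initial condition $x_0$.
   Context: $T>0$. $X$ is a real Hilbert space with inner product $\langle\cdot,\cdot\rangle$ and norm $|x|=\sqrt{\langle x,x\rangle}$; $W$ is a real Banach space with norm $|\cdot|_W$, dual $W'$ (norm $|\cdot|_{W'}$), duality pairing $\langle v,f\rangle_W$; $\mathcal L(X,W)$ is the space of bounded linear operators with operator norm. $G:X\times W\to[0,\infty)$ is locally Lipschitz continuous and $Z(w):=\{x\in X: G(x,w)\le 1\}$; $\partial Z(w)$ is its boundary, $\mathrm{dist}(x,S)=\inf_{s\in S}|x-s|$. Partial gradients: $\nabla_xG(x,w)\in X$ with $\langle\nabla_xG(x,w),y\rangle=\lim_{t\to0}\frac1t(G(x+ty,w)-G(x,w))$ for all $y\in X$; $\nabla_wG(x,w)\in W'$ with $\langle v,\nabla_wG(x,w)\rangle_W=\lim_{t\to0}\frac1t(G(x,w+tv)-G(x,w))$ for all $v\in W$. (H): $\nabla_xG(x,w)$ exists for all $(x,w)$, and there are positive constants $\lambda,c,L$ and functions $\mu_1:W\times[0,\infty)\to[0,\infty)$, $\mu_2:[0,\infty)\to[0,\infty)$ with $\mu_1(w,0)=\mu_2(0)=0$, $\lim_{s\to\infty}\mu_1(w,s)=\lim_{s\to\infty}\mu_2(s)=\infty$ for every $w$, such that for all $x,y,z\in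 X$, $w,w'\in W$: (i) $G(x,w)=1\Rightarrow|\nabla_xG(x,w)|\ge c$; (ii) $|\nabla_xG(x,w)-\nabla_xG(y,w)|\le\mu_1(w,|x-y|)$ if $x,y\in Z(w)$; (iii) $\langle\nabla_xG(x,w)-\nabla_xG(z,w),x-z\rangle\ge-\lambda|x-z|^2$ if $x\in\partial Z(w)$, $z\in Z(w)$; (iv) $|G(x,w)-G(x,w')|\le L|w-w'|_W$; (v) for $\rho>0$, $\mathrm{dist}(x,Z(w))\ge\rho\Rightarrow G(x,w)-1\ge\mu_2(\rho)$. Set $r:=c/\lambda$. (L): $\nabla_xG,\nabla_wG$ exist on all of $X\times W$ and there are positive constants $K_0,K_1,C_0,C_1$ with $|\nabla_xG|\le K_0$, $|\nabla_wG|_{W'}\le K_1$, $|\nabla_xG(x,w)-\nabla_xG(x',w')|\le C_0(|x-x'|+|w-w'|_W)$, $|\nabla_wG(x,w)-\nabla_wG(x',w')|_{W'}\le C_1(|x-x'|+|w-w'|_W)$. (g): $g:[0,T]\times X\times X\to W$ is continuous, its partial derivatives $\partial_tg$, $\partial_ug$, $\partial_\xi g$ exist, and there are $a,b\in L^1(0,T)$ and constants $\gamma,\omega,C_\xi,C_u>0$ such that for all $u,v,\xi,\eta\in X$ and a.e. $t\in(0,T)$: $|\partial_\xi g(t,u,\xi)|_{\mathcal L(X,W)}\le\gamma$, $|\partial_ug(t,u,\xi)|_{\mathcal L(X,W)}\le\omega$, $|\partial_tg(t,u,\xi)|_W\le a(t)$, $|\partial_\xi g(t,u,\xi)-\partial_\xi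 g(t,v,\eta)|_{\mathcal L(X,W)}\le C_\xi(|u-v|+|\xi-\eta|)$, $|\partial_ug(t,u,\xi)-\partial_ug(t,v,\eta)|_{\mathcal L(X,W)}\le C_u(|u-v|+|\xi-\eta|)$, $|\partial_tg(t,u,\xi)-\partial_tg(t,v,\eta)|_W\le b(t)(|u-v|+|\xi-\eta|)$; moreover $\delta:=K_1\gamma/c<1$. State-dependent sweeping process: given $u\in W^{1,1}(0,T;X)$ and $x_0\in X$ with $x_0\in Z(g(0,u(0),u(0)-x_0))$, a function $\xi\in W^{1,1}(0,T;X)$ is a solution with input $u$ and initial condition $x_0$ if, with $x:=u-\xi$: $x(t)\in Z(g(t,u(t),\xi(t)))$ for all $t\in[0,T]$; $\langle x(t)-z,\dot\xi(t)\rangle+\frac{|\dot\xi(t)|}{2r}|x(t)-z|^2\ge0$ for all $z\in Z(g(t,u(t),\xi(t)))$, a.e. $t$; $x(0)=x_0$. For such $u,x_0$: $\Omega_{x_0}(u)$ is the set of $\eta\in W^{1,1}(0,T;X)$ with $\eta(0)=u(0)-x_0$ and $|\dot\eta(t)|\le\frac1{1-\delta}\big((1+\frac{\omega K_1}{c})|\dot u(t)|+\frac{K_1}{c}a(t)\big)$ for a.e. $t\in(0,T)$. *)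

(* Defs.v *)
From HB Require Import structures.
From mathcomp Require Import all_boot all_order all_algebra.
From mathcomp Require Import all_classical all_reals all_analysis.
Set Implicit Arguments. Unset Strict Implicit. Unset Printing Implicit Defensive.
Import Order.TTheory GRing.Theory Num.Theory.
Import numFieldNormedType.Exports.
Local Open Scope classical_set_scope.
Local Open Scope ring_scope.

(* ip is the inner product of the real Hilbert space X, compatible with the
   norm of X (X is a complete normed space, i.e. with ip a Hilbert space). *)
Definition hilbert_inner {R : realType} {X : normedModType R} (ip : X -> X -> R) :=
  [/\ forall x y, ip x y = ip y x,
      forall (a : R) (x y z : X), ip (a *: x + y) z = a * ip x z + ip y z &
      forall x, ip x x = `|x| ^+ 2].

Definition Zset {R : realType} {X W : Type} (G : X -> W -> R) (w : W) : set X :=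
  [set x | G x w <= 1].

Definition bdry {T : topologicalType} (A : set T) : set T :=
  closure A `\` interior A.

(* dist(x,S) = inf_{s in S} |x - s|, extended-real valued (+oo for S empty) *)
Definition edist {R : realType} {X : normedModType R} (x : X) (S : set X) : \bar R :=
  ereal_inf [set (`|x - s|)%:E | s in S].

Definition loc_lipschitz2 {R : realType} {X W : normedModType R} (G : X -> W -> R) :=
  forall (x : X) (w : W), exists2 rho : R, 0 < rho & exists Lc : R,
    forall x1 x2 w1 w2, `|x1 - x| < rho -> `|x2 - x| < rho ->
      `|w1 - w| < rho -> `|w2 - w| < rho ->
      `|G x1 w1 - G x2 w2| <= Lc * (`|x1 - x2| + `|w1 - w2|).

Definition is_grad_x {R : realType} {X W : normedModType R} (ip : X -> X -> R)
  (G : X -> W -> R) (gx : X -> W -> X) :=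
  forall (x : X) (w : W) (y : X),
    (fun t : R => t^-1 * (G (x + t *: y) w - G x w)) @ 0^' --> ip (gx x w) y.

Definition is_grad_w {R : realType} {X W : normedModType R}
  (G : X -> W -> R) (gw : X -> W -> W -> R) :=
  forall (x : X) (w : W),
    [/\ forall (a : R) (v1 v2 : W), gw x w (a *: v1 + v2) = a * gw x w v1 + gw x w v2,
        (exists M : R, forall v, `|gw x w v| <= M * `|v|) &
        forall v : W, (fun t : R => t^-1 * (G x (w + t *: v) - G x w)) @ 0^' --> gw x w v].

Definition hypH {R : realType} {X W : normedModType R} (ip : X -> X -> R)
  (G : X -> W -> R) (gx : X -> W -> X) (lam c L : R)
  (mu1 : W -> R -> R) (mu2 : R -> R) :=
  [/\ is_grad_x ip G gx, [/\ 0 < lam, 0 < c & 0 < L],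
      [/\ forall w s, 0 <= s -> 0 <= mu1 w s,
          forall s, 0 <= s -> 0 <= mu2 s,
          (forall w, mu1 w 0 = 0) /\ mu2 0 = 0,
          forall w, mu1 w s @[s --> +oo] --> +oo &
          mu2 s @[s --> +oo] --> +oo] &
      [/\ (* (i) *) forall x w, G x w = 1 -> c <= `|gx x w|,
          (* (ii) *) forall x y w, Zset G w x -> Zset G w y ->
             `|gx x w - gx y w| <= mu1 w `|x - y|,
          (* (iii) *) forall x z w, bdry (Zset G w) x -> Zset G w z ->
             - lam * `|x - z| ^+ 2 <= ip (gx x w - gx z w) (x - z),
          (* (iv) *) forall x w w', `|G x w - G x w'| <= L * `|w - w'| &
          (* (v) *) forall x w (rho : R), 0 < rho -> (rho%:E <= edist x (Zset G w))%E ->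
             mu2 rho <= G x w - 1]].

(* Hypothesis (L); operator norms in W' are unfolded *)
Definition hypL {R : realType} {X W : normedModType R}
  (G : X -> W -> R) (gx : X -> W -> X) (gw : X -> W -> W -> R) (K0 K1 C0 C1 : R) :=
  [/\ is_grad_w G gw, 0 < K0, 0 < K1, 0 < C0 & 0 < C1] /\
  [/\ forall x w, `|gx x w| <= K0,
      forall x w v, `|gw x w v| <= K1 * `|v|,
      forall x w x' w', `|gx x w - gx x' w'| <= C0 * (`|x - x'| + `|w - w'|) &
      forall x w x' w' v, `|gw x w v - gw x' w' v| <= C1 * (`|x - x'| + `|w - w'|) * `|v|].

Definition L1 {R : realType} (T : R) (a : R -> R) :=
  (@lebesgue_measure R).-integrable `[0, T]%classic (EFin \o a).

(* Hypothesis (g); partial derivatives in u and xi are Frechet derivatives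
   ('d), the one in t is the derivative 'D_1; operator norms in L(X,W)
   are unfolded. *)
Definition hypg {R : realType} {X W : normedModType R} (T : R)
  (g : R -> X -> X -> W) (a b : R -> R) (gam om Cxi Cu : R) :=
  [/\ {within `[0, T]%classic `*` setT `*` setT, continuous (fun p : R * X * X => g p.1.1 p.1.2 p.2)},
      forall t u xi, `[0, T]%classic t ->
        differentiable (g t u) xi /\ differentiable (fun u' => g t u' xi) u,
      forall t u xi, `]0, T[%classic t -> derivable (fun s => g s u xi) t 1,
      [/\ L1 T a, L1 T b & [/\ 0 < gam, 0 < om, 0 < Cxi & 0 < Cu]] &
      {ae @lebesgue_measure R, forall t, `]0, T[%classic t -> forall u v xi eta : X,
        [/\ [/\ forall h, `|'d (g t u) xi h| <= gam * `|h|,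
                forall h, `|'d (fun u' => g t u' xi) u h| <= om * `|h| &
                `|'D_1 (fun s => g s u xi) t| <= a t],
            forall h, `|'d (g t u) xi h - 'd (g t v) eta h|
                        <= Cxi * (`|u - v| + `|xi - eta|) * `|h|,
            forall h, `|'d (fun u' => g t u' xi) u h - 'd (fun u' => g t u' eta) v h|
                        <= Cu * (`|u - v| + `|xi - eta|) * `|h| &
            `|'D_1 (fun s => g s u xi) t - 'D_1 (fun s => g s v eta) t|
              <= b t * (`|u - v| + `|xi - eta|)]}].

Definition abs_cont {R : realType} {X : normedModType R} (T : R) (f : R -> X) :=
  forall e : R, 0 < e -> exists2 d : R, 0 < d &
    forall (n : nat) (a b : nat -> R),
      (forall i, (i < n)%N -> 0 <= a i /\ a i <= b i /\ b i <= T) ->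
      (forall i j, (i < j < n)%N -> b i <= a j) ->
      \sum_(i < n) (b i - a i) < d ->
      \sum_(i < n) `|f (b i) - f (a i)| < e.

(* W^{1,1}(0,T;X) for X a Hilbert space: absolutely continuous on [0,T]
   (hence a.e. differentiable with integrable derivative); the derivative
   is written 'D_1 f t. *)
Definition W11 {R : realType} {X : normedModType R} (T : R) (f : R -> X) :=
  abs_cont T f /\ {ae @lebesgue_measure R, forall t, `]0, T[%classic t -> derivable f t 1}.

(* xi is a solution of the state-dependent sweeping process with input u and
   initial condition x0, with r = c/lambda *)
Definition is_solution {R : realType} {X W : normedModType R} (ip : X -> X -> R)
  (G : X -> W -> R) (g : R -> X -> X -> W) (T r : R) (u : R -> X) (x0 : X)
  (xi : R -> X) :=
  [/\ W11 T xi,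
      forall t, `[0, T]%classic t -> Zset G (g t (u t) (xi t)) (u t - xi t),
      {ae @lebesgue_measure R, forall t, `]0, T[%classic t ->
         forall z, Zset G (g t (u t) (xi t)) z ->
           0 <= ip (u t - xi t - z) ('D_1 xi t)
                + `|'D_1 xi t| / (2 * r) * `|u t - xi t - z| ^+ 2} &
      u 0 - xi 0 = x0].

Definition Omega {R : realType} {X : normedModType R} (T : R) (u : R -> X) (x0 : X)
  (K1 c om delta : R) (a : R -> R) (eta : R -> X) :=
  [/\ W11 T eta, eta 0 = u 0 - x0 &
      {ae @lebesgue_measure R, forall t, `]0, T[%classic t ->
         `|'D_1 eta t| <= (1 - delta)^-1 * ((1 + om * K1 / c) * `|'D_1 u t| + K1 / c * a t)}].

(* Main.v *)
Require Import Defs.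
From HB Require Import structures.
From mathcomp Require Import all_boot all_order all_algebra.
From mathcomp Require Import all_classical all_reals all_analysis.
From mathcomp Require Import measurable_realfun ring lra.
Set Implicit Arguments. Unset Strict Implicit. Unset Printing Implicit Defensive.
Import Order.TTheory GRing.Theory Num.Theory.
Import numFieldNormedType.Exports.
Local Open Scope classical_set_scope.
Local Open Scope ring_scope.

(* Write Gam t xi = G (u t - xi) (g t (u t) xi) and P t xi for the partial
   gradient of G in x at the same point.  Level sets of G are prox-regular with
   constant c / lam: (iii) controls the gradient along pairs of level points, and
   a contradiction at an almost extremal pair globalises this.  Hence the
   variational inequality says that xi' = 0 where Gam < 1 and that xi' is a
   nonnegative multiple of P where Gam = 1.

   Uniqueness.  For two such trajectories x1, x2 the quantity
   c |x1 - x2| + |Gam x1 - Gam x2| has a.e. derivative at most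
   const * phi * |x1 - x2| with phi integrable: where both constraints are
   active, the derivative of Gam vanishes along each trajectory and this
   determines the normal speeds, and delta < 1 absorbs the dependence of Gam' on
   xi'.  Gronwall's lemma gives uniqueness, and, for trajectories whose velocity
   is only eps-close to the direction of P, an O(eps) comparison estimate.

   Existence.  On a short interval, moving along one fixed gradient direction by
   the least amount that restores Gam <= 1 gives an eps-trajectory; these are
   concatenated, are uniformly Cauchy as eps -> 0 by the comparison estimate, and
   the limit is dominated by a primitive, hence a.e. differentiable
   (Radon-Nikodym property of a Hilbert space), and inherits the slope
   condition. *)

(** Derivatives of vector-valued functions are never integrated. Trajectories are dominated by one
    scalar clock [M], the primitive of an integrable [phi], and every integral estimate is a mean
    value inequality that asks for a derivative bound almost everywhere and for no variation on null
    sets. The notion [null_variation] is chosen for this: besides absolutely continuous functions it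
    covers functions differentiable everywhere whose derivative need not be integrable. The state
    enters its own constraint, so [Gam'] contains the unknown velocity [d] twice: through [<P, d>]
    and, via [g], with a coefficient at most [K1 * gam = delta * c]. At an active point [|P| >= c],
    so the first effect wins by the margin [1 - delta]; this margin takes the place of a fixed point
    argument. Hypothesis (iii) compares a boundary point with a point of the set, but the segment
    between them may leave the set; it therefore cannot simply be integrated along that segment, and
    the prox inequality is first obtained locally with a higher order error. Since all constants are
    global, the admissible length of a catching-up step does not depend on the state where it
    starts, and finitely many steps cover [[0, T]]. *)

(* [lmod] proves identities in a module by reflecting both sides to formal
   linear combinations of atoms and comparing the coefficients with [ring]. *)
Section LmodReflection.
Variables (K : comPzRingType) (V : lmodType K).

Inductive lexpr :=
  | LVar of nat | LZero | LAdd of lexpr & lexpr | LOpp of lexpr | LScale of K & lexpr.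

Fixpoint leval (env : seq V) (e : lexpr) : V :=
  match e with
  | LVar n => nth 0 env n
  | LZero => 0
  | LAdd a b => leval env a + leval env b
  | LOpp a => - leval env a
  | LScale k a => k *: leval env a
  end.

(** Atoms are compared with [eqn] because [lmod_over] evaluates coefficients by a [cbn] restricted
    to a few constants, which would not unfold the generic [==]. *)
Fixpoint lcoef (e : lexpr) (i : nat) : K :=
  match e with
  | LVar n => if eqn i n then 1 else 0
  | LZero => 0
  | LAdd a b => lcoef a i + lcoef b i
  | LOpp a => - lcoef a i
  | LScale k a => k * lcoef a i
  end.

(** An index beyond [env] denotes the default 0 of [nth] and contributes nothing, so equality of the
    coefficients of index below [size env] is enough for equality of the values. *)
Lemma levalE env e : leval env e = \sum_(i < size env) lcoef e i *: nth 0 env i.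
Proof.
elim: e => [n||a IHa b IHb|a IHa|k a IHa] /=; rewrite ?IHa ?IHb.
- have [ns|ns] := ltnP n (size env); last first.
    rewrite nth_default // big1 // => i _.
    have -> : eqn i n = false by apply/negbTE/eqP => E; move: (ltn_ord i); rewrite E ltnNge ns.
    by rewrite scale0r.
  rewrite (bigD1 (Ordinal ns)) //= eqnE eqxx scale1r big1 ?addr0 // => i Hi.
  have -> : (i == n :> nat) = false by apply/negbTE; move: Hi; rewrite -val_eqE.
  by rewrite scale0r.
- by rewrite big1 // => i _; rewrite scale0r.
- by rewrite -big_split; apply: eq_bigr => i _; rewrite scalerDl.
- by rewrite -sumrN; apply: eq_bigr => i _; rewrite scaleNr.
- by rewrite scaler_sumr; apply: eq_bigr => i _; rewrite scalerA.
Qed.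

Fixpoint same_coefs (n : nat) (a b : lexpr) : Prop :=
  if n is n'.+1 then lcoef a n' = lcoef b n' /\ same_coefs n' a b else True.

Lemma same_coefsP n a b : same_coefs n a b -> forall i, (i < n)%N -> lcoef a i = lcoef b i.
Proof.
elim: n => [//|n IH] /= [Hn /IH Hs] i; rewrite ltnS leq_eqVlt => /orP[/eqP->//|]; exact: Hs.
Qed.

Lemma leval_same env a b : same_coefs (size env) a b -> leval env a = leval env b.
Proof.
by move=> H; rewrite !levalE; apply: eq_bigr => i _; rewrite (same_coefsP H).
Qed.

End LmodReflection.

Ltac lmod_add t l :=
  lazymatch l with
  | context [cons t _] => l
  | _ => constr:(cons t l)
  end.
Ltac lmod_atoms t l :=
  lazymatch t with
  | @Algebra.add _ ?a ?b => let l' := lmod_atoms a l in lmod_atoms b l'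
  | @Algebra.opp _ ?a => lmod_atoms a l
  | @GRing.scale _ _ _ ?a => lmod_atoms a l
  | @Algebra.zero _ => l
  | _ => lmod_add t l
  end.
Ltac lmod_index t l :=
  lazymatch l with
  | cons t _ => constr:(O)
  | cons _ ?l' => let n := lmod_index t l' in constr:(S n)
  end.
Ltac lmod_quote K t l :=
  lazymatch t with
  | @Algebra.add _ ?a ?b =>
      let a' := lmod_quote K a l in let b' := lmod_quote K b l in constr:(@LAdd K a' b')
  | @Algebra.opp _ ?a => let a' := lmod_quote K a l in constr:(@LOpp K a')
  | @GRing.scale _ _ ?k ?a => let a' := lmod_quote K a l in constr:(@LScale K k a')
  | @Algebra.zero _ => constr:(@LZero K)
  | _ => let n := lmod_index t l in constr:(@LVar K n)
  end.
Ltac lmod_over K V :=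
  lazymatch goal with
  | |- ?a = ?b =>
    let l := lmod_atoms a (@nil (GRing.Lmodule.sort V)) in
    let l := lmod_atoms b l in
    let a' := lmod_quote K a l in let b' := lmod_quote K b l in
    change (@leval K V l a' = @leval K V l b');
    apply: leval_same; cbn [same_coefs size lcoef eqn]; repeat split; try ring; try (field; lra)
  end.
Ltac lmod :=
  lazymatch goal with
  | |- @eq (@NormedModule.sort (reals_Real__to__Num_NumDomain ?R) ?V) _ _ =>
     lmod_over (R : comPzRingType) (V : lmodType R)
  | R : realType |- @eq ?T _ _ => lmod_over (R : comPzRingType) (T : lmodType R)
  end.

(* [lra] processes every hypothesis; [lra_with h1 .. hn] hides the order
   hypotheses other than [h1 .. hn] first. *)
Ltac drop_order_hyps := repeat match goal with H : is_true _ |- _ => clear H end.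
Tactic Notation "lra_with" hyp_list(hs) := revert hs; drop_order_hyps; lra.

(** * Real induction and mean value inequalities from almost everywhere information *)

(** The supremum of the points [s] with [F s <= F a] can be reached and passed: the local hypothesis
    there compares a point of the set just to its left with any point just to its right. Comparing
    only across [t] matches what a derivative at [t] alone provides. *)
Lemma creeping (R : realType) (a b : R) (F : R -> R) : a <= b ->
  (forall t, a <= t <= b -> exists2 eta, 0 < eta &
     forall x y, a <= x -> x <= t -> t <= y -> y <= b -> t - eta < x -> y < t + eta ->
       F y <= F x) ->
  F b <= F a.
Proof.
move=> ab H.
pose S := [set s | a <= s <= b /\ F s <= F a].
have Sa : S a by split => //; rewrite lexx.
have Sub : ubound S b by move=> s [/andP[_ ->]].
have hS : has_sup S by split; [exists a | exists b].
have sa : a <= sup S by apply: ub_le_sup => //; exists b.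
have sb : sup S <= b by apply: ge_sup => //; exists a.
have [|eta eta0 He] := H (sup S); first by rewrite sa sb.
have [s [/andP[as_ sb'] Fs] slt] := sup_adherent eta0 hS.
have ssup : s <= sup S by apply: ub_le_sup; [exists b | split => //; rewrite as_ sb'].
have key y : sup S <= y -> y <= b -> y < sup S + eta -> S y.
  move=> sy yb yl; split; first by rewrite yb (le_trans sa).
  by apply: le_trans Fs; apply: He => //.
have [bs|bs] := leP b (sup S).
  have e : sup S = b by lra.
  have [//|] := key b sb (lexx b); last by [].
  by rewrite e; lra.
pose y := Num.min b (sup S + eta / 2).
have ysup : sup S < y by rewrite /y lt_min bs /=; lra.
have yb : y <= b by rewrite /y ge_min lexx.
have : y <= sup S.
  apply: ub_le_sup; [by exists b | apply: key => //; first exact: ltW].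
  have : y <= sup S + eta / 2 by rewrite /y ge_min lexx orbT.
  lra.
lra.
Qed.

Lemma window_min (R : realType) (t x y r1 r2 : R) :
  t - Num.min r1 r2 < x -> y < t + Num.min r1 r2 ->
  [/\ t - r1 < x, y < t + r1, t - r2 < x & y < t + r2].
Proof.
rewrite ltrBlDr -ltrBlDl lt_min => /andP[h1 h2].
rewrite -ltrBlDl lt_min => /andP[h3 h4].
by split; rewrite 1?ltrBlDr -?ltrBlDl // addrC -ltrBlDr.
Qed.

Section almost_everywhere.
Variables (R : realType).

Definition has_derivative (V : normedModType R) (f : R -> V) (t : R) (d : V) :=
  forall e, 0 < e -> exists2 eta, 0 < eta & forall s, `|s - t| < eta ->
    `|f s - f t - (s - t) *: d| <= e * `|s - t|.

(** Says that [f] has no variation on Lebesgue null sets: [chi] is a monotone majorant of small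
    total increase which pays for all short intervals around points of [N]. *)
Definition null_variation (V : normedModType R) (a b : R) (f : R -> V) :=
  forall N : set R, (@lebesgue_measure R).-negligible N -> forall e, 0 < e ->
  exists chi : R -> R,
   [/\ (forall x y, a <= x -> x <= y -> y <= b -> chi x <= chi y),
       chi b - chi a <= e &
       forall t, N t -> a <= t <= b -> exists2 eta, 0 < eta &
       forall x y, a <= x -> x <= t -> t <= y -> y <= b -> t - eta < x -> y < t + eta ->
       `|f y - f x| <= chi y - chi x].

Lemma null_variation_le (V V' : normedModType R) a b (f : R -> V) (h : R -> V') (K : R) :
  0 < K ->
  (forall x y, a <= x -> x <= y -> y <= b -> `|h y - h x| <= K * `|f y - f x|) ->
  null_variation a b f -> null_variation a b h.
Proof.
move=> K0 H Nf N nN e e0.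
have [|chi [c1 c2 c3]] := Nf N nN (e / K); first by rewrite divr_gt0.
exists (fun t => K * chi t); split.
- by move=> x y ax xy yb; rewrite ler_pM2l //; exact: c1.
- by rewrite -mulrBr mulrC -ler_pdivlMr.
- move=> t Nt tab; have [eta eta0 He] := c3 t Nt tab; exists eta => // x y ax xt ty yb t1 t2.
  apply: le_trans (H x y _ _ _) _ => //; first exact: le_trans ty.
  by rewrite -mulrBr ler_pM2l //; exact: He.
Qed.

Lemma null_variation_sub (V : normedModType R) a b a' b' (f : R -> V) :
  a <= a' -> a' <= b' -> b' <= b -> null_variation a b f -> null_variation a' b' f.
Proof.
move=> aa ab bb Nf N nN e e0.
have [chi [c1 c2 c3]] := Nf N nN e e0; exists chi; split.
- by move=> x y ax xy yb; apply: c1 => //; lra.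
- have := c1 a a' (lexx _) aa; have := c1 b' b; move=> /(_ _ _ _)/[dup] h1 h2.
  have q1 : chi b' <= chi b by apply: h1; lra.
  have q2 : chi a <= chi a' by apply: c1; lra.
  lra.
- move=> t Nt /andP[t1 t2]; have [|eta eta0 He] := c3 t Nt; first by apply/andP; split; lra.
  exists eta => // x y *; apply: He => //; lra.
Qed.

(** Creeping is applied to [F - Psi - chi - k t]: at points of the null set the increase of [F] is
    paid by [chi], elsewhere by [Psi] and the small slope [k]. *)
Lemma ae_upper_derivative_le (a b : R) (F Psi : R -> R) : a <= b ->
  null_variation a b F ->
  (forall x y, a <= x -> x <= y -> y <= b -> Psi x <= Psi y) ->
  {ae @lebesgue_measure R, forall t, a < t < b -> forall e, 0 < e ->
     exists2 eta, 0 < eta & forall x y, a <= x -> x <= t -> t <= y -> y <= b ->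
       t - eta < x -> y < t + eta -> F y - F x <= Psi y - Psi x + e * (y - x)} ->
  F b - F a <= Psi b - Psi a.
Proof.
move=> ab nF mP [N0 [mN0 N00 sN0]].
apply/ler_addgt0Pr => e e0.
(* The end points join the null set because the derivative hypothesis concerns interior points
   only. *)
pose N := N0 `|` [set a] `|` [set b].
have nN : (@lebesgue_measure R).-negligible N.
  apply: negligibleU; first apply: negligibleU.
  - by exists N0; split.
  - by exists [set a]; split => //; exact: lebesgue_measure_set1.
  - by exists [set b]; split => //; exact: lebesgue_measure_set1.
have e1 : 0 < e / 2 by lra.
have [chi [c1 c2 c3]] := nF N nN _ e1.
(* The [+ 1] covers the case [a = b]. *)
pose k := e / 2 / (b - a + 1).
have k0 : 0 < k by rewrite /k divr_gt0 //; lra.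
have kb : k * (b - a) <= e / 2.
  rewrite /k mulrAC ler_pdivrMr; last lra.
  rewrite ler_pM2l //; lra.
suff : F b - Psi b - chi b - k * b <= F a - Psi a - chi a - k * a.
  have := kb; rewrite mulrBr; lra.
apply: (@creeping _ a b (fun t => F t - Psi t - chi t - k * t)) => //.
move=> t /andP[at_ tb]; have [tN|tN] := pselect (N t).
  have [|eta eta0 He] := c3 t tN; first by rewrite at_ tb.
  exists eta => // x y ax xt ty yb t1 t2.
  have h1 := He x y ax xt ty yb t1 t2.
  have h2 := ler_norm (F y - F x).
  have h3 : Psi x <= Psi y by apply: mP => //; lra.
  have h4 : k * x <= k * y by rewrite ler_pM2l //; lra.
  lra.
have tg : a < t < b.
  rewrite !lt_neqAle at_ tb !andbT; apply/andP; split; apply/eqP => E; apply: tN.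
    by left; right; rewrite E.
  by right.
have gt : forall e, 0 < e ->
     exists2 eta, 0 < eta & forall x y, a <= x -> x <= t -> t <= y -> y <= b ->
       t - eta < x -> y < t + eta -> F y - F x <= Psi y - Psi x + e * (y - x).
  move=> e' e'0; apply: contrapT => Hn; apply: tN; left; left; apply: sN0 => /= Hc.
  by apply: Hn; exact: Hc.
have [eta eta0 He] := gt k k0.
exists eta => // x y ax xt ty yb t1 t2.
have h1 := He x y ax xt ty yb t1 t2.
have h3 : chi x <= chi y by apply: c1 => //; lra.
move: h1; rewrite mulrBr; lra.
Qed.

Lemma ae_imply (P Q : R -> Prop) : {ae @lebesgue_measure R, forall t, P t} ->
  (forall t, P t -> Q t) -> {ae @lebesgue_measure R, forall t, Q t}.
Proof.
have F := ae_filter_ringOfSetsType (@lebesgue_measure R).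
by move=> H PQ; apply: filterS H.
Qed.

Lemma ae_and (P Q : R -> Prop) : {ae @lebesgue_measure R, forall t, P t} ->
  {ae @lebesgue_measure R, forall t, Q t} ->
  {ae @lebesgue_measure R, forall t, P t /\ Q t}.
Proof.
have F := ae_filter_ringOfSetsType (@lebesgue_measure R).
by move=> HP HQ; apply: filterI.
Qed.

(** The scalar inequality is applied to the distance from [f a], whose increments are at most those
    of [f] in norm. *)
Lemma ae_mean_value_ineq (V : normedModType R) (a b : R) (f : R -> V) (Psi : R -> R) : a <= b ->
  null_variation a b f ->
  (forall x y, a <= x -> x <= y -> y <= b -> Psi x <= Psi y) ->
  {ae @lebesgue_measure R, forall t, a < t < b -> forall e, 0 < e ->
     exists2 eta, 0 < eta & forall x y, a <= x -> x <= t -> t <= y -> y <= b ->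
       t - eta < x -> y < t + eta -> `|f y - f x| <= Psi y - Psi x + e * (y - x)} ->
  `|f b - f a| <= Psi b - Psi a.
Proof.
move=> ab nf mP H.
have tri x y : `|f y - f a| - `|f x - f a| <= `|f y - f x|.
  have := lerB_dist (f y - f a) (f x - f a).
  by rewrite opprB addrA subrK.
have := @ae_upper_derivative_le a b (fun t => `|f t - f a|) Psi ab.
rewrite subrr normr0 subr0; apply => //.
  apply: null_variation_le nf; first exact: ltr01.
  move=> x y _ _ _; rewrite mul1r ler_norml tri andbT.
  have := tri y x; rewrite [`|f x - f y|]distrC; lra.
apply: (ae_imply H) => t Ht tab e e0; have [eta eta0 He] := Ht tab e e0.
by exists eta => // x y *; apply: le_trans (tri _ _) _; exact: He.
Qed.

(** The errors at both ends add up to a multiple of [|y - t| + |x - t| = y - x], because [t] lies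
    between [x] and [y]. *)
Lemma has_derivative_straddle (V : normedModType R) (f : R -> V) t d : has_derivative f t d ->
  forall e, 0 < e -> exists2 eta, 0 < eta &
    forall x y, x <= t -> t <= y -> t - eta < x -> y < t + eta ->
      `|f y - f x - (y - x) *: d| <= e * (y - x).
Proof.
move=> H e e0; have [eta eta0 He] := H e e0; exists eta => // x y xt ty h1 h2.
have E : f y - f x - (y - x) *: d
    = (f y - f t - (y - t) *: d) - (f x - f t - (x - t) *: d) by lmod.
rewrite E (le_trans (ler_normB _ _)) //.
have -> : e * (y - x) = e * `|y - t| + e * `|x - t|.
  by rewrite ger0_norm ?ler0_norm; lra.
by apply: lerD; apply: He; rewrite ltr_norml; lra.
Qed.

Lemma has_derivative_norm_straddle (V : normedModType R) (f : R -> V) t d K : has_derivative f t d ->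
  `|d| <= K ->
  forall e, 0 < e -> exists2 eta, 0 < eta &
    forall x y, x <= t -> t <= y -> t - eta < x -> y < t + eta ->
      `|f y - f x| <= (K + e) * (y - x).
Proof.
move=> H dK e e0; have [eta eta0 He] := has_derivative_straddle H e0.
exists eta => // x y xt ty h1 h2; have := He x y xt ty h1 h2 => h3.
have yx : 0 <= y - x by lra.
rewrite -[f y - f x](subrK ((y - x) *: d)) (le_trans (ler_normD _ _)) //.
rewrite normrZ (ger0_norm yx).
have : (y - x) * `|d| <= (y - x) * K by rewrite ler_wpM2l.
lra.
Qed.

End almost_everywhere.

(** * Pointwise derivatives and their algebra *)

Section derivatives.
Variable R : realType.

(** The quotient [q] is abstract, known only by an equation, because quotients occur in several
    syntactic shapes: [derivable], directional derivatives of a differential, Gateaux gradients. *)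
Lemma cvg_quotientP (V : normedModType R) (f : R -> V) t d (q : R -> V) :
  (forall h, q h = h^-1 *: (f (t + h) - f t)) ->
  (q @ 0^' --> d <-> has_derivative f t d).
Proof.
move=> qE; split=> [/cvgrPdist_le H e e0|H].
  have := H e e0; rewrite near_withinE => /nbhs_ballP[eta /= eta0 He].
  exists eta => // s st.
  have [->|nst] := eqVneq s t; first by rewrite !subrr scale0r subr0 !normr0 mulr0.
  have h0 : s - t != 0 by rewrite subr_eq0.
  have := He (s - t); rewrite /ball /= sub0r normrN => /(_ st h0).
  rewrite qE [t + _]addrC subrK => h.
  have -> : f s - f t - (s - t) *: d = - ((s - t) *: (d - (s - t)^-1 *: (f s - f t))).
    by rewrite scalerBr scalerA divff // scale1r opprB.
  by rewrite normrN normrZ mulrC ler_wpM2r.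
apply/cvgrPdist_le => e e0; rewrite near_withinE; apply/nbhs_ballP.
have [eta eta0 He] := H e e0; exists eta => //= h.
rewrite /ball /= sub0r normrN => hs h0.
have := He (t + h); rewrite [t + h]addrC addrK => /(_ hs) h1.
rewrite qE [t + h]addrC.
have -> : d - h^-1 *: (f (h + t) - f t) = - (h^-1 *: (f (h + t) - f t - h *: d)).
  by rewrite [in RHS]scalerBr scalerA mulVf // scale1r opprB.
rewrite normrN normrZ normfV ler_pdivrMl ?normr_gt0 //.
by rewrite mulrC.
Qed.

Lemma derivable_has_derivative (V : normedModType R) (f : R -> V) t :
  derivable f t 1 -> has_derivative f t ('D_1 f t).
Proof.
move=> H; pose q h := h^-1 *: ((f \o shift t) (h *: 1) - f t).
have qE h : q h = h^-1 *: (f (t + h) - f t) by rewrite /q /= [h *: 1]mulr1 [t + h]addrC.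
exact: (cvg_quotientP _ qE).1 H.
Qed.

Lemma has_derivativeE (V : normedModType R) (f : R -> V) t d :
  has_derivative f t d -> derivable f t 1 /\ 'D_1 f t = d.
Proof.
move=> H.
have H' : (fun h : R => h^-1 *: ((f \o shift t) (h *: 1) - f t)) @ 0^' --> d.
  apply: (cvg_quotientP _ _).2 H => h /=; by rewrite [h *: 1]mulr1 [t + h]addrC.
by split; [apply/cvg_ex; exists d | apply/cvg_lim].
Qed.

Lemma has_derivative_unique (V : normedModType R) (f : R -> V) t d d' :
  has_derivative f t d -> has_derivative f t d' -> d = d'.
Proof. by move=> /has_derivativeE[_ <-] /has_derivativeE[_ <-]. Qed.

Lemma has_derivative_ext (V : normedModType R) (f f' : R -> V) t d r : 0 < r ->
  (forall s, `|s - t| < r -> f s = f' s) ->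
  has_derivative f t d -> has_derivative f' t d.
Proof.
move=> r0 E H e e0; have [eta eta0 He] := H e e0.
exists (Num.min r eta) => [|s]; rewrite ?lt_min ?r0 // => /andP[sr se].
by rewrite -!E ?subrr ?normr0 //; exact: He.
Qed.

Lemma has_derivativeD (V : normedModType R) (f f' : R -> V) t d d' :
  has_derivative f t d -> has_derivative f' t d' ->
  has_derivative (fun s => f s + f' s) t (d + d').
Proof.
move=> H H' e e0; have e2 : 0 < e / 2 by lra.
have [r r0 Hr] := H _ e2; have [r' r'0 Hr'] := H' _ e2.
exists (Num.min r r') => [|s]; rewrite ?lt_min ?r0 // => /andP[sr sr'].
have -> : f s + f' s - (f t + f' t) - (s - t) *: (d + d')
  = (f s - f t - (s - t) *: d) + (f' s - f' t - (s - t) *: d') by lmod.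
apply: le_trans (ler_normD _ _) _.
have := Hr s sr; have := Hr' s sr'; lra.
Qed.

Lemma has_derivativeZ (V : normedModType R) (f : R -> V) (k : R) t d :
  has_derivative f t d -> has_derivative (fun s => k *: f s) t (k *: d).
Proof.
move=> H e e0; pose K := `|k| + 1.
have K0 : 0 < K by rewrite /K; have := normr_ge0 k; lra.
have [|r r0 Hr] := H (e / K); first exact: divr_gt0.
exists r => // s sr.
have -> : k *: f s - k *: f t - (s - t) *: (k *: d) = k *: (f s - f t - (s - t) *: d) by lmod.
rewrite normrZ; have := Hr s sr; have := normr_ge0 (f s - f t - (s - t) *: d).
set n := `|f s - _ - _| => n0 h.
apply: (@le_trans _ _ (K * n)); first by rewrite ler_wpM2r // /K; lra.
by rewrite -ler_pdivlMl // mulrA [_^-1 * e]mulrC.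
Qed.

Lemma has_derivative_id (t : R) : has_derivative (fun s : R => s) t 1.
Proof.
by move=> e e0; exists 1 => // s _; rewrite [_ *: _]mulr1 subrr normr0 mulr_ge0 // ltW.
Qed.

Lemma has_derivative_cst (V : normedModType R) (v : V) (t : R) : has_derivative (fun=> v) t 0.
Proof.
by move=> e e0; exists 1 => // s _; rewrite scaler0 subrr subr0 normr0 mulr_ge0 // ltW.
Qed.

Lemma has_derivative_continuous (V : normedModType R) (f : R -> V) t d :
  has_derivative f t d -> forall e, 0 < e -> exists2 eta, 0 < eta &
    forall s, `|s - t| < eta -> `|f s - f t| < e.
Proof.
move=> H e e0; have [r r0 Hr] := H 1 ltr01.
pose K := `|d| + 2; have K0 : 0 < K by rewrite /K; have := normr_ge0 d; lra.
exists (Num.min r (e / K)) => [|s]; first by rewrite lt_min r0 divr_gt0.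
rewrite lt_min => /andP[sr se].
rewrite -[f s - f t](subrK ((s - t) *: d)); apply: le_lt_trans (ler_normD _ _) _.
rewrite normrZ; have := Hr s sr; rewrite mul1r => h.
apply: (@le_lt_trans _ _ (`|s - t| * (K - 1))); first by rewrite /K; lra.
move: se; rewrite ltr_pdivlMr // => se; apply: le_lt_trans se.
rewrite ler_wpM2l //; lra.
Qed.

End derivatives.

(** * Primitives of integrable functions on the line *)

Section primitive.
Variable R : realType.
Notation mu := (@lebesgue_measure R).

Definition L1T (f : R -> R) := mu.-integrable setT (EFin \o f).

Lemma L1T_integrable f (D : set R) : measurable D -> L1T f -> mu.-integrable D (EFin \o f).
Proof. by move=> mD If; apply: integrableS If. Qed.

Lemma L1T_restrict f (D : set R) : measurable D -> L1T f -> L1T (f \_ D).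
Proof.
move=> mD If; rewrite /L1T (_ : EFin \o (f \_ D) = (EFin \o f) \_ D); last first.
  by apply/funext => x; rewrite /patch /=; case: ifP.
exact: (@integrable_mkcond _ _ _ mu D (EFin \o f) mD).1 (L1T_integrable mD If).
Qed.

Definition primitive (f : R -> R) (t : R) : R := \int[mu]_(x in `]-oo, t]) f x.

Lemma primitiveB f s t : L1T f -> s <= t ->
  primitive f t - primitive f s = \int[mu]_(x in `]s, t]) f x.
Proof.
move=> If st; rewrite /primitive Rintegral_itvB //.
exact: L1T_integrable.
Qed.

Lemma primitive_derivative f : L1T f ->
  {ae mu, forall t, has_derivative (primitive f) t (f t)}.
Proof.
move=> If.
have I1 y : mu.-integrable `]-oo, y] (EFin \o f) by exact: L1T_integrable.
have I2 : locally_integrable [set: R] f.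
  by apply: open_integrable_locally; [exact: openT | exact: If].
apply: (ae_imply (FTC1Ny I1 I2)).
by move=> t [/derivable_has_derivative]; rewrite derive1E => h <-.
Qed.

Lemma primitive_le f s t : L1T f -> (forall x, 0 <= f x) -> s <= t ->
  primitive f s <= primitive f t.
Proof.
move=> If f0 st; rewrite -subr_ge0 primitiveB //; exact: Rintegral_ge0.
Qed.

Lemma Rintegral_abs_continuous f : L1T f -> (forall x, 0 <= f x) ->
  forall e, 0 < e -> exists2 d : R, 0 < d & forall A, measurable A ->
    (mu A < d%:E)%E -> \int[mu]_(x in A) f x < e.
Proof.
move=> If f0 e e0; have [d [d0 H]] := integral_normr_continuous If e0.
exists d => // A mA /(H A mA); rewrite (_ : (fun x => _) = f) //.
by apply/funext => x; rewrite ger0_norm.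
Qed.

Lemma negligible_open_cover (N : set R) : mu.-negligible N -> forall d : R, 0 < d ->
  exists U : set R, [/\ open U, N `<=` U & (mu U < d%:E)%E].
Proof.
move=> /negligible_outer_measure N0 d d0.
have d2 : 0 < d / 2 by lra.
have [U [oU NU mU]] := outer_measure_open_le N d2.
exists U; split => //; apply: le_lt_trans mU _.
by rewrite N0 add0e lte_fin; lra.
Qed.

(** [chi] is the primitive of [f] cut off to an open [U] containing [N] on which [f] has integral
    below [e]; near a point of [N] the interval lies inside [U], where the cut-off changes
    nothing. *)
Lemma primitive_null_variation f a b : L1T f -> (forall x, 0 <= f x) ->
  null_variation a b (primitive f).
Proof.
move=> If f0 N nN e e0.
have [d d0 Hd] := Rintegral_abs_continuous If f0 e0.
have [U [oU NU mU]] := negligible_open_cover nN d0.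
have mUm : measurable U by exact: measurable_realfun.open_measurable.
pose h := f \_ U.
have Ih: L1T h by exact: L1T_restrict.
have h_ge0 x : 0 <= h x by rewrite /h patchE; case: ifP.
exists (primitive h); split.
- by move=> x y _ xy _; exact: primitive_le.
- have [ab|ba] := leP a b; last first.
    by apply: le_trans (ltW e0); rewrite subr_le0 primitive_le // ltW.
  rewrite primitiveB //; apply: le_trans (ltW (Hd U mUm mU)).
  rewrite /h -Rintegral_mkcondr setIC Rintegral_mkcondr.
  rewrite [leRHS](_ : _ = \int[mu]_(x in U) f x) //.
  apply: le_Rintegral => //.
  + by apply: L1T_integrable => //; exact: L1T_restrict.
  + exact: L1T_integrable.
  + by move=> x _; rewrite patchE; case: ifP.
- move=> t Nt _.
  have /nbhs_ballP[eta /= eta0 He] : nbhs t U by apply: open_nbhs_nbhs; split => //; exact: NU.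
  exists eta => // x y _ xt ty _ hx hy.
  have xy : x <= y by exact: le_trans ty.
  rewrite !primitiveB // /h -Rintegral_mkcondr ger0_norm; last exact: Rintegral_ge0.
  rewrite (_ : `]x, y] `&` U = `]x, y]%classic) //.
  apply/setIidPl => z /=; rewrite in_itv /= => /andP[xz zy]; apply: He.
  by rewrite /ball /= ltr_norml; apply/andP; split; lra.
Qed.

End primitive.

Lemma le_lebesgue_measure (R : realType) (A B : set R) : measurable A -> measurable B ->
  A `<=` B -> (lebesgue_measure A <= lebesgue_measure B)%E.
Proof. by move=> mA mB AB; apply: le_measure => //; rewrite inE. Qed.

(** * Finite ordered families of intervals *)

Section families.
Variable R : realType.
Notation mu := (@lebesgue_measure R).
Variables (a b : nat -> R).

Definition ordered_family n :=
  (forall i, (i < n)%N -> a i <= b i) /\ (forall i j, (i < j < n)%N -> b i <= a j).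

Definition family_union n : set R := \big[setU/set0]_(i < n) `]a i, b i]%classic.

Lemma ordered_familyW n : ordered_family n.+1 -> ordered_family n.
Proof.
move=> [h1 h2]; split=> [i /ltnW/h1//|i j /andP[ij jn]].
by apply: h2; rewrite ij ltnW.
Qed.

Lemma measurable_family_union n : measurable (family_union n).
Proof. by apply: bigsetU_measurable => i _; exact: measurable_itv. Qed.

Lemma family_union_disjoint n : ordered_family n.+1 ->
  family_union n `&` `]a n, b n] = set0.
Proof.
move=> [_ h]; rewrite -subset0 => x [].
rewrite /family_union -(bigcup_mkord n (fun i => `]a i, b i]%classic)) => -[i /= ni].
rewrite !in_itv /= => /andP[_ xb] /andP[ax _].
have := h i n; rewrite ni ltnSn => /(_ isT); lra.
Qed.

Lemma measure_family_union n : ordered_family n ->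
  mu (family_union n) = (\sum_(i < n) (b i - a i))%:E.
Proof.
elim: n => [|n IH] hn; first by rewrite /family_union !big_ord0 measure0.
transitivity (mu (family_union n) + mu `]a n, b n]%classic)%E.
  rewrite /family_union big_ord_recr /=; apply: measureU.
  - exact: measurable_family_union.
  - exact: measurable_itv.
  - exact: family_union_disjoint.
rewrite IH; last exact: ordered_familyW.
rewrite big_ord_recr EFinD; congr (_ + _)%E; rewrite lebesgue_measure_itv /= lte_fin.
have [h _] := hn; have := h n (ltnSn n); rewrite le_eqVlt => /orP[/eqP->|->//].
by rewrite ltxx subrr.
Qed.

Lemma Rintegral_family_union f n : L1T f -> ordered_family n ->
  \int[mu]_(x in family_union n) f x = \sum_(i < n) (primitive f (b i) - primitive f (a i)).
Proof.
move=> If; elim: n => [|n IH] hn; first by rewrite /family_union !big_ord0 Rintegral_set0.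
transitivity (\int[mu]_(x in family_union n) f x + \int[mu]_(x in `]a n, b n]) f x).
  rewrite {1}/family_union big_ord_recr /= -/(family_union n); apply: Rintegral_setU.
  - exact: measurable_family_union.
  - exact: measurable_itv.
  - apply: L1T_integrable => //; apply: measurableU; last exact: measurable_itv.
    exact: measurable_family_union.
  - by apply/eqP; exact: family_union_disjoint.
rewrite IH; last exact: ordered_familyW.
by rewrite big_ord_recr; congr (_ + _); rewrite primitiveB //; case: hn => h _; exact: h.
Qed.

End families.

(** * Absolutely continuous and everywhere differentiable functions on null sets *)

Section absolute_continuity.
Variable R : realType.
Notation mu := (@lebesgue_measure R).

Lemma primitive_abs_cont (V : normedModType R) T (f : R -> V) (phi : R -> R) :
  L1T phi -> (forall x, 0 <= phi x) ->
  (forall s t, 0 <= s -> s <= t -> t <= T -> `|f t - f s| <= primitive phi t - primitive phi s) ->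
  abs_cont T f.
Proof.
move=> Ip p0 H e e0; have [d d0 Hd] := Rintegral_abs_continuous Ip p0 e0.
exists d => // n a b hab hord hsum.
have of_ : ordered_family a b n.
  by split=> // i /hab[_ []].
have := Hd _ (measurable_family_union a b n).
rewrite measure_family_union // lte_fin => /(_ hsum).
rewrite Rintegral_family_union //; apply: le_lt_trans; apply: ler_sum => i _.
by have [? [? ?]] := hab i (ltn_ord i); exact: H.
Qed.

(** [chi t] is the variation of [f] over finite families of intervals contained in a small open [U]
    around [N] and ending before [t]. Such families have total length below [d], so absolute
    continuity bounds [chi] by [e]. *)
Lemma abs_cont_null_variation (V : normedModType R) T (f : R -> V) :
  0 <= T -> abs_cont T f -> null_variation 0 T f.
Proof.
move=> T0 Hf N nN e e0.
have [d d0 Hd] := Hf e e0.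
have [U [oU NU mU]] := negligible_open_cover nN d0.
pose fam t (n : nat) (a b : nat -> R) :=
  [/\ ordered_family a b n, (forall i, (i < n)%N -> 0 <= a i /\ b i <= t) &
      forall i, (i < n)%N -> `[a i, b i]%classic `<=` U].
pose S t := [set x | exists n a b, fam t n a b /\ x = \sum_(i < n) `|f (b i) - f (a i)|].
have S0 t : S t 0.
  exists 0%N, (fun=> 0), (fun=> 0); split; last by rewrite big_ord0.
  by split => //; split => //= i j; rewrite ltn0 andbF.
have Sub t : t <= T -> forall x, S t x -> x <= e.
  move=> tT x [n [a [b [[h1 h2 h3] ->]]]]; apply/ltW/Hd.
  - move=> i ni; have [??] := h2 i ni; have [h4 _] := h1; have := h4 i ni.
    by split=> //; split=> //; lra.
  - by have [_ h] := h1.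
  - rewrite -lte_fin -measure_family_union //; apply: le_lt_trans mU.
    apply: le_lebesgue_measure; first exact: measurable_family_union.
      exact: measurable_realfun.open_measurable.
    rewrite /family_union -(bigcup_mkord n (fun i => `]a i, b i]%classic)) => z [i /= ni].
    rewrite in_itv /= => /andP[ax xb]; apply: (h3 i ni) => /=.
    by rewrite in_itv /= (ltW ax).
have hs t : t <= T -> has_sup (S t).
  by move=> tT; split; [exists 0 | exists e => x /Sub; apply].
(* An interval [[x, y]] inside [U] can be appended to any family that ends before [x], so [chi]
   grows across it by at least the increment of [f]. *)
have step x y : 0 <= x -> x <= y -> y <= T -> `[x, y]%classic `<=` U ->
    sup (S x) + `|f y - f x| <= sup (S y).
  move=> x0 xy yT xyU; rewrite -lerBrDr; apply: ge_sup; first by exists 0.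
  move=> _ [n [a [b [[[h1 h1'] h2 h3] ->]]]]; rewrite lerBrDr.
  apply: ub_le_sup; first by case: (hs y yT).
  pose a' i := if (i < n)%N then a i else x; pose b' i := if (i < n)%N then b i else y.
  exists n.+1, a', b'; split; last first.
    rewrite big_ord_recr /= /a' /b' ltnn; congr (_ + _).
    by apply: eq_bigr => i _; rewrite ltn_ord.
  split; first split.
  - by move=> i; rewrite ltnS leq_eqVlt /a' /b' => /orP[/eqP->|ni]; rewrite ?ltnn // ni h1.
  - move=> i j /andP[ij]; rewrite ltnS leq_eqVlt /a' /b' => /orP[/eqP jn|jn].
      by rewrite -jn ij ltnn; case: (h2 i); rewrite -?jn.
    by rewrite (ltn_trans ij jn) jn; apply: h1'; rewrite ij.
  - move=> i; rewrite ltnS leq_eqVlt /a' /b' => /orP[/eqP->|ni]; first by rewrite ltnn.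
    by rewrite ni; have [? ?] := h2 i ni; split => //; lra.
  - move=> i; rewrite ltnS leq_eqVlt /a' /b' => /orP[/eqP->|ni]; first by rewrite ltnn.
    by rewrite ni; exact: h3.
exists (fun t => sup (S t)); split.
- move=> x y x0 xy yT; apply: ge_sup; first by exists 0.
  move=> z [n [a [b [[h1 h2 h3] ->]]]]; apply: ub_le_sup; first by case: (hs y yT).
  exists n, a, b; split => //; split => // i ni; have [? ?] := h2 i ni; split => //; lra.
- have : sup (S T) <= e by apply: ge_sup; [exists 0 | exact: Sub].
  have : 0 <= sup (S 0) by apply: ub_le_sup; [case: (hs 0 T0) | exact: S0].
  lra.
- move=> t Nt _.
  have /nbhs_ballP[eta /= eta0 He] : nbhs t U by apply: open_nbhs_nbhs; split => //; exact: NU.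
  exists eta => // x y x0 xt ty yT hx hy.
  have := step x y x0 (le_trans xt ty) yT.
  rewrite -subr_ge0 addrC => h; rewrite -subr_ge0.
  have : `[x, y]%classic `<=` U.
    move=> z /=; rewrite in_itv /= => /andP[xz zy]; apply: He.
    by rewrite /ball /= ltr_norml; apply/andP; split; lra.
  by move=> /h; lra.
Qed.

(** The derivative is finite at each point but has no common bound. Open sets [U n] around [N] of
    measure below [e / 2 ^+ n.+1] are stacked, and [chi t] sums the measures of [U n] up to [t]. At
    a point with [|d| + 1 <= k], a neighbourhood lies in the first [k] sets, so [chi] has slope at
    least [k] there and dominates [f]. *)
Lemma differentiable_null_variation (V : normedModType R) (a b : R) (f : R -> V) : a <= b ->
  (forall t, a <= t <= b -> exists d, has_derivative f t d) -> null_variation a b f.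
Proof.
move=> ab Hf N nN e e0.
pose dn (n : nat) : R := e / 2 ^+ n.+1.
have dn0 n : 0 < dn n by rewrite divr_gt0 // exprn_gt0.
pose U n := sval (cid (negligible_open_cover nN (dn0 n))).
have PU n : [/\ open (U n), N `<=` U n & (mu (U n) < (dn n)%:E)%E].
  by rewrite /U; case: cid.
have mUn n : measurable (U n) by apply: measurable_realfun.open_measurable; case: (PU n).
pose c n t : R := fine (mu (U n `&` `]a, t])).
have mI n t : measurable (U n `&` `]a, t]) by apply: measurableI => //; exact: measurable_itv.
have fin n t : mu (U n `&` `]a, t]) \is a fin_num.
  rewrite ge0_fin_numE //; case: (PU n) => _ _ h; apply: le_lt_trans (lt_trans h (ltry _)).
  by apply: le_lebesgue_measure => //; exact: subIsetl.
have c0 n t : 0 <= c n t by apply: fine_ge0.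
have cle n t : c n t <= dn n.
  rewrite -lee_fin fineK //; case: (PU n) => _ _ h; apply: le_trans (ltW h).
  by apply: le_lebesgue_measure => //; exact: subIsetl.
have cmono n x y : x <= y -> c n x <= c n y.
  move=> xy; rewrite -lee_fin !fineK //; apply: le_lebesgue_measure => //.
  by apply: setIS => z /=; rewrite !in_itv /= => /andP[-> h]; exact: le_trans xy.
have cadd n x y : a <= x -> x <= y -> `]x, y]%classic `<=` U n -> c n x + (y - x) <= c n y.
  move=> ax xy sU; rewrite -lee_fin EFinD !fineK //.
  have -> : (y - x)%:E = mu `]x, y].
    rewrite lebesgue_measure_itv /= lte_fin; move: xy; rewrite le_eqVlt => /orP[/eqP->|->//].
    by rewrite ltxx subrr.
  have -> : (mu (U n `&` `]a, x]) + mu `]x, y])%E = mu ((U n `&` `]a, x]) `|` `]x, y]).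
    apply/esym; apply: measureU; [exact: mI | exact: measurable_itv |].
    rewrite -subset0 => z [[_ /=]]; rewrite !in_itv /= => /andP[_ zx] /andP[xz _]; lra.
  apply: le_lebesgue_measure => //.
    by apply: measurableU => //; exact: measurable_itv.
  move=> z [[Uz /=]|/=]; rewrite in_itv /= => /andP[h1 h2].
    by split => //=; rewrite in_itv /= h1 (le_trans h2).
  by split; [apply: sU => /=; rewrite in_itv /= h1 | rewrite /= in_itv /= h2 andbT; lra].
pose s n t : R := \sum_(i < n) c i t.
have sum_dn n : \sum_(i < n) dn i <= e - e / 2 ^+ n.
  elim: n => [|n IH]; first by rewrite big_ord0 expr0 divr1 subrr.
  rewrite big_ord_recr /=; apply: le_trans (lerD IH (lexx _)) _.
  rewrite /dn exprS invfM; lra.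
have sle n t : s n t <= e.
  apply: (@le_trans _ _ (\sum_(i < n) dn i)); first by apply: ler_sum => i _; exact: cle.
  apply: le_trans (sum_dn n) _.
  by rewrite gerBl divr_ge0 ?exprn_ge0 // ltW.
have s0 n t : 0 <= s n t by apply: sumr_ge0.
(* The infinite sum of the [c i t] is taken as the supremum of its partial sums. *)
pose S t := [set s n t | n in [set: nat]].
have hs t : has_sup (S t).
  by split; [exists (s 0%N t); exists 0%N | exists e => _ [n _ <-]; exact: sle].
have sS n t : s n t <= sup (S t) by apply: ub_le_sup; [case: (hs t) | exists n].
exists (fun t => sup (S t)); split.
- move=> x y _ xy _; apply: ge_sup; first by exists (s 0%N x); exists 0%N.
  move=> _ [n _ <-]; apply: le_trans (sS n y); apply: ler_sum => i _; exact: cmono.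
- have : sup (S b) <= e by apply: ge_sup; [exists (s 0%N b); exists 0%N | move=> _ [n _ <-]].
  have : 0 <= sup (S a) by apply: le_trans (sS 0%N a).
  lra.
- move=> t Nt tab; have [d Hd] := Hf t tab.
  have [k kd] : exists k : nat, `|d| + 1 <= k%:R.
    exists (Num.truncn (`|d| + 1)).+1; apply/ltW/truncnS_gt.
  have [eta1 eta10 He1] := has_derivative_norm_straddle Hd (lexx _) ltr01.
  have [eta2 eta20 He2] : exists2 eta2 : R, 0 < eta2 &
      forall n, (n < k)%N -> forall z, `|z - t| < eta2 -> U n z.
    elim: k {kd} => [|k [r r0 Hr]]; first by exists 1.
    have /nbhs_ballP[r' /= r'0 Hr'] : nbhs t (U k).
      by have [Uo UN _] := PU k; apply: open_nbhs_nbhs; split => //; exact: UN.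
    exists (Num.min r r') => [|n nk z]; rewrite ?lt_min ?r0 // => /andP[zr zr'].
    move: nk; rewrite ltnS leq_eqVlt => /orP[/eqP->|nk]; last exact: Hr.
    by apply: Hr'; rewrite /ball /= distrC.
  exists (Num.min eta1 eta2) => [|x y ax xt ty yb].
    by rewrite lt_min eta10.
  rewrite ltrBlDr -ltrBlDl lt_min => /andP[h1 h2].
  rewrite -ltrBlDl lt_min => /andP[h3 h4].
  have xy := le_trans xt ty.
  apply: (@le_trans _ _ (k%:R * (y - x))).
    apply: le_trans (He1 x y xt ty _ _) _; [lra | lra |].
    by rewrite ler_wpM2r // subr_ge0.
  rewrite lerBrDl; rewrite -lerBrDr; apply: ge_sup; first by exists (s 0%N x); exists 0%N.
  move=> _ [n _ <-]; rewrite lerBrDr; apply: le_trans (sS (maxn n k) y).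
  have key m : (k <= m)%N -> s m x + k%:R * (y - x) <= s m y.
    move=> km; rewrite -(subnKC km) /s !big_split_ord /=.
    rewrite -addrA [X in _ + X]addrC addrA; apply: lerD; last first.
      by apply: ler_sum => i _; exact: cmono.
    rewrite (_ : k%:R * (y - x) = \sum_(i < k) (y - x)); last first.
      by rewrite sumr_const card_ord mulr_natl.
    rewrite -big_split /=; apply: ler_sum => i _; apply: cadd => //.
    move=> z /=; rewrite in_itv /= => /andP[xz zy]; apply: (He2 i (ltn_ord i)).
    by rewrite ltr_norml; apply/andP; split; lra.
  apply: le_trans (key _ (leq_maxr n k)); rewrite lerD2r.
  rewrite -(subnKC (leq_maxl n k)) /s big_split_ord /= lerDl; exact: sumr_ge0.
Qed.

End absolute_continuity.

(** * An integrable density for the variation of a [W11] function *)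

Lemma limn_einf_le (R : realType) (u : nat -> \bar R) (C : \bar R) :
  (forall n, u n <= C)%E -> (limn_einf u <= C)%E.
Proof.
move=> H; rewrite limn_einf_lim; apply: lime_le; first exact: is_cvg_einfs.
near=> n; apply: le_trans (H n); apply: ereal_inf_lbound; exists n => //=.
Unshelve. all: by end_near.
Qed.

Lemma measurable_fun_limn_einf d (T : measurableType d) (R : realType) (D : set T)
    (f : nat -> T -> \bar R) : (forall n, measurable_fun D (f n)) ->
  measurable_fun D (fun x => limn_einf (f ^~ x)).
Proof.
move=> mf; rewrite (_ : (fun x => _) = -%E \o (fun x => limn_esup ((fun n => -%E \o f n) ^~ x))).
  apply: measurableT_comp; first exact: oppe_measurable.
  apply: measurable_fun_limn_esup => n; exact: (measurableT_comp (@oppe_measurable R setT) (mf n)).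
apply/funext => x /=; rewrite -limn_einfN; congr limn_einf.
by apply/funext => n /=; rewrite oppeK.
Qed.

(** The intervals shrink to [t] without having it as an end point, like the cells of finer and finer
    partitions. *)
Lemma derivative_quotient_cvg (R : realType) (V : normedModType R) (u : R -> V) t d :
  has_derivative u t d -> forall e, 0 < e -> exists2 eta, 0 < eta &
  forall x y, x <= t -> t <= y -> x < y -> y - x < eta ->
    `| `|d| - `|u y - u x| / (y - x) | <= e.
Proof.
move=> H e e0; have [eta eta0 He] := has_derivative_straddle H e0.
exists eta => // x y xt ty xy yx.
have h := He x y xt ty _ _; have {}h := h ltac:(lra) ltac:(lra).
have p : 0 < y - x by lra.
rewrite -(ler_pM2r p) -{2}(gtr0_norm p) -normrM mulrBl mulfVK ?gt_eqF //.
apply: le_trans h; have -> : `|d| * (y - x) = `|(y - x) *: d| by rewrite normrZ gtr0_norm // mulrC.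
by rewrite distrC; exact: ler_dist_dist.
Qed.

Section dominated.
Variable R : realType.
Notation mu := (@lebesgue_measure R).

(** The density is the lower limit of the step functions given by increment norms over cell lengths
    on uniform partitions. Fatou's lemma bounds its integral by the total variation, and almost
    everywhere it equals [|u'|]; integrability of [|u'|] is thus obtained without measurability of
    the vector-valued derivative. *)
Lemma W11_dominated (V : normedModType R) (T : R) (u : R -> V) : 0 < T -> W11 T u ->
  exists phi : R -> R, [/\ L1T phi, forall x, 0 <= phi x &
   forall s t, 0 <= s -> s <= t -> t <= T -> `|u t - u s| <= primitive phi t - primitive phi s].
Proof.
move=> T0 [acu deru].
have [d d0 Hd] := acu 1 ltr01.
(* With [T / n0 < d], absolute continuity for tolerance 1 bounds the variation on each of [n0] equal
   blocks by 1, whatever the subdivision. *)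
pose n0 := (Num.truncn (T / d)).+1.
have n0d : T / n0%:R < d.
  by rewrite ltr_pdivrMr ?ltr0n // mulrC -ltr_pdivrMr //; exact: truncnS_gt.
(* Each block is cut into [m.+1] cells, so the bound [n0] on the total variation is uniform in
   [m]. *)
pose N m := (n0 * m.+1)%N.
have N0 m : 0 < (N m)%:R :> R by rewrite ltr0n muln_gt0.
pose len m := T / (N m)%:R.
have len0 m : 0 < len m by rewrite divr_gt0.
pose tt m k := k%:R * len m.
have ttS m k : tt m k.+1 - tt m k = len m by rewrite /tt -mulrBl -natrB // subSnn mul1r.
have tt_le m j k : (j <= k)%N -> tt m j <= tt m k by move=> jk; rewrite ler_pM2r // ler_nat.
have ttN m : tt m (N m) = T by rewrite /tt /len mulrCA divff ?mulr1 // gt_eqF.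
pose c m k := `|u (tt m k.+1) - u (tt m k)| / len m.
have c0 m k : 0 <= c m k by rewrite divr_ge0 // ltW.
have blk m j : (j <= n0)%N ->
    \sum_(k < (j * m.+1)%N) `|u (tt m k.+1) - u (tt m k)| <= j%:R.
  elim: j => [|j IH] jn; first by rewrite mul0n big_ord0.
  rewrite mulSnr big_split_ord /= -[j.+1%:R]natr1; apply: lerD; first exact/IH/ltnW.
  apply/ltW; apply: (Hd _ (fun i => tt m (j * m.+1 + i)%N) (fun i => tt m (j * m.+1 + i).+1)).
  - move=> i im; split; first by rewrite mulr_ge0 // ltW.
    split; first exact: tt_le.
    rewrite -(ttN m); apply: tt_le; rewrite /N (leq_trans _ (leq_mul jn (leqnn _))) //.
    by rewrite mulSnr -addnS leq_add2l.
  - by move=> i k /andP[ik km]; apply: tt_le; rewrite -addnS leq_add2l.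
  - rewrite (eq_bigr (fun=> len m)); last by move=> i _; rewrite ttS.
    rewrite sumr_const card_ord; apply: le_lt_trans n0d.
    have -> : len m *+ m.+1 = T / n0%:R.
      rewrite -[LHS]mulr_natr /len /N natrM.
      have h1 : n0%:R != 0 :> R by rewrite pnatr_eq0.
      have h2 : m.+1%:R != 0 :> R by rewrite pnatr_eq0.
      by move: (n0%:R) (m.+1%:R) h1 h2 => x y x0 y0; field; rewrite x0 y0.
    by [].
(* Half-open cells: a time strictly between 0 and [T] belongs to exactly one of them. *)
pose F m t : \bar R := (\sum_(k < N m) (c m k)%:E * (\1_(`]tt m k, tt m k.+1]%classic) t)%:E)%E.
have mF m : measurable_fun [set: measurableTypeR R] (F m).
  apply: emeasurable_sum => k; apply: emeasurable_funM => //.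
  by apply/measurable_EFinP; exact: measurable_indic.
have F0 m t : (0 <= F m t)%E.
  by apply: sume_ge0 => k _; rewrite mule_ge0 // lee_fin.
have IF m : (\int[mu]_t F m t <= n0%:R%:E)%E.
  rewrite /F ge0_integral_sum //; last 2 first.
  - move=> k; apply: emeasurable_funM => //.
    by apply/measurable_EFinP; exact: measurable_indic.
  - by move=> k x _; rewrite mule_ge0 // lee_fin.
  apply: (@le_trans _ _ (\sum_(k < N m) `|u (tt m k.+1) - u (tt m k)|)%:E); last first.
    by rewrite lee_fin; exact: blk.
  rewrite -sumEFin; apply: lee_sum => k _.
  rewrite ge0_integralZl //; last 2 first.
  - by apply/measurable_EFinP; exact: measurable_indic.
  - by rewrite lee_fin.
  rewrite integral_indic // setIT.
  rewrite [X in (_ * X)%E](_ : _ = (len m)%:E); first by rewrite -EFinM lee_fin /c mulfVK // gt_eqF.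
  rewrite -[LHS]/(lebesgue_measure `]tt m k, tt m k.+1]%classic) lebesgue_measure_itv /=.
  by rewrite lte_fin -subr_gt0 ttS len0 -EFinB ttS.
(* A lower limit, since convergence is known only where [u] has a derivative. *)
pose psi t : \bar R := limn_einf (F ^~ t).
have mpsi : measurable_fun [set: measurableTypeR R] psi by exact: measurable_fun_limn_einf.
have psi0 t : (0 <= psi t)%E.
  rewrite /psi limn_einf_lim; apply: lime_ge; first exact: is_cvg_einfs.
  near=> n; apply: le_ereal_inf_tmp => _ [k _ <-]; exact: F0.
have Ipsi : (\int[mu]_t psi t <= n0%:R%:E)%E.
  apply: le_trans (fatou mu measurableT mF (fun n x _ => F0 n x)) _.
  exact: limn_einf_le.
pose phi t := fine (psi t).
have phi0 t : 0 <= phi t by exact: fine_ge0.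
have mphi : measurable_fun [set: measurableTypeR R] phi.
  by apply: measurableT_comp => //; exact: fine_measurable.
have Iphi : L1T phi.
  apply/integrableP; split; first exact/measurable_EFinP.
  apply: le_lt_trans (ltry n0%:R); apply: le_trans Ipsi.
  apply: ge0_le_integral => //.
  - by apply: measurableT_comp => //; exact/measurable_EFinP.
  - move=> t _ /=; rewrite ger0_norm // /phi; case: (psi t) (psi0 t) => //=.
exists phi; split => // s t s0 st tT.
have T0' : 0 <= T by lra.
apply: ae_mean_value_ineq => //.
- apply: (@null_variation_sub _ _ 0 T) => //; exact: abs_cont_null_variation.
- by move=> x y _ xy _; exact: primitive_le.
apply: (ae_imply (ae_and deru (primitive_derivative Iphi))) => r [Hr Hp] /andP[sr rt] e e0.
have rT : r \in `]0, T[ by rewrite in_itv /=; lra.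
have {Hr} Hr := derivable_has_derivative (Hr rT).
suff E : phi r = `|'D_1 u r|.
  have e2 : 0 < e / 2 by lra.
  have [r1 r10 H1] := has_derivative_norm_straddle Hr (lexx _) e2.
  have [r2 r20 H2] := has_derivative_straddle Hp e2.
  exists (Num.min r1 r2) => [|x y sx xr ry yt]; first by rewrite lt_min r10.
  rewrite ltrBlDr -ltrBlDl lt_min => /andP[h1 h2].
  rewrite -ltrBlDl lt_min => /andP[h3 h4].
  have := H1 x y xr ry ltac:(lra) ltac:(lra).
  have := H2 x y xr ry ltac:(lra) ltac:(lra).
  rewrite E [_ *: _]mulrC ler_norml => /andP[+ _]; lra.
rewrite /phi /psi; apply: (f_equal fine (y := (`|'D_1 u r|)%:E)).
apply: (fun H => (cvg_limn_einf_sup H).1).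
have Fval m : exists k, [/\ tt m k < r, r <= tt m k.+1 & F m r = (c m k)%:E].
  have exk : exists k, (r <= tt m k.+1).
    by exists (N m); apply: le_trans (tt_le m _ _ (leqnSn _)); rewrite ttN; lra.
  have [k rk kmin] := ex_minnP exk.
  have tk : tt m k < r.
    case: k rk kmin => [|k] rk kmin; first by rewrite /tt mul0r; lra.
    by rewrite ltNge; apply/negP => /kmin; rewrite ltnn.
  have kN : (k < N m)%N.
    rewrite ltnNge; apply/negP => /(tt_le m); rewrite ttN; lra.
  exists k; split => //.
  rewrite /F (bigD1 (Ordinal kN)) //= big1 => [|j jk].
    rewrite adde0 indicE mem_set ?mule1 //=; by rewrite in_itv /= tk.
  rewrite indicE memNset ?mule0 //= in_itv /= => /andP[h1 h2].
  have : (j != k :> nat) by [].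
  rewrite neq_ltn => /orP[/(tt_le m)|/(tt_le m)]; lra.
apply: cvg_EFin.
  by near=> m; have [k [_ _ ->]] := Fval m.
apply/cvgrPdist_le => e' e'0.
have [eta eta0 He] := derivative_quotient_cvg Hr e'0.
have ne0 : 0 < n0%:R * eta / T by rewrite divr_gt0 // mulr_gt0 // ltr0n.
near=> m; have [k [h1 h2 h3]] := Fval m.
rewrite /= h3 /= /c -(ttS m k); apply: He => //; try lra.
rewrite ttS /len /N natrM ltr_pdivrMr ?mulr_gt0 ?ltr0n //.
have : m.+1%:R^-1 < n0%:R * eta / T.
  near: m; exact: (near_infty_natSinv_lt (PosNum (ne0 : 0 < n0%:R * eta / T))).
rewrite ltr_pdivlMr // mulrC ltr_pdivrMr ?ltr0n //; lra.
Unshelve. all: by end_near. Qed.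
End dominated.

(** * Inner product identities *)

Section hilbert.
Variables (R : realType) (X : normedModType R) (ip : X -> X -> R).
Hypothesis hX : hilbert_inner ip.

Lemma ipC x y : ip x y = ip y x. Proof. by case: hX. Qed.
Lemma ipxx x : ip x x = `|x| ^+ 2. Proof. by case: hX. Qed.
Lemma ipDl x y z : ip (x + y) z = ip x z + ip y z.
Proof. by case: hX => _ /(_ 1 x y z); rewrite scale1r mul1r. Qed.
Lemma ip0l z : ip 0 z = 0.
Proof. by have := ipDl 0 0 z; rewrite addr0; lra. Qed.
Lemma ipZl k x z : ip (k *: x) z = k * ip x z.
Proof. by case: hX => _ /(_ k x 0 z); rewrite addr0 ip0l addr0. Qed.
Lemma ipNl x z : ip (- x) z = - ip x z.
Proof. by rewrite -scaleN1r ipZl mulN1r. Qed.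
Lemma ipBl x y z : ip (x - y) z = ip x z - ip y z.
Proof. by rewrite ipDl ipNl. Qed.
Lemma ipDr x y z : ip z (x + y) = ip z x + ip z y.
Proof. by rewrite !(ipC z) ipDl. Qed.
Lemma ip0r z : ip z 0 = 0. Proof. by rewrite ipC ip0l. Qed.
Lemma ipZr k x z : ip z (k *: x) = k * ip z x.
Proof. by rewrite !(ipC z) ipZl. Qed.
Lemma ipNr x z : ip z (- x) = - ip z x.
Proof. by rewrite !(ipC z) ipNl. Qed.
Lemma ipBr x y z : ip z (x - y) = ip z x - ip z y.
Proof. by rewrite !(ipC z) ipBl. Qed.
Definition ipE := (ipDl, ipDr, ipBl, ipBr, ipNl, ipNr, ipZl, ipZr, ip0l, ip0r).

Lemma normD_sqr x y : `|x + y| ^+ 2 = `|x| ^+ 2 + 2 * ip x y + `|y| ^+ 2.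
Proof. rewrite -!ipxx !ipE (ipC y x); ring. Qed.
Lemma normB_sqr x y : `|x - y| ^+ 2 = `|x| ^+ 2 - 2 * ip x y + `|y| ^+ 2.
Proof. rewrite -!ipxx !ipE (ipC y x); ring. Qed.

Lemma cauchy_schwarz x y : `|ip x y| <= `|x| * `|y|.
Proof.
have [->|y0] := eqVneq y 0; first by rewrite ip0r !normr0 mulr0.
have ny : 0 < `|y| by rewrite normr_gt0.
have y2 : 0 < `|y| ^+ 2 by rewrite exprn_gt0.
rewrite -(@ler_pXn2r _ 2) // ?nnegrE ?mulr_ge0 // real_normK ?num_real // exprMn.
have := sqr_ge0 `|x - (ip x y / `|y| ^+ 2) *: y|.
rewrite normB_sqr ipZr normrZ exprMn real_normK ?num_real //.
rewrite -(pmulr_rge0 _ y2).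
rewrite (_ : _ * _ = `|x| ^+ 2 * `|y| ^+ 2 - ip x y ^+ 2) ?subr_ge0 //.
field; exact: lt0r_neq0.
Qed.

Lemma ip_le x y : ip x y <= `|x| * `|y|.
Proof. exact: le_trans (ler_norm _) (cauchy_schwarz _ _). Qed.

Lemma has_derivative_ip (f : R -> X) t d z :
  has_derivative f t d -> has_derivative (fun s => ip (f s) z) t (ip d z).
Proof.
move=> H e e0; pose K := `|z| + 1.
have K0 : 0 < K by rewrite /K; have := normr_ge0 z; lra.
have [|r r0 Hr] := H (e / K); first exact: divr_gt0.
exists r => // s sr.
have -> : ip (f s) z - ip (f t) z - (s - t) *: ip d z = ip (f s - f t - (s - t) *: d) z.
  by rewrite !ipE.
apply: le_trans (cauchy_schwarz _ _) _; have := Hr s sr.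
set n := `|f s - _ - _| => h.
apply: (@le_trans _ _ (n * K)); first by apply: ler_wpM2l; [exact: normr_ge0 | rewrite /K; lra].
by move: h; rewrite -(ler_pM2r K0) => h; apply: le_trans h _; rewrite mulrAC mulfVK // gt_eqF.
Qed.

End hilbert.

(** * Extrema, domination, and a Gronwall lemma driven by a clock *)

Section calculus.
Variable R : realType.

Lemma has_derivative_max (f : R -> R) t d r : 0 < r ->
  (forall s, `|s - t| < r -> f s <= f t) -> has_derivative f t d -> d = 0.
Proof.
move=> r0 H Hd; apply/eqP; rewrite -normr_le0; apply/ler_addgt0Pl => e e0.
rewrite addr0; have [eta eta0 He] := Hd e e0.
pose h := Num.min r eta / 2.
have h0 : 0 < h by rewrite divr_gt0 // lt_min r0.
have hr : h < r by rewrite /h ltr_pdivrMr // (@le_lt_trans _ _ r) ?ge_min ?lexx //; lra.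
have he : h < eta.
  by rewrite /h ltr_pdivrMr // (@le_lt_trans _ _ eta) ?ge_min ?lexx ?orbT //; lra.
have E1 : t + h - t = h by ring.
have E2 : t - h - t = - h by ring.
have := He (t + h); have := He (t - h); have := H (t + h); have := H (t - h).
rewrite E1 E2 normrN (gtr0_norm h0) => /(_ hr) a1 /(_ hr) a2 /(_ he) + /(_ he).
rewrite /GRing.scale /= !ler_norml => /andP[b1 _] /andP[b2 _].
have hd1 : h * d <= h * e by lra.
have hd2 : - (h * d) <= h * e by lra.
by rewrite -mulrN in hd2; move: hd1 hd2; rewrite !ler_pM2l // => *; lra.
Qed.

Lemma has_derivative_dominated (V : normedModType R) (f : R -> V) (M : R -> R) t d m r k :
  0 < r -> 0 <= k ->
  (forall s, t <= s -> s < t + r -> `|f s - f t| <= k * (M s - M t)) ->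
  has_derivative f t d -> has_derivative M t m -> `|d| <= k * m.
Proof.
move=> r0 k0 H Hf HM; apply/ler_addgt0Pr => e e0.
pose e1 := e / (k + 1); have k1 : 0 < k + 1 by lra.
have e10 : 0 < e1 by rewrite divr_gt0.
have [r1 r10 H1] := Hf _ e10; have [r2 r20 H2] := HM _ e10.
pose h := Num.min r (Num.min r1 r2) / 2.
have h20 : 0 < Num.min r (Num.min r1 r2) by rewrite !lt_min r0 r10.
have [l1 l2 l3] : [/\ h < r, h < r1 & h < r2].
  have : h < Num.min r (Num.min r1 r2) by rewrite /h; lra.
  by rewrite !lt_min => /and3P[].
have h0 : 0 < h by rewrite divr_gt0.
have E1 : t + h - t = h by ring.
have := H1 (t + h); have := H2 (t + h); have := H (t + h).
rewrite E1 (gtr0_norm h0) => a /(_ l3) b /(_ l2) c'.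
have {}a := a ltac:(lra) ltac:(lra).
have c2 : h * `|d| <= `|f (t + h) - f t| + e1 * h.
  have -> : h * `|d| = `|h *: d| by rewrite normrZ gtr0_norm.
  have -> : h *: d = (f (t + h) - f t) - (f (t + h) - f t - h *: d) by lmod.
  by apply: le_trans (ler_normB _ _) _; rewrite lerD2l.
move: b; rewrite /GRing.scale /= ler_norml => /andP[_ b].
have : k * (M (t + h) - M t) <= k * (h * m + e1 * h) by apply: ler_wpM2l => //; lra.
have -> : k * (h * m + e1 * h) = h * (k * m + k * e1) by ring.
have ee : e = k * e1 + e1 by rewrite /e1; field; lra.
move=> d1; have : h * `|d| <= h * (k * m + e) by rewrite ee; lra.
by rewrite ler_pM2l.
Qed.

(** The integrating factor is [expR (- (K * (M t - M a)))], and its product with [F] is compared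
    with [E * M]. [F] need not be differentiable: an upper bound across almost every point suffices,
    because domination by [M] rules out variation on null sets. *)
Lemma gronwall_ae (a b : R) (F M phi : R -> R) (CF K E : R) : a <= b ->
  0 <= CF -> 0 <= K -> 0 <= E ->
  (forall x, 0 <= phi x) ->
  (forall x y, a <= x -> x <= y -> y <= b -> M x <= M y) ->
  null_variation a b M ->
  (forall x, a <= x <= b -> 0 <= F x) -> F a = 0 ->
  (forall x y, a <= x -> x <= y -> y <= b -> `|F y - F x| <= CF * (M y - M x)) ->
  {ae @lebesgue_measure R, forall t, a < t < b -> has_derivative M t (phi t) /\
     forall e, 0 < e -> exists2 eta, 0 < eta & forall x y, a <= x -> x <= t -> t <= y -> y <= b ->
       t - eta < x -> y < t + eta -> F y - F x <= (phi t * (K * F t + E) + e) * (y - x)} ->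
  F b <= expR (K * (M b - M a)) * (E * (M b - M a)).
Proof.
move=> ab CF0 K0 E0 phi0 Mnd Mns F0 Fa FM H.
pose X t := expR (- (K * (M t - M a))).
have X0 t : 0 < X t by exact: expR_gt0.
have X1 t : a <= t -> t <= b -> X t <= 1.
  move=> at_ tb; rewrite /X -[leRHS]expR0 ler_expR oppr_le0 mulr_ge0 // subr_ge0; exact: Mnd.
have Xd x y : a <= x -> x <= y -> y <= b -> X y - X x <= - (X y * (K * (M y - M x))).
  move=> ax xy yb.
  have -> : X x = X y * expR (K * (M y - M x)) by rewrite /X -expRD; congr expR; ring.
  have := expR_ge1Dx (K * (M y - M x)).
  rewrite -(ler_pM2l (X0 y)) mulrDr mulr1; lra.
have Xnd x y : a <= x -> x <= y -> y <= b -> X y <= X x.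
  move=> ax xy yb; rewrite /X ler_expR lerN2 ler_wpM2l // lerD2r; exact: Mnd.
have Fmax x : a <= x -> x <= b -> F x <= CF * (M b - M a).
  move=> ax xb; have := FM a x (lexx _) ax xb; rewrite Fa subr0 => h.
  apply: le_trans (ler_norm _) _; apply: le_trans h _; apply: ler_wpM2l => //; rewrite lerD2r; exact: Mnd.
have Mab : M a <= M b by exact: Mnd.
suff key : X b * F b - X a * F a <= E * M b - E * M a.
  move: key; rewrite Fa mulr0 subr0 -mulrBr => key.
  have : expR (K * (M b - M a)) * (X b * F b) = F b.
    by rewrite mulrA /X -expRD subrr expR0 mul1r.
  by move=> <-; rewrite ler_pM2l ?expR_gt0.
(* A Lipschitz constant of [X * F] with respect to [M]; the last 1 makes it positive. *)
pose C := CF + CF * (M b - M a) * K + 1.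
have C0 : 0 < C.
  have h : 0 <= CF * (M b - M a) * K by rewrite !mulr_ge0 ?subr_ge0.
  rewrite /C; lra.
apply: (@ae_upper_derivative_le R a b (fun t => X t * F t) (fun t => E * M t)) => //.
- apply: (null_variation_le C0 _ Mns) => x y ax xy yb.
  have Mxy := Mnd x y ax xy yb.
  rewrite [X in _ <= _ * X]ger0_norm ?subr_ge0 //.
  have -> : X y * F y - X x * F x = X y * (F y - F x) + (X y - X x) * F x by ring.
  apply: le_trans (ler_normD _ _) _.
  have Fx0 : 0 <= F x by apply: F0; rewrite ax; lra.
  have h1 : `|X y * (F y - F x)| <= CF * (M y - M x).
    rewrite normrM gtr0_norm //; apply: le_trans (FM x y ax xy yb).
    by rewrite ler_piMl // X1 //; lra.
  have h2 : `|(X y - X x) * F x| <= K * (M y - M x) * (CF * (M b - M a)).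
    rewrite normrM (ger0_norm Fx0); apply: ler_pM => //; last by apply: Fmax => //; lra.
    rewrite distrC ger0_norm ?subr_ge0; last exact: Xnd.
    have -> : X y = X x * expR (- (K * (M y - M x))) by rewrite /X -expRD; congr expR; ring.
    have h3 := expR_ge1Dx (- (K * (M y - M x))).
    have Xx1 := X1 x ax ltac:(lra).
    have h4 : 0 <= K * (M y - M x) by rewrite mulr_ge0 // subr_ge0.
    have h5 : X x * (1 + - (K * (M y - M x))) <= X x * expR (- (K * (M y - M x))).
      by rewrite ler_pM2l.
    have h6 : X x * (K * (M y - M x)) <= K * (M y - M x) by rewrite ler_piMl.
    rewrite mulrDr mulr1 in h5; lra.
  have -> : C * (M y - M x) = CF * (M y - M x) + K * (M y - M x) * (CF * (M b - M a)) + (M y - M x).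
    by rewrite /C; ring.
  lra.
- by move=> x y ax xy yb; apply: ler_wpM2l => //; exact: Mnd.
apply: (ae_imply H) => t Ht tab e e0; have [HM HF] := Ht tab.
have /andP[at_ tb] := tab.
have Ft : 0 <= F t by apply: F0; apply/andP; split; lra.
(* [Q] adds up the coefficients with which the tolerance [e1] enters: the bound on [F] itself, the
   two replacements of the increment of [M] by [phi t], and the replacement of [F x] by [F t]. *)
pose Q := 1 + K * F t + K * (phi t + 1) * CF + E.
have Q0 : 0 < Q.
  have : 0 <= K * F t by exact: mulr_ge0.
  have : 0 <= K * (phi t + 1) * CF by rewrite !mulr_ge0 //; have := phi0 t; lra.
  rewrite /Q; lra.
pose e1 := Num.min 1 (e / Q).
have e10 : 0 < e1 by rewrite lt_min ltr01 divr_gt0.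
have e11 : e1 <= 1 by rewrite ge_min lexx.
have e1Q : e1 * Q <= e.
  by rewrite -ler_pdivlMr // ge_min lexx orbT.
have [r1 r10 H1] := HF _ e10.
have [r2 r20 H2] := has_derivative_straddle HM e10.
have [r3 r30 H3] := has_derivative_continuous HM e10.
exists (Num.min r1 (Num.min r2 r3)) => [|x y ax xt ty yb].
  by rewrite !lt_min r10 r20.
move=> w1 w2; have [h1 h2 w3 w4] := window_min w1 w2; have [h3 h4 h5 h6] := window_min w3 w4.
have xy := le_trans xt ty; have xb := le_trans xy yb.
have F1 := H1 x y ax xt ty yb h1 h2.
have := H2 x y xt ty h3 h4.
rewrite /GRing.scale /= ler_norml => /andP[M1 M2].
have M3 : `|M x - M t| < e1 by apply: H3; rewrite distrC ger0_norm ?subr_ge0 // ltrBlDr -ltrBlDl.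
have MxMt := Mnd x t ax xt (ltW tb).
have F2 : F t - CF * e1 <= F x.
  have := FM x t ax xt (ltW tb); rewrite ler_norml => /andP[_ g].
  move: M3; rewrite distrC ger0_norm ?subr_ge0 // => M3.
  have h : CF * (M t - M x) <= CF * e1 by apply: ler_wpM2l => //; rewrite ltW.
  clear -g h; lra.
have Fx0 : 0 <= F x by apply: F0; rewrite ax.
have dM : 0 <= M y - M x by rewrite subr_ge0; exact: Mnd.
have yx : 0 <= y - x by rewrite subr_ge0.
set DM := M y - M x in M1 M2 dM *; set w := y - x in F1 M1 M2 yx *.
have g1 : K * DM * (F t - CF * e1) <= K * DM * F x by apply: ler_wpM2l => //; rewrite mulr_ge0.
have g2 : K * F t * (w * phi t - e1 * w) <= K * F t * DM.
  by apply: ler_wpM2l; rewrite ?mulr_ge0 //; clear -M1; lra.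
have g3 : K * CF * e1 * DM <= K * CF * e1 * (w * (phi t + 1)).
  apply: ler_wpM2l; rewrite ?mulr_ge0 //; first exact: ltW.
  have h : e1 * w <= 1 * w by apply: ler_wpM2r => //.
  clear -M2 h; lra.
have g4 : E * (w * phi t - e1 * w) <= E * DM by apply: ler_wpM2l => //; clear -M1; lra.
have bracket : F y - F x - K * DM * F x <= E * DM + e * w.
  have : e1 * Q * w <= e * w by apply: ler_wpM2r => //.
  move: F1 g1 g2 g3 g4; rewrite /Q => F1 g1 g2 g3 g4 h; clear -F1 g1 g2 g3 g4 h; lra.
have r_ge0 : 0 <= E * DM + e * w by rewrite addr_ge0 ?mulr_ge0 // ltW.
have -> : E * M y - E * M x = E * DM by rewrite /DM; ring.
apply: (@le_trans _ _ (X y * (E * DM + e * w))); last first.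
  by apply: ler_piMl => //; apply: X1 => //; exact: le_trans xy.
(* Discrete product rule: the decrease of [X] is evaluated at [F x], the increase of [F] at
   [X y]. *)
apply: (@le_trans _ _ (X y * (F y - F x - K * DM * F x))); last by rewrite ler_pM2l.
have : (X y - X x) * F x <= - (X y * (K * DM)) * F x by apply: ler_wpM2r => //; exact: Xd.
move=> h; clear -h; lra.
Qed.

End calculus.

(** If [v] is missed, the indicator of [f >= v] is locally constant; creeping then forbids its jump
    from 0 at [a] to 1 at [b]. *)
Lemma creeping_ivt (R : realType) (f : R -> R) (a b v : R) : a <= b -> f a <= v -> v <= f b ->
  (forall t, a <= t <= b -> forall e, 0 < e -> exists2 eta, 0 < eta &
     forall s, a <= s <= b -> `|s - t| < eta -> `|f s - f t| < e) ->
  exists2 t, a <= t <= b & f t = v.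
Proof.
move=> ab fa fb cf; apply: contrapT => no.
pose F t : R := if f t < v then 0 else 1.
have ne t : a <= t <= b -> f t != v by move=> tab; apply/eqP => E; apply: no; exists t.
have : F b <= F a.
  apply: creeping => // t tab.
  have e0 : 0 < `|f t - v| by rewrite normr_gt0 subr_eq0 ne.
  have [eta eta0 He] := cf t tab _ e0; exists eta => // x y ax xt ty yb h1 h2.
  have in1 : a <= x <= b by rewrite ax (le_trans xt (le_trans ty yb)).
  have in2 : a <= y <= b by rewrite yb (le_trans ax (le_trans xt ty)).
  have d1 : `|x - t| < eta by rewrite distrC ger0_norm ?subr_ge0 // ltrBlDr -ltrBlDl.
  have d2 : `|y - t| < eta by rewrite ger0_norm ?subr_ge0 // ltrBlDl.
  have := He x in1 d1; have := He y in2 d2; rewrite /F.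
  have := ne t tab; rewrite neq_lt => /orP[tv|tv].
    have -> : `|f t - v| = v - f t by rewrite distrC gtr0_norm // subr_gt0.
    rewrite !ltr_norml => /andP[_ b1] /andP[_ b2].
    by rewrite !ifT //; lra.
  have -> : `|f t - v| = f t - v by rewrite gtr0_norm // subr_gt0.
  rewrite !ltr_norml => /andP[b1 _] /andP[b2 _].
  by rewrite !ifF //; apply/negbTE; rewrite -leNgt; lra.
have aab : a <= a <= b by rewrite lexx.
have bab : a <= b <= b by rewrite lexx andbT.
have fa' : f a < v by rewrite lt_neqAle ne.
have fb' : (f b < v) = false by rewrite ltNge fb.
by rewrite /F fa' fb' ler10.
Qed.

Lemma derivative_le0 (R : realType) (f : R -> R) (a b : R) : a <= b ->
  (forall t, a <= t <= b -> exists2 d, d <= 0 & has_derivative f t d) -> f b <= f a.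
Proof.
move=> ab H; apply/ler_addgt0Pr => e e0.
pose k := e / (b - a + 1).
have k0 : 0 < k by rewrite divr_gt0 //; lra.
have kb : k * (b - a) <= e.
  by rewrite /k mulrAC ler_pdivrMr; [apply: ler_wpM2l; lra | lra].
suff : f b - k * b <= f a - k * a by move: kb; rewrite mulrBr; lra.
apply: (@creeping _ a b (fun t => f t - k * t)) => // t tab.
have [d d0 D] := H t tab; have [eta eta0 He] := has_derivative_straddle D k0.
exists eta => // x y ax xt ty yb h1 h2.
have := He x y xt ty h1 h2; rewrite ler_norml => /andP[_].
have w : 0 <= y - x by rewrite subr_ge0 (le_trans xt).
have : (y - x) *: d <= 0 by apply: mulr_ge0_le0.
lra.
Qed.

(** * Comparison of approximate trajectories *)

Section comparison.
Variables (R : realType) (X : normedModType R) (ip : X -> X -> R).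
Hypothesis hX : hilbert_inner ip.
Variables (T c K0 delta CG CP CB kap : R) (phi M : R -> R).
Variables (Gam : R -> X -> R) (Pg : R -> X -> X) (B : R -> X -> X -> R).
Hypothesis T0 : 0 < T.
Hypothesis c0 : 0 < c.
Hypothesis K00 : 0 <= K0.
Hypothesis delta0 : 0 <= delta.
Hypothesis delta1 : delta < 1.
Hypothesis CG0 : 0 <= CG.
Hypothesis CP0 : 0 <= CP.
Hypothesis CB0 : 0 <= CB.
Hypothesis kap0 : 0 <= kap.
Hypothesis phi0 : forall t, 0 <= phi t.
Hypothesis M_nd : forall s t, 0 <= s -> s <= t -> t <= T -> M s <= M t.
Hypothesis M_null : null_variation 0 T M.
Hypothesis M_der : {ae @lebesgue_measure R, forall t, 0 < t < T -> has_derivative M t (phi t)}.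
Hypothesis Gam_lip : forall s t xi ze, 0 <= s -> s <= t -> t <= T ->
  `|Gam t xi - Gam s ze| <= CG * (`|xi - ze| + (M t - M s)).
Hypothesis P_lip : forall s t xi ze, 0 <= s -> s <= t -> t <= T ->
  `|Pg t xi - Pg s ze| <= CP * (`|xi - ze| + (M t - M s)).
Hypothesis P_ge : forall t xi, 0 <= t -> t <= T -> Gam t xi = 1 -> c <= `|Pg t xi|.
Hypothesis P_le : forall t xi, `|Pg t xi| <= K0.
Hypothesis chain : {ae @lebesgue_measure R, forall t, 0 < t < T -> forall ze d,
  has_derivative ze t d ->
  has_derivative (fun s => Gam s (ze s)) t (B t (ze t) d - ip (Pg t (ze t)) d)}.
(** [B] is the time derivative of [Gam] along a curve without the term [- <P, d>]. It still depends
    on [d] through the state dependence of the constraint, with coefficient [delta * c]. Only [d1]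
    has to be bounded, because the change from [x1] to [x2] is made with the velocity [d1]. *)
Hypothesis B_lip : {ae @lebesgue_measure R, forall t, 0 < t < T -> forall x1 x2 d1 d2,
  `|d1| <= kap * phi t ->
  `|B t x1 d1 - B t x2 d2| <= delta * c * `|d1 - d2| + CB * phi t * `|x1 - x2|}.

(** For [eps = 0] this is the inclusion of [d] in the normal cone. The lower bound on [|p|] controls
    the multiplier [a] by [|d| / c], so an error [eps] in the direction costs only [O(eps)] in the
    velocity. *)
Definition slope_cond (eps : R) t (x d : X) :=
  (Gam t x < 1 -> d = 0) /\
  (Gam t x = 1 -> exists a p, [/\ 0 <= a, `|p - Pg t x| <= eps, c <= `|p| & d = a *: p]).

Definition approx_sol (eps : R) (xi : R -> X) :=
  [/\ forall s t, 0 <= s -> s <= t -> t <= T -> `|xi t - xi s| <= kap * (M t - M s),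
      forall t, 0 <= t -> t <= T -> Gam t (xi t) <= 1 &
      {ae @lebesgue_measure R, forall t, 0 < t < T ->
        exists2 d, has_derivative xi t d & slope_cond eps t (xi t) d}].

(** Serves the mixed case, where one velocity vanishes and the other must be recovered from its
    component along [P]. *)
Lemma slope_norm_le eps t x d : 0 <= t -> t <= T -> Gam t x = 1 -> slope_cond eps t x d ->
  c * `|d| <= ip (Pg t x) d + eps * `|d|.
Proof.
move=> t0 tT G1 [_ /(_ G1)[a [p [a0 pP cp ->]]]].
rewrite normrZ ger0_norm // (ipZr hX).
have -> : Pg t x = p - (p - Pg t x) by lmod.
rewrite (ipBl hX) (ipxx hX).
have h1 : ip (p - Pg t x) p <= eps * `|p|.
  by apply: le_trans (ip_le hX _ _) _; apply: ler_wpM2r.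
have h2 : c * `|p| <= `|p| ^+ 2 by rewrite expr2; apply: ler_wpM2r.
have : a * (c * `|p|) <= a * (`|p| ^+ 2 - ip (p - Pg t x) p + eps * `|p|).
  by apply: ler_wpM2l => //; lra.
rewrite [c * (a * _)]mulrCA => h; apply: le_trans h _.
by rewrite mulrDr [a * (eps * _)]mulrCA.
Qed.

(* Two vectors that are nearly positive multiples of the same [P]: their
   difference is controlled by its component along [P]. *)
Lemma slope_diff_le eps1 eps2 t x1 x2 d1 d2 k : 0 <= eps1 -> 0 <= eps2 ->
  0 <= t -> t <= T -> Gam t x1 = 1 -> Gam t x2 = 1 ->
  slope_cond eps1 t x1 d1 -> slope_cond eps2 t x2 d2 ->
  `|d1| <= k -> `|d2| <= k ->
  c * `|d1 - d2| <= `|ip (Pg t x1) d1 - ip (Pg t x2) d2|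
     + k * (CP + 2 * K0 * CP / c) * `|x1 - x2| + 2 * K0 * k / c * (eps1 + eps2).
Proof.
move=> e10 e20 t0 tT G1 G2 [_ /(_ G1)[a1 [p1 [a10 pP1 cp1 E1]]]] [_ /(_ G2)[a2 [p2 [a20 pP2 cp2 E2]]]] dk1 dk2.
set P1 := Pg t x1; set P2 := Pg t x2; set D := `|x1 - x2|.
have P12 : `|P1 - P2| <= CP * D.
  by have := @P_lip t t x1 x2 t0 (lexx _) tT; rewrite subrr addr0.
have cP1 : c <= `|P1| by exact: P_ge.
have k0 : 0 <= k by exact: le_trans (normr_ge0 _) dk1.
have ak (a : R) (p d : X) : 0 <= a -> c <= `|p| -> d = a *: p -> `|d| <= k -> a <= k / c.
  move=> a0 cp -> ; rewrite normrZ ger0_norm // => h; rewrite ler_pdivlMr //.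
  by apply: le_trans h; apply: ler_wpM2l.
have a1k := ak a1 p1 d1 a10 cp1 E1 dk1.
have a2k := ak a2 p2 d2 a20 cp2 E2 dk2.
(* Both velocities are referred to the single gradient [P1]; [r] collects the errors in
   direction. *)
pose r := a1 *: (p1 - P1) - a2 *: (p2 - P1).
have dE : d1 - d2 = (a1 - a2) *: P1 + r by rewrite E1 E2 /r; lmod.
have rle : `|r| <= k / c * (eps1 + eps2 + CP * D).
  apply: le_trans (ler_normB _ _) _; rewrite !normrZ !ger0_norm //.
  have h1 : a1 * `|p1 - P1| <= k / c * eps1.
    by apply: ler_pM.
  have h2 : a2 * `|p2 - P1| <= k / c * (eps2 + CP * D).
    apply: ler_pM => //; have -> : p2 - P1 = (p2 - P2) - (P1 - P2) by lmod.
    by apply: le_trans (ler_normB _ _) _; exact: lerD.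
  lra_with h2 h1.
have s1 : c * `|d1 - d2| <= `|P1| * `|d1 - d2| by apply: ler_wpM2r.
have s2 : `|P1| * `|d1 - d2| <= `|ip P1 (d1 - d2)| + 2 * K0 * `|r|.
  have h1 : `|P1| * `|d1 - d2| <= `|(a1 - a2) * `|P1| ^+ 2| + `|P1| * `|r|.
    rewrite normrM [`| `|P1| ^+ 2|]ger0_norm ?sqr_ge0 //.
    have -> : `|a1 - a2| * `|P1| ^+ 2 + `|P1| * `|r| = `|P1| * (`|a1 - a2| * `|P1| + `|r|) by ring.
    apply: ler_wpM2l => //; rewrite dE -normrZ; exact: ler_normD.
  have h2 : (a1 - a2) * `|P1| ^+ 2 = ip P1 (d1 - d2) - ip P1 r.
    by rewrite dE (ipDr hX) (ipZr hX) (ipxx hX); ring.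
  have h3 : `|ip P1 r| <= `|P1| * `|r| by exact: cauchy_schwarz.
  have h4 : `|P1| * `|r| <= K0 * `|r| by apply: ler_wpM2r => //; exact: P_le.
  have h5 := ler_normB (ip P1 (d1 - d2)) (ip P1 r).
  rewrite h2 in h1; lra_with h1 h5 h4 h3.
have s3 : `|ip P1 (d1 - d2)| <= `|ip P1 d1 - ip P2 d2| + CP * D * k.
  have -> : ip P1 (d1 - d2) = (ip P1 d1 - ip P2 d2) - ip (P1 - P2) d2.
    by rewrite (ipBr hX) (ipBl hX); ring.
  apply: le_trans (ler_normB _ _) _; rewrite lerD2l.
  by apply: le_trans (cauchy_schwarz hX _ _) _; apply: ler_pM.
have s4 : 2 * K0 * `|r| <= 2 * K0 * (k / c * (eps1 + eps2 + CP * D)).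
  by apply: ler_wpM2l; [rewrite mulr_ge0 | exact: rle].
lra_with s4 s3 s2 s1.
Qed.

(* Since the contact pressure acts only where the constraint is active,
   [|A1 - A2| + |Gam1 - Gam2|' <= |B1 - B2|] for [A_i = <P_i, d_i>]. *)
Lemma slope_comparison eps1 eps2 t (x1 x2 : R -> X) d1 d2 :
  0 <= eps1 -> 0 <= eps2 -> 0 < t < T ->
  (forall s, 0 <= s -> s <= T -> Gam s (x1 s) <= 1) ->
  (forall s, 0 <= s -> s <= T -> Gam s (x2 s) <= 1) ->
  has_derivative x1 t d1 -> has_derivative x2 t d2 ->
  slope_cond eps1 t (x1 t) d1 -> slope_cond eps2 t (x2 t) d2 ->
  `|d1| <= kap * phi t -> `|d2| <= kap * phi t ->
  (forall ze d, has_derivative ze t d ->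
     has_derivative (fun s => Gam s (ze s)) t (B t (ze t) d - ip (Pg t (ze t)) d)) ->
  (forall x1 x2 d1 d2, `|d1| <= kap * phi t ->
     `|B t x1 d1 - B t x2 d2| <= delta * c * `|d1 - d2| + CB * phi t * `|x1 - x2|) ->
  exists2 g, (forall e, 0 < e -> exists2 eta, 0 < eta &
     forall x y, x <= t -> t <= y -> t - eta < x -> y < t + eta ->
     `|Gam y (x1 y) - Gam y (x2 y)| - `|Gam x (x1 x) - Gam x (x2 x)| <= (g + e) * (y - x)) &
   (1 - delta) * `|d1 - d2| + g / c <=
     phi t * ((CB + kap * (CP + 2 * K0 * CP / c)) / c * `|x1 t - x2 t|
              + (2 * K0 * kap / c + kap) / c * (eps1 + eps2)).
Proof.
move=> e10 e20 /andP[t0 tT] G1 G2 D1 D2 S1 S2 dk1 dk2 ch Bl.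
have H1 := ch _ _ D1; have H2 := ch _ _ D2.
have Bd := Bl (x1 t) (x2 t) d1 d2 dk1.
set b1 := B t (x1 t) d1 in H1 Bd; set b2 := B t (x2 t) d2 in H2 Bd.
set P1 := Pg t (x1 t) in H1; set P2 := Pg t (x2 t) in H2.
set D := `|x1 t - x2 t| in Bd *; set n := `|d1 - d2| in Bd *.
have D0 : 0 <= D by exact: normr_ge0.
have n0 : 0 <= n by exact: normr_ge0.
set W := phi t * _.
have cn : c != 0 by rewrite gt_eqF.
have WE : c * W = phi t * ((CB + kap * (CP + 2 * K0 * CP / c)) * D
              + (2 * K0 * kap / c + kap) * (eps1 + eps2)).
  by rewrite /W; field.
have fold (q : R) : c * ((1 - delta) * n + q / c) <= c * W -> (1 - delta) * n + q / c <= W.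
  by rewrite ler_pM2l.
have foldE q : c * ((1 - delta) * n + q / c) = c * n - delta * c * n + q by field.
have m1 : 0 <= phi t * (kap * (CP + 2 * K0 * CP / c)) * D.
  by rewrite !mulr_ge0 // addr_ge0 // divr_ge0 ?mulr_ge0 // ltW.
have m2 : 0 <= phi t * (2 * K0 * kap / c) * (eps1 + eps2).
  by rewrite !mulr_ge0 ?invr_ge0 // ?addr_ge0 // ltW.
have m3 : 0 <= phi t * kap * eps1 by rewrite !mulr_ge0.
have m4 : 0 <= phi t * kap * eps2 by rewrite !mulr_ge0.
have r0 : 0 < Num.min t (T - t) by rewrite lt_min t0 subr_gt0.
(* An active constraint at an interior time is a maximum of [Gam] along a feasible trajectory, so
   its derivative vanishes there. *)
have max0 (x : R -> X) b : (forall s, 0 <= s -> s <= T -> Gam s (x s) <= 1) -> Gam t (x t) = 1 ->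
    has_derivative (fun s => Gam s (x s)) t b -> b = 0.
  move=> Gx Gt; apply: (has_derivative_max r0) => s; rewrite lt_min => /andP[h1 h2].
  rewrite Gt; apply: Gx.
    by move: h1; rewrite ltr_norml => /andP[]; (drop_order_hyps; lra).
  by move: h2; rewrite ltr_norml => /andP[]; (drop_order_hyps; lra).
have DG : has_derivative (fun s => Gam s (x1 s) - Gam s (x2 s)) t
    ((b1 - ip P1 d1) - (b2 - ip P2 d2)).
  have := has_derivativeD H1 (has_derivativeZ (-1) H2).
  rewrite scaleN1r (_ : (fun s => _ + -1 *: _) = (fun s => Gam s (x1 s) - Gam s (x2 s))) //.
  by apply/funext => s; rewrite scaleN1r.
set gam := fun s => Gam s (x1 s) - Gam s (x2 s) in DG.
have tri x y : `|gam y| - `|gam x| <= `|gam y - gam x| by exact: lerB_dist.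
have L1 := G1 t (ltW t0) (ltW tT); have L2 := G2 t (ltW t0) (ltW tT).
have ips (P d : X) : d = 0 -> ip P d = 0 by move=> ->; rewrite (ip0r hX).
move: L1; rewrite le_eqVlt => /orP[/eqP A1|I1]; move: L2; rewrite le_eqVlt => /orP[/eqP A2|I2].
(* Both active: the two values of [Gam] agree to first order, so [g = 0], and [<P_i, d_i> = b_i]
   determines the normal speeds. *)
- have q1 := max0 _ _ G1 A1 H1; have q2 := max0 _ _ G2 A2 H2.
  exists 0.
    move=> e e0; have [eta eta0 He] := DG e e0; exists eta => // x y xt ty h1 h2.
    have gt : gam t = 0 by rewrite /gam A1 A2 subrr.
    have := He y; have := He x; rewrite q1 q2 gt !subr0 !scaler0 !subr0.
    have -> : `|x - t| = t - x by rewrite distrC ger0_norm ?subr_ge0.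
    have -> : `|y - t| = y - t by rewrite ger0_norm ?subr_ge0.
    have a1 := normr_ge0 (gam x); move=> a2 a3.
    have {}a2 : `|gam x| <= e * (t - x) by apply: a2; rewrite ltrBlDr -ltrBlDl.
    have {}a3 : `|gam y| <= e * (y - t) by apply: a3; rewrite ltrBlDl.
    have ex : 0 <= e * (t - x) by rewrite mulr_ge0 ?subr_ge0 // ltW.
    lra_with a3 a2 a1.
  apply: fold; rewrite foldE WE.
  have := slope_diff_le e10 e20 (ltW t0) (ltW tT) A1 A2 S1 S2 dk1 dk2.
  rewrite -/P1 -/P2 -/D -/n.
  have -> : ip P1 d1 - ip P2 d2 = b1 - b2 by (drop_order_hyps; lra).
  move=> h; lra_with h m4 m3 Bd.
(* Only the first is active: near [t] the absolute difference is the difference itself, with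
   derivative [- b2]. It combines with [c |d1|], which is at most about [b1], into [b1 - b2]. *)
- have q1 := max0 _ _ G1 A1 H1; have z2 := (S2.1 I2); have z2' := ips P2 _ z2.
  exists (- b2).
    move=> e e0.
    have gt : 0 < gam t by rewrite /gam A1 subr_gt0.
    have [r1 r10 Hr1] := has_derivative_continuous DG gt.
    have [r2 r20 Hr2] := has_derivative_straddle DG e0.
    exists (Num.min r1 r2) => [|x y xt ty]; first by rewrite lt_min r10.
    move=> w1 w2; have [h1 h2 h3 h4] := window_min w1 w2.
    have gp s : `|s - t| < r1 -> 0 <= gam s by move=> /Hr1; rewrite ltr_norml => /andP[]; (drop_order_hyps; lra).
    rewrite -/(gam y) -/(gam x) !ger0_norm; last 2 first.
    - by apply: gp; rewrite distrC ger0_norm ?subr_ge0 // ltrBlDr -ltrBlDl.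
    - by apply: gp; rewrite ger0_norm ?subr_ge0 // ltrBlDl.
    have := Hr2 x y xt ty h3 h4.
    rewrite q1 z2' subr0 sub0r [_ *: _]mulrC ler_norml => /andP[_].
    (drop_order_hyps; lra).
  apply: fold; rewrite foldE WE.
  have := slope_norm_le (ltW t0) (ltW tT) A1 S1; rewrite -/P1.
  have nd : `|d1| = n by rewrite /n z2 subr0.
  have ek : eps1 * n <= eps1 * (kap * phi t) by rewrite -nd; apply: ler_wpM2l.
  rewrite nd; have := ler_norm (b1 - b2).
  move=> a1 a2; lra_with a2 a1 ek m4 m2 m1 Bd.
- have q2 := max0 _ _ G2 A2 H2; have z1 := (S1.1 I1); have z1' := ips P1 _ z1.
  exists (- b1).
    move=> e e0.
    have gt : 0 < - gam t by rewrite /gam A2 opprB subr_gt0.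
    have [r1 r10 Hr1] := has_derivative_continuous DG gt.
    have [r2 r20 Hr2] := has_derivative_straddle DG e0.
    exists (Num.min r1 r2) => [|x y xt ty]; first by rewrite lt_min r10.
    move=> w1 w2; have [h1 h2 h3 h4] := window_min w1 w2.
    have gp s : `|s - t| < r1 -> gam s <= 0 by move=> /Hr1; rewrite ltr_norml => /andP[]; (drop_order_hyps; lra).
    rewrite -/(gam y) -/(gam x) !ler0_norm; last 2 first.
    - by apply: gp; rewrite distrC ger0_norm ?subr_ge0 // ltrBlDr -ltrBlDl.
    - by apply: gp; rewrite ger0_norm ?subr_ge0 // ltrBlDl.
    have := Hr2 x y xt ty h3 h4.
    rewrite q2 z1' !subr0 [_ *: _]mulrC ler_norml => /andP[+ _].
    (drop_order_hyps; lra).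
  apply: fold; rewrite foldE WE.
  have := slope_norm_le (ltW t0) (ltW tT) A2 S2; rewrite -/P2.
  have nd : `|d2| = n by rewrite /n z1 sub0r normrN.
  have ek : eps2 * n <= eps2 * (kap * phi t) by rewrite -nd; apply: ler_wpM2l.
  rewrite nd; have := ler_norm (- (b1 - b2)); rewrite normrN.
  move=> a1 a2; lra_with a2 a1 ek m3 m2 m1 Bd.
(* Both inactive: the velocities vanish and only the dependence of [B] on the state remains. *)
- have z1 := (S1.1 I1); have z2 := (S2.1 I2).
  have z1' := ips P1 _ z1; have z2' := ips P2 _ z2.
  exists (`|b1 - b2|).
    move=> e e0.
    have [|r1 r10 Hr1] := has_derivative_norm_straddle DG (K := `|b1 - b2|) _ e0.
      by rewrite z1' z2' !subr0.
    by exists r1 => // x y xt ty h1 h2; apply: le_trans (tri x y) _; exact: Hr1.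
  apply: fold; rewrite foldE WE.
  have nd : n = 0 by rewrite /n z1 z2 subr0 normr0.
  rewrite nd in Bd *; lra_with Bd m4 m3 m2 m1.
Qed.


(** Gronwall applied to the weighted sum [F] below, whose initial value is zero because the
    trajectories start together. The tolerances contribute only to the inhomogeneous term, so the
    final bound is linear in them. *)
Lemma approx_sol_comparison : exists2 C, 0 <= C & forall eps1 eps2 x1 x2,
  0 <= eps1 -> 0 <= eps2 -> approx_sol eps1 x1 -> approx_sol eps2 x2 -> x1 0 = x2 0 ->
  forall t, 0 <= t -> t <= T -> `|x1 t - x2 t| <= C * (eps1 + eps2).
Proof.
pose K1 := (CB + kap * (CP + 2 * K0 * CP / c)) / c.
pose C2 := (2 * K0 * kap / c + kap) / c.
pose K := K1 / (1 - delta).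
have d1 : 0 < 1 - delta by rewrite subr_gt0.
have K10 : 0 <= K1.
  by rewrite divr_ge0 ?(ltW c0) // addr_ge0 // mulr_ge0 // addr_ge0 // divr_ge0 ?mulr_ge0 // ltW.
have C20 : 0 <= C2.
  by rewrite divr_ge0 ?(ltW c0) // addr_ge0 // divr_ge0 ?mulr_ge0 // ltW.
have K0' : 0 <= K by rewrite divr_ge0 // ltW.
have MT : M 0 <= M T by apply: M_nd => //; exact: ltW.
exists (expR (K * (M T - M 0)) * (C2 * (M T - M 0)) / (1 - delta)).
  by rewrite divr_ge0 ?(ltW d1) // mulr_ge0 ?expR_ge0 // mulr_ge0 // subr_ge0.
move=> eps1 eps2 x1 x2 e10 e20 [L1 G1 S1] [L2 G2 S2] x00 t t0 tT.
(* The weight [1 - delta] is the part of [|d1 - d2|] left in [slope_comparison] after the feedback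
   through [B] has been absorbed. *)
pose F s := (1 - delta) * `|x1 s - x2 s| + `|Gam s (x1 s) - Gam s (x2 s)| / c.
pose E := C2 * (eps1 + eps2).
have E0 : 0 <= E by rewrite mulr_ge0 // addr_ge0.
pose CF := (1 - delta) * (2 * kap) + 2 * (CG * (kap + 1)) / c.
have CF0 : 0 <= CF.
  rewrite addr_ge0 ?mulr_ge0 ?invr_ge0 ?(ltW d1) ?(ltW c0) // addr_ge0 //.
have F_ge0 s : 0 <= F s by rewrite addr_ge0 ?mulr_ge0 ?invr_ge0 // ltW.
have dist_le (V : normedModType R) (a b a' b' : V) :
    `| `|a' - b'| - `|a - b| | <= `|a' - a| + `|b' - b|.
  apply: le_trans (ler_dist_dist _ _) _.
  have -> : a' - b' - (a - b) = (a' - a) - (b' - b) by lmod.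
  exact: ler_normB.
have FL x y : 0 <= x -> x <= y -> y <= t -> `|F y - F x| <= CF * (M y - M x).
  move=> x0 xy yt; have yT := le_trans yt tT.
  have GL (z : R -> X) : (forall s t, 0 <= s -> s <= t -> t <= T -> `|z t - z s| <= kap * (M t - M s)) ->
      `|Gam y (z y) - Gam x (z x)| <= CG * (kap + 1) * (M y - M x).
    move=> Lz; apply: le_trans (Gam_lip _ _ x0 xy yT) _.
    rewrite -mulrA; apply: ler_wpM2l => //; rewrite mulrDl mul1r lerD2r; exact: Lz.
  have h1 := dist_le _ (x1 x) (x2 x) (x1 y) (x2 y).
  have h2 := dist_le R^o (Gam x (x1 x)) (Gam x (x2 x)) (Gam y (x1 y)) (Gam y (x2 y)).
  have h3 := L1 x y x0 xy yT; have h4 := L2 x y x0 xy yT.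
  have h5 := GL _ L1; have h6 := GL _ L2.
  have -> : F y - F x = (1 - delta) * (`|x1 y - x2 y| - `|x1 x - x2 x|)
     + (`|Gam y (x1 y) - Gam y (x2 y)| - `|Gam x (x1 x) - Gam x (x2 x)|) / c.
    by rewrite /F; ring.
  apply: le_trans (ler_normD _ _) _; rewrite !normrM (gtr0_norm d1) normfV (gtr0_norm c0).
  have -> : CF * (M y - M x) = (1 - delta) * (2 * kap * (M y - M x))
     + (2 * (CG * (kap + 1)) * (M y - M x)) / c by rewrite /CF; ring.
  apply: lerD.
    by rewrite ler_pM2l //; apply: le_trans h1 _; lra_with h4 h3.
  by rewrite ler_pM2r ?invr_gt0 //; apply: le_trans h2 _; lra_with h6 h5.
have F00 : F 0 = 0 by rewrite /F x00 !subrr !normr0 mulr0 mul0r addr0.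
have key : F t <= expR (K * (M t - M 0)) * (E * (M t - M 0)).
  apply: (@gronwall_ae R 0 t F M phi CF K E) => //.
  - by move=> x y x0 xy yt; apply: M_nd => //; exact: le_trans tT.
  - by apply: (@null_variation_sub _ _ 0 T) => //.
  apply: (ae_imply (ae_and (ae_and S1 S2) (ae_and M_der (ae_and chain B_lip)))).
  move=> s [[Q1 Q2] [Q3 [Q4 Q5]]] /andP[s0 st].
  have sT : 0 < s < T by rewrite s0 (lt_le_trans st tT).
  have {Q1}[d1' D1 S1'] := Q1 sT; have {Q2}[d2' D2 S2'] := Q2 sT.
  have {}Q3 := Q3 sT; have {}Q4 := Q4 sT; have {}Q5 := Q5 sT.
  have /andP[_ sT'] := sT.
  have r0 : 0 < T - s by rewrite subr_gt0.
  have dk (z : R -> X) d : (forall s t, 0 <= s -> s <= t -> t <= T -> `|z t - z s| <= kap * (M t - M s)) ->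
      has_derivative z s d -> `|d| <= kap * phi s.
    move=> Lz Dz; apply: (has_derivative_dominated r0 kap0 _ Dz Q3) => s' ss' s'T.
    by apply: Lz => //; [exact: ltW | lra_with s'T].
  have dk1 := dk _ _ L1 D1; have dk2 := dk _ _ L2 D2.
  have [g Hg1 Hg2] := slope_comparison e10 e20 sT G1 G2 D1 D2 S1' S2' dk1 dk2 Q4 Q5.
  split => // e e0.
  (* The tolerance is shared between the two summands of [F], which carry the weights [1 - delta]
     and [c^-1]. *)
  have e2 : 0 < e / (1 - delta + c^-1).
    by rewrite divr_gt0 // addr_gt0 // invr_gt0.
  have [r1 r10 Hr1] := Hg1 _ e2.
  have DD : has_derivative (fun s => x1 s - x2 s) s (d1' - d2').
    have := has_derivativeD D1 (has_derivativeZ (-1) D2); rewrite scaleN1r.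
    rewrite (_ : (fun s => _ + -1 *: _) = (fun s => x1 s - x2 s)) //.
    by apply/funext => s'; rewrite scaleN1r.
  have [r2 r20 Hr2] := has_derivative_norm_straddle DD (lexx _) e2.
  exists (Num.min r1 r2) => [|x y x0 xs sy yt]; first by rewrite lt_min r10.
  move=> w1 w2; have [h1 h2 h3 h4] := window_min w1 w2.
  have k1 := Hr1 x y xs sy; have k2 := Hr2 x y xs sy.
  have {}k1 := k1 h1 h2; have {}k2 := k2 h3 h4.
  have k3 : `|x1 y - x2 y| - `|x1 x - x2 x| <= `|x1 y - x2 y - (x1 x - x2 x)| by exact: lerB_dist.
  have yx : 0 <= y - x by rewrite subr_ge0 (le_trans xs).
  set e' := e / _ in k1 k2.
  have ee : e = (1 - delta) * e' + e' / c.
    have -> : (1 - delta) * e' + e' / c = e' * (1 - delta + c^-1) by ring.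
    by rewrite /e' mulfVK // gt_eqF // addr_gt0 // invr_gt0.
  have -> : F y - F x = (1 - delta) * (`|x1 y - x2 y| - `|x1 x - x2 x|)
     + (`|Gam y (x1 y) - Gam y (x2 y)| - `|Gam x (x1 x) - Gam x (x2 x)|) / c.
    by rewrite /F; ring.
  apply: (@le_trans _ _ ((1 - delta) * ((`|d1' - d2'| + e') * (y - x)) + ((g + e') * (y - x)) / c)).
    apply: lerD; first by rewrite ler_pM2l //; exact: le_trans k2.
    by rewrite ler_pM2r ?invr_gt0.
  have -> : (1 - delta) * ((`|d1' - d2'| + e') * (y - x)) + (g + e') * (y - x) / c
     = ((1 - delta) * `|d1' - d2'| + g / c + e) * (y - x) by rewrite [in RHS]ee; ring.
  apply: ler_wpM2r => //; rewrite lerD2r; apply: le_trans Hg2 _.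
  apply: ler_wpM2l => //; rewrite lerD2r -/K1.
  have : K * ((1 - delta) * `|x1 s - x2 s|) = K1 * `|x1 s - x2 s|.
    by rewrite /K mulrA mulfVK // gt_eqF.
  move=> <-; apply: ler_wpM2l => //; rewrite /F lerDl divr_ge0 //; exact: ltW.
have Mt : M t - M 0 <= M T - M 0 by rewrite lerD2r; exact: M_nd.
have Mt0 : 0 <= M t - M 0 by rewrite subr_ge0; apply: M_nd.
have : (1 - delta) * `|x1 t - x2 t| <= expR (K * (M T - M 0)) * (E * (M T - M 0)).
  apply: (@le_trans _ _ (F t)); first by rewrite /F lerDl divr_ge0 // ltW.
  apply: le_trans key _; apply: ler_pM.
  - exact: expR_ge0.
  - by rewrite mulr_ge0.
  - by rewrite ler_expR; apply: ler_wpM2l.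
  - by apply: ler_wpM2l.
rewrite -ler_pdivlMl // => h; apply: le_trans h _.
by rewrite /E le_eqVlt; apply/orP; left; apply/eqP; ring.
Qed.

End comparison.

(** * Radon-Nikodym property, for scalar functions and for Hilbert space valued ones *)

Section density_measure.
Context {R : realType}.
Variable h : R -> R.
Hypothesis h0 : forall x, 0 <= h x.
Hypothesis hI : L1T h.
Local Notation mu := (@lebesgue_measure R).

Definition density_measure (A : set (measurableTypeR R)) : \bar R := \int[mu]_(x in A) (h x)%:E.

Let dm0 : density_measure set0 = 0%E.
Proof. by rewrite /density_measure integral_set0. Qed.

Let dm_ge0 A : (0 <= density_measure A)%E.
Proof. by apply: integral_ge0 => x _; rewrite lee_fin. Qed.

Let dm_sigma : semi_sigma_additive density_measure.
Proof.
apply: semi_sigma_additive_nng_induced => [|x]; last by rewrite lee_fin.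
by case/integrableP: hI.
Qed.

HB.instance Definition _ := isMeasure.Build _ _ _ density_measure dm0 dm_ge0 dm_sigma.

Lemma density_measure_itv a b : a <= b ->
  density_measure `]a, b] = (primitive h b - primitive h a)%:E.
Proof.
move=> ab; rewrite primitiveB // /Rintegral fineK //.
by apply: integrable_fin_num => //; exact: L1T_integrable.
Qed.

Lemma density_measure_fin A : measurable A -> density_measure A \is a fin_num.
Proof. by move=> mA; apply: integrable_fin_num => //; exact: L1T_integrable. Qed.

Lemma density_measure_null A : measurable A -> mu A = 0%E -> density_measure A = 0%E.
Proof.
move=> mA A0; apply/eqP; rewrite eq_le dm_ge0 andbT.
rewrite /density_measure null_set_integral //.
by apply/measurable_funTS; case/integrableP: hI.
Qed.

End density_measure.

Section scalar_rnp.
Variable R : realType.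
Notation mu := (@lebesgue_measure R).

Lemma stieltjes_itv (f : cumulative R R) (a b : R) : a <= b ->
  lebesgue_stieltjes_measure f `]a, b]%classic = (f b - f a)%:E.
Proof.
move=> ab; rewrite /lebesgue_stieltjes_measure /= /measure_extension /=.
rewrite measurable_mu_extE //=; last exact: is_ocitv.
exact: wlength_itv_bnd.
Qed.

(** The Stieltjes measure of [f1] lies below that of [f1 + f2], which has density [h]; it is
    therefore finite and absolutely continuous, and the Radon-Nikodym theorem applies to it. *)
Lemma cumulative_density (f1 f2 : cumulative R R) (h : R -> R) :
  L1T h -> (forall x, 0 <= h x) ->
  (forall a b, a <= b -> (f1 b - f1 a) + (f2 b - f2 a) = primitive h b - primitive h a) ->
  exists rho : R -> R, L1T rho /\
    forall a b, a <= b -> f1 b - f1 a = primitive rho b - primitive rho a.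
Proof.
move=> hI h0 H.
have f3nd : nondecreasing (primitive h) by move=> x y xy; exact: primitive_le.
(* Right continuity is read off from [f1 + f2], which differs from the primitive by a constant. *)
have f3rc : forall x, primitive h @ at_right x --> primitive h x.
  move=> x; have : (fun y => f1 y + f2 y + (primitive h x - f1 x - f2 x)) @ at_right x
      --> f1 x + f2 x + (primitive h x - f1 x - f2 x).
    apply: cvgD; last exact: cvg_cst.
    by apply: cvgD; exact: cumulative_is_right_continuous.
  have -> : (fun y => f1 y + f2 y + (primitive h x - f1 x - f2 x)) = primitive h.
    apply/funext => y; have [xy|/ltW yx] := leP x y.
      have := H x y xy; lra.
    have := H y x yx; lra.
  by have -> : f1 x + f2 x + (primitive h x - f1 x - f2 x) = primitive h x by ring.
pose f3 : cumulative R R := HB.pack (primitive h) (isCumulative.Build R _ R (primitive h) f3nd f3rc).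
pose n1 := lebesgue_stieltjes_measure f1.
pose n2 := lebesgue_stieltjes_measure f2.
pose n3 := lebesgue_stieltjes_measure f3.
have addE A : measure_add n1 n2 A = (n1 A + n2 A)%E by exact: measure_addE.
have E1 : forall A, measurable A -> n3 A = measure_add n1 n2 A.
  apply: (lebesgue_stieltjes_measure_unique (mu := measure_add n1 n2)) => A /ocitvP[->|[[a b] /= ab ->]].
    by rewrite !measure0.
  apply: etrans (esym (addE _)).
  by rewrite /n1 /n2 !stieltjes_itv ?ltW // -EFinD H // ltW.
have E2 : forall A, measurable A -> n3 A = density_measure h A.
  apply: (lebesgue_stieltjes_measure_unique (mu := density_measure h)) => A /ocitvP[->|[[a b] /= ab ->]].
    by rewrite !measure0.
  by rewrite density_measure_itv ?ltW // stieltjes_itv // ltW.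
have le1 A : measurable A -> (n1 A <= density_measure h A)%E.
  move=> mA; rewrite -E2 // E1 //; rewrite [leRHS]addE; exact: leeDl.
have fin1 : fin_num_fun n1.
  move=> A mA; rewrite ge0_fin_numE //; apply: le_lt_trans (le1 A mA) _.
  have := density_measure_fin hI mA; rewrite ge0_fin_numE //.
  exact: (measure_ge0 (density_measure h)).
pose n1f : {finite_measure set (measurableTypeR R) -> \bar R} :=
  HB.pack n1 (@Measure_isFinite.Build _ _ _ n1 fin1).
have dom : n1f `<< mu.
  apply/null_content_dominatesP => A mA A0; apply/eqP; rewrite eq_le measure_ge0 andbT.
  by rewrite -(density_measure_null h0 hI mA A0); exact: le1.
have [r [r0 rf rI rE]] := radon_nikodym_sigma_finite dom.
pose rho x := fine (r x).
have rhoE : EFin \o rho = r by apply/funext => x /=; rewrite fineK.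
have rhoI : L1T rho by rewrite /L1T rhoE.
exists rho; split => // a b ab.
rewrite primitiveB //; apply: EFin_inj; rewrite -stieltjes_itv //.
have := rE `]a, b]%classic (measurable_itv _).
rewrite /Rintegral => ->; rewrite fineK; last first.
  by apply: integrable_fin_num => //; exact: L1T_integrable.
by rewrite -rhoE.
Qed.

(** With [H] a primitive of the dominating density, [H + f] and [H - f] are nondecreasing, so the
    monotone case gives a density of [H + f], from which that of [H] is subtracted. *)
Lemma scalar_radon_nikodym (T : R) (f phi : R -> R) : 0 < T ->
  L1T phi -> (forall x, 0 <= phi x) ->
  (forall s t, 0 <= s -> s <= t -> t <= T -> `|f t - f s| <= primitive phi t - primitive phi s) ->
  exists rho, L1T rho /\
    forall s t, 0 <= s -> s <= t -> t <= T -> f t - f s = primitive rho t - primitive rho s.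
Proof.
move=> T0 Ip p0 H.
(* Clamping time to [[0, T]] extends [f] by constants, since Stieltjes measures live on the whole
   line. *)
pose cl (t : R) := Num.max 0 (Num.min t T).
have cl0 t : 0 <= cl t by rewrite /cl le_max lexx.
have clT t : cl t <= T by rewrite /cl ge_max ge_min lexx orbT ltW.
have cl_id t : 0 <= t -> t <= T -> cl t = t.
  by move=> t0 tT; rewrite /cl (min_idPl tT) (max_idPr t0).
have clnd x y : x <= y -> cl x <= cl y.
  by move=> xy; rewrite /cl; apply: le_max2 => //; apply: le_min2.
have mI : measurable (`[0, T] : set R) by exact: measurable_itv.
pose h' := phi \_ `[0, T].
have I' : L1T h' by exact: L1T_restrict.
have h'0 x : 0 <= h' x by rewrite /h' patchE; case: ifP.
(* The two monotone functions add up to twice the primitive of [h']. *)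
pose h x := 2 * h' x.
have hI : L1T h.
  rewrite /L1T (_ : EFin \o _ = (fun x => 2%:E * (EFin \o h') x)%E); last by apply/funext => x.
  exact: integrableZl.
have h0 x : 0 <= h x by rewrite mulr_ge0.
have hE a b : a <= b -> primitive h b - primitive h a = 2 * (primitive h' b - primitive h' a).
  move=> ab; rewrite primitiveB // primitiveB // -RintegralZl //.
  by apply: L1T_integrable => //; exact: measurable_itv.
have B x y : x <= y -> `|f (cl y) - f (cl x)| <= primitive h' y - primitive h' x.
  move=> xy; have [e|ne] := eqVneq (cl x) (cl y).
    by rewrite e subrr normr0 subr_ge0; exact: primitive_le.
  have cxy := clnd _ _ xy.
  have xT : x <= T.
    rewrite leNgt; apply/negP => Tx; case/eqP: ne.
    by rewrite /cl (min_r (ltW Tx)) (min_r (le_trans (ltW Tx) xy)).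
  have y0 : 0 <= y.
    rewrite leNgt; apply/negP => yn; case/eqP: ne.
    by rewrite /cl !max_l // ge_min ?(ltW yn) // (le_trans xy (ltW yn)).
  have xc : x <= cl x by rewrite /cl le_max le_min lexx xT orbT.
  have cy : cl y <= y by rewrite /cl ge_max ge_min lexx y0.
  apply: le_trans (H _ _ (cl0 x) cxy (clT y)) _.
  have -> : primitive phi (cl y) - primitive phi (cl x) = primitive h' (cl y) - primitive h' (cl x).
    rewrite !primitiveB // /h' -Rintegral_mkcondr; congr Rintegral.
    apply/esym/setIidPl => z /=; rewrite !in_itv /= => /andP[z1 z2].
    by rewrite (le_trans (cl0 x) (ltW z1)) (le_trans z2).
  have := primitive_le I' h'0 xc; have := primitive_le I' h'0 cy; clear; lra.
pose f1 t := primitive h' t + f (cl t).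
pose f2 t := primitive h' t - f (cl t).
have f1nd : nondecreasing f1.
  by move=> x y /B; rewrite ler_norml /f1 => /andP[]; clear; lra.
have f2nd : nondecreasing f2.
  by move=> x y /B; rewrite ler_norml /f2 => /andP[]; clear; lra.
have S a b : a <= b -> (f1 b - f1 a) + (f2 b - f2 a) = primitive h b - primitive h a.
  by move=> ab; rewrite hE // /f1 /f2; ring.
have small x e : 0 < e -> exists2 d, 0 < d & forall y, x <= y -> y - x < d -> primitive h y - primitive h x < e.
  move=> e0; have [d d0 Hd] := Rintegral_abs_continuous hI h0 e0.
  exists d => // y xy yd; rewrite primitiveB //; apply: Hd; first exact: measurable_itv.
  rewrite lebesgue_measure_itv /= lte_fin; case: ifP => _; last by rewrite lte_fin.
  by rewrite -EFinB lte_fin.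
have rc (k : R -> R) : (forall x y, x <= y -> 0 <= k y - k x <= primitive h y - primitive h x) ->
    forall x, k @ at_right x --> k x.
  move=> Hk x; apply/cvgrPdist_lt => e e0; have [d d0 Hd] := small x e e0.
  near=> y; have xy : x <= y by near: y; exact: nbhs_right_ge.
  have /andP[k0 k1] := Hk x y xy; rewrite distrC ger0_norm //; apply: le_lt_trans k1 _.
  by apply: Hd => //; rewrite ltrBlDl; near: y; apply: nbhs_right_lt; rewrite ltrDl.
have f1rc : forall x, f1 @ at_right x --> f1 x.
  apply: rc => x y xy; rewrite -S //; have := f1nd x y xy; have := f2nd x y xy; clear; lra.
have f2rc : forall x, f2 @ at_right x --> f2 x.
  apply: rc => x y xy; rewrite -S //; have := f1nd x y xy; have := f2nd x y xy; clear; lra.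
pose c1 : cumulative R R := HB.pack f1 (isCumulative.Build R _ R f1 f1nd f1rc).
pose c2 : cumulative R R := HB.pack f2 (isCumulative.Build R _ R f2 f2nd f2rc).
have [rho [rI rE]] := @cumulative_density c1 c2 h hI h0 S.
have Irh : L1T (fun x => rho x - h' x).
  rewrite /L1T (_ : EFin \o _ = (EFin \o rho) \- (EFin \o h'))%E; last by apply/funext => x.
  exact: integrableB.
exists (fun x => rho x - h' x); split => //.
move=> s t s0 st tT.
have t_ge0 := le_trans s0 st; have s_leT := le_trans st tT.
have := rE s t st; rewrite /= /f1 !cl_id //.
have sub a b : a <= b -> primitive (fun x => rho x - h' x) b - primitive (fun x => rho x - h' x) a
    = (primitive rho b - primitive rho a) - (primitive h' b - primitive h' a).
  move=> ab; rewrite (primitiveB Irh ab) (primitiveB rI ab) (primitiveB I' ab).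
  by rewrite RintegralB //; exact: L1T_integrable.
rewrite sub //; clear; lra.
Unshelve. all: by end_near. Qed.

End scalar_rnp.


(* A density [m] of the variation which is a countable supremum of
   derivatives of the scalar functions [<xi, z_k>], [|z_k| <= 1]: uniform
   convexity then turns the convergence of these scalar quotients into the
   convergence of the vector quotients. *)
Lemma quotients_close (R : realType) (X : normedModType R) (ip : X -> X -> R)
  (hX : hilbert_inner ip) (z q q' : X) (m e : R) : `|z| <= 1 -> 0 <= m -> 0 <= e ->
  `|q| <= m + e -> `|q'| <= m + e ->
  m < 2 * e \/ m - 2 * e <= ip q z /\ m - 2 * e <= ip q' z ->
  `|q - q'| ^+ 2 <= 24 * e * m + 36 * e ^+ 2.
Proof.
move=> z1 m0 e0 qm qm' iq.
have s1 : `|q| ^+ 2 <= (m + e) ^+ 2 by rewrite ler_sqr ?nnegrE ?addr_ge0.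
have s2 : `|q'| ^+ 2 <= (m + e) ^+ 2 by rewrite ler_sqr ?nnegrE ?addr_ge0.
have par : `|q - q'| ^+ 2 = 2 * `|q| ^+ 2 + 2 * `|q'| ^+ 2 - `|q + q'| ^+ 2.
  by rewrite (normB_sqr hX) (normD_sqr hX); ring.
have [me|me] := leP (2 * e) m; last first.
  have : 4 * (m + e) ^+ 2 <= 24 * e * m + 36 * e ^+ 2.
    have : 0 <= (2 * e - m) * (2 * m + 8 * e) by rewrite mulr_ge0 //; lra.
    have : 0 <= e * m by rewrite mulr_ge0.
    lra.
  by rewrite par; have := sqr_ge0 `|q + q'|; lra.
have [iq1 iq2] : m - 2 * e <= ip q z /\ m - 2 * e <= ip q' z by case: iq => //; lra.
have h : 2 * (m - 2 * e) <= `|q + q'|.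
  have : ip (q + q') z <= `|q + q'| * 1.
    by apply: le_trans (ip_le hX _ _) _; apply: ler_wpM2l.
  rewrite (ipDl hX); lra.
have : (2 * (m - 2 * e)) ^+ 2 <= `|q + q'| ^+ 2 by rewrite ler_sqr ?nnegrE //; lra.
have : 0 <= e ^+ 2 by exact: sqr_ge0.
rewrite par; lra.
Qed.

(** No separability is assumed: the countably many increments between rational times give enough
    test directions, as [xi] is continuous. Completeness enters through the Cauchy criterion for the
    difference quotients at [t]. *)
Lemma hilbert_radon_nikodym (R : realType) (X : completeNormedModType R) (ip : X -> X -> R)
  (hX : hilbert_inner ip) (T : R) (xi : R -> X) (phi : R -> R) : 0 < T ->
  L1T phi -> (forall x, 0 <= phi x) ->
  (forall s t, 0 <= s -> s <= t -> t <= T -> `|xi t - xi s| <= primitive phi t - primitive phi s) ->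
  {ae @lebesgue_measure R, forall t, 0 < t < T -> exists d, has_derivative xi t d}.
Proof.
move=> T0 Ip p0 H.
pose cl (t : R) := Num.max 0 (Num.min t T).
have cl0 t : 0 <= cl t by rewrite /cl le_max lexx.
have clT t : cl t <= T by rewrite /cl ge_max ge_min lexx orbT ltW.
have cl_id t : 0 <= t -> t <= T -> cl t = t.
  by move=> t0 tT; rewrite /cl (min_idPl tT) (max_idPr t0).
(* An enumeration of all increments between rational times; codes of no pair receive 0. *)
pose inc (k : nat) : X := if unpickle k is Some (q1, q2) then
   xi (cl (ratr (q1 : rat))) - xi (cl (ratr (q2 : rat))) else 0.
pose z k := `|inc k|^-1 *: inc k.
have z1 k : `|z k| <= 1.
  rewrite /z normrZ normfV normr_id; have [->|n0] := eqVneq (inc k) 0.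
    by rewrite normr0 mulr0.
  by rewrite mulVf // normr_eq0.
have zinc k : ip (inc k) (z k) = `|inc k|.
  rewrite /z (ipZr hX) (ipxx hX); have [->|n0] := eqVneq (inc k) 0.
    by rewrite normr0 expr0n mulr0.
  by rewrite expr2 mulrA mulVf ?mul1r // normr_eq0.
pose f k t := ip (xi t) (z k).
have fdom k s t : 0 <= s -> s <= t -> t <= T -> `|f k t - f k s| <= primitive phi t - primitive phi s.
  move=> s0 st tT; apply: le_trans (H s t s0 st tT).
  rewrite /f -(ipBl hX); apply: le_trans (cauchy_schwarz hX _ _) _.
  by rewrite ler_piMr.
pose rho k := sval (cid (scalar_radon_nikodym T0 Ip p0 (fdom k))).
have rhoP k : L1T (rho k) /\ forall s t, 0 <= s -> s <= t -> t <= T ->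
    f k t - f k s = primitive (rho k) t - primitive (rho k) s.
  by rewrite /rho; case: cid.
clearbody rho.
have mr k : measurable_fun [set: measurableTypeR R] (rho k).
  by have [/integrableP[/measurable_EFinP ? _] _] := rhoP k.
have mphi : measurable_fun [set: measurableTypeR R] phi.
  by have /integrableP[/measurable_EFinP ? _] := Ip.
(* Truncation between 0 and [phi] makes the supremum over [k] finite at every time, not just almost
   everywhere, and integrable. *)
pose h k t := Num.max 0 (Num.min (rho k t) (phi t)).
have hphi k t : h k t <= phi t by rewrite /h ge_max p0 ge_min lexx orbT.
have h0 k t : 0 <= h k t by rewrite /h le_max lexx.
pose m t := sups (h ^~ t) 0%N.
have bnd t : has_ubound (range (h ^~ t)) by exists (phi t) => _ [k _ <-].
have hsup t : has_sup (range (h ^~ t)) by split => //; exists (h 0%N t); exists 0%N.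
have mE t : m t = sup (range (h ^~ t)).
  rewrite /m /sups /= /sdrop; congr sup; apply/seteqP; split => [_ [k _ <-]|_ [k _ <-]];
  by exists k.
have hm k t : h k t <= m t by rewrite mE; apply: ub_le_sup => //; exists k.
have m0 t : 0 <= m t by exact: le_trans (hm 0%N t).
have mphi' t : m t <= phi t by rewrite mE; apply: ge_sup; [exists (h 0%N t); exists 0%N | move=> _ [k _ <-]].
have madh t e : 0 < e -> exists k, m t - e < h k t.
  move=> e0; have [_ [k _ <-]] := sup_adherent e0 (hsup t).
  by rewrite -mE => ?; exists k.
have mm : measurable_fun [set: measurableTypeR R] m.
  apply: measurable_fun_sups => [t _|k]; first exact: bnd.
  apply: measurable_maxr; first exact: measurable_cst.
  exact: measurable_minr.
have mI : L1T m.
  apply: (le_integrable measurableT _ _ Ip) => /=; first exact/measurable_EFinP.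
  by move=> t _; rewrite /= lee_fin !ger0_norm.
have good : {ae @lebesgue_measure R, forall t, forall k, has_derivative (primitive (rho k)) t (rho k t)}.
  apply/ae_foralln => k; apply: primitive_derivative; by have [] := rhoP k.
have fder t k : 0 < t < T -> has_derivative (primitive (rho k)) t (rho k t) ->
    has_derivative (f k) t (rho k t).
  move=> /andP[t0 tT] D; have [_ E] := rhoP k.
  have r0 : 0 < Num.min t (T - t) by rewrite lt_min t0 subr_gt0.
  have D' := has_derivativeD D (has_derivative_cst (f k 0 - primitive (rho k) 0) t).
  rewrite addr0 in D'; apply: (has_derivative_ext r0 _ D') => s.
  rewrite lt_min !ltr_norml => /andP[/andP[h1 _] /andP[_ h2]].
  have := E 0 s (lexx _) ltac:(lra) ltac:(lra); clear; lra.
have dom1 k s t : 0 <= s -> s <= t -> t <= T -> f k t - f k s <= primitive m t - primitive m s.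
  move=> s0 st tT; apply: ae_upper_derivative_le => //.
  - apply: (@null_variation_le _ _ _ _ _ (primitive phi) _ 1) => //; last exact: primitive_null_variation.
    move=> x y sx xy yt; rewrite mul1r [leRHS]ger0_norm; last by rewrite subr_ge0; exact: primitive_le.
    by apply: fdom => //; [exact: le_trans sx | exact: le_trans tT].
  - by move=> x y _ xy _; exact: primitive_le.
  apply: (ae_imply (ae_and good (ae_and (primitive_derivative mI) (primitive_derivative Ip)))).
  move=> t' [Hr [Hm Hp]] /andP[st' t't] e e0.
  have t'T : 0 < t' < T by rewrite (le_lt_trans s0 st') (lt_le_trans t't tT).
  have D := fder t' k t'T (Hr k).
  have rp : rho k t' <= phi t'.
    apply: le_trans (ler_norm _) _; rewrite -[phi t']mul1r.
    apply: (@has_derivative_dominated _ _ (f k) (primitive phi) t' _ _ (T - t') 1) => //.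
    - by have /andP[_] := t'T; rewrite subr_gt0.
    - move=> s' ts sT; rewrite mul1r; apply: fdom => //; last by move: sT; clear; lra.
      by have /andP[/ltW] := t'T.
  have rm : rho k t' <= m t'.
    by apply: le_trans (hm k t'); rewrite /h le_max le_min lexx rp orbT.
  have e2 : 0 < e / 2 by rewrite divr_gt0.
  have [r1 r10 H1] := has_derivative_straddle D e2.
  have [r2 r20 H2] := has_derivative_straddle Hm e2.
  exists (Num.min r1 r2) => [|x y sx xr ry yt]; first by rewrite lt_min r10.
  rewrite ltrBlDr -ltrBlDl lt_min => /andP[h1 h2].
  rewrite -ltrBlDl lt_min => /andP[h3 h4].
  have a1 := H1 x y xr ry; have a2 := H2 x y xr ry.
  have t1 w : t' - x < w -> t' - w < x by move=> ?; lra.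
  have t2 w : y - t' < w -> y < t' + w by move=> ?; lra.
  move: (a1 (t1 _ h1) (t2 _ h3)) (a2 (t1 _ h2) (t2 _ h4)).
  have w0 : 0 <= y - x by rewrite subr_ge0 (le_trans xr).
  have := ler_wpM2l w0 rm; rewrite /GRing.scale /= !ler_norml.
  clear => rm /andP[_ b1] /andP[b2 _]; lra.
have small e : 0 < e -> exists2 d, 0 < d & forall x y, 0 <= x -> x <= T -> 0 <= y -> y <= T ->
    `|y - x| < d -> `|xi y - xi x| < e.
  move=> e0; have [d d0 Hd] := Rintegral_abs_continuous Ip p0 e0.
  have S x y : 0 <= x -> x <= y -> y <= T -> y - x < d -> `|xi y - xi x| < e.
    move=> x0 xy yT yd; apply: le_lt_trans (H x y x0 xy yT) _.
    rewrite primitiveB //; apply: Hd; first exact: measurable_itv.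
    rewrite lebesgue_measure_itv /= lte_fin; case: ifP => _; last by rewrite lte_fin.
    by rewrite -EFinB lte_fin.
  exists d => // x y x0 xT y0 yT; have [xy|/ltW yx] := leP x y.
    by rewrite ger0_norm ?subr_ge0 // => ?; exact: S.
  by rewrite distrC ger0_norm ?subr_ge0 // distrC => ?; exact: S.
(* The end points are moved to rational times, and the increment is tested against its own
   normalised direction, where the scalar bound [dom1] is nearly sharp. *)
have dom2 s t : 0 <= s -> s <= t -> t <= T -> `|xi t - xi s| <= primitive m t - primitive m s.
  move=> s0 st tT; apply/ler_addgt0Pr => e e0.
  have e4 : 0 < e / 4 by rewrite divr_gt0.
  have [d d0 Hd] := small _ e4.
  have near_rat x : 0 <= x -> x <= T -> exists q : rat, `|xi (cl (ratr q)) - xi x| < e / 4.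
    move=> x0 xT; have [q] := @rat_in_itvoo R (x - d) (x + d) ltac:(lra).
    rewrite in_itv /= => /andP[q1 q2]; exists q; apply: Hd => //.
    rewrite ltr_norml /cl; case: (leP (ratr q) T) => qT; case: (leP 0 _) => q0; move: q1 q2 xT x0 qT q0 d0 T0; clear; lra.
  have [q1 Hq1] := near_rat t ltac:(lra) tT; have [q2 Hq2] := near_rat s s0 ltac:(lra).
  pose k := pickle (q1, q2).
  have incE : inc k = xi (cl (ratr q1)) - xi (cl (ratr q2)) by rewrite /inc /k pickleK.
  have a1 := dom1 k s t s0 st tT; rewrite /f -(ipBl hX) in a1.
  have a2 : ip (inc k - (xi t - xi s)) (z k) <= `|inc k - (xi t - xi s)|.
    by apply: le_trans (ip_le hX _ _) _; rewrite ler_piMr.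
  have a3 : `|inc k - (xi t - xi s)| <= e / 4 + e / 4.
    rewrite incE (_ : _ - _ = (xi (cl (ratr q1)) - xi t) - (xi (cl (ratr q2)) - xi s)); last by lmod.
    by apply: le_trans (ler_normB _ _) _; apply: lerD; exact: ltW.
  rewrite (ipBl hX) zinc in a2.
  have a4 : `|xi t - xi s| <= `|inc k| + `|inc k - (xi t - xi s)|.
    have -> : xi t - xi s = inc k - (inc k - (xi t - xi s)) by lmod.
    rewrite [in leRHS](_ : inc k - (inc k - (inc k - _)) = inc k - (xi t - xi s)); last by lmod.
    exact: ler_normB.
  move: a1 a2 a3 a4; clear; lra.
apply: (ae_imply (ae_and good (ae_and (primitive_derivative mI) (primitive_derivative Ip)))).
move=> t [Hr [Hm Hp]] t0T.
have /andP[t0 tT] := t0T.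
pose q s : X := s^-1 *: (xi (t + s) - xi t).
suff : cvg (q @ 0^').
  move=> C; exists (lim (q @ 0^')); apply: ((@cvg_quotientP R X xi t _ q _).1 C) => s //.
apply/cauchy_cvgP; apply/cauchy_exP => e e0.
(* Makes the bound of [quotients_close] smaller than [e ^+ 2]. *)
have [e1 [e10 He1]] : exists e1, 0 < e1 /\ 24 * e1 * m t + 36 * e1 ^+ 2 < e ^+ 2.
  pose C := 24 * m t + 36; have C0 : 0 < C by rewrite /C; have := m0 t; lra.
  pose e1 := Num.min 1 (e ^+ 2 / (2 * C)).
  have e10 : 0 < e1 by rewrite lt_min ltr01 divr_gt0 ?exprn_gt0 ?mulr_gt0.
  exists e1; split => //.
  have e11 : e1 <= 1 by rewrite ge_min lexx.
  have : e1 * (2 * C) <= e ^+ 2.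
    by rewrite -ler_pdivlMr ?mulr_gt0 // ge_min lexx orbT.
  have : e1 ^+ 2 <= e1 by rewrite expr2 ler_piMr // ltW.
  have : 0 < e1 * C by rewrite mulr_gt0.
  rewrite /C; have := m0 t; nra.
have [k Hk] := madh t e1 e10.
have [r1 r10 H1] := Hm _ e10.
have D := fder t k t0T (Hr k).
have [r2 r20 H2] := D _ e10.
have rk : m t - e1 < 0 \/ m t - e1 < rho k t.
  move: Hk; rewrite /h lt_max lt_min => /orP[|/andP[h1 _]]; [left|right] => //.
pose r := Num.min (Num.min r1 r2) (Num.min t (T - t)).
have r0 : 0 < r by rewrite !lt_min r10 r20 t0 subr_gt0.
(* Every short quotient has norm almost at most [m t], and almost attains [m t] in the one direction
   [z k]; two such vectors are close. *)
have Q s : `|s| < r -> s != 0 -> `|q s| <= m t + e1 /\ (m t - e1 < rho k t -> m t - 2 * e1 <= ip (q s) (z k)).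
  rewrite !lt_min => /andP[/andP[s1 s2] /andP[s3 s4]] sn.
  have s0 : 0 < `|s| by rewrite normr_gt0.
  have := H1 (t + s); have := H2 (t + s); rewrite (addrC t s) addrK => /(_ s2) b2 /(_ s1) b1.
  have nq : `|q s| * `|s| = `|xi (s + t) - xi t|.
    by rewrite /q (addrC t s) normrZ normfV mulrAC mulVf ?mul1r // normr_eq0.
  have c1 : `|xi (s + t) - xi t| <= `|primitive m (s + t) - primitive m t|.
    move: s3 s4; rewrite !ltr_norml => /andP[u1 u2] /andP[u3 u4].
    have [sp|sp] := leP 0 s.
      apply: le_trans (ler_norm _); apply: dom2; [exact: ltW | by rewrite lerDr | by move: u4; clear; lra].
    rewrite distrC [leRHS]distrC; apply: le_trans (ler_norm _).
    by apply: dom2; [move: u1; clear; lra | rewrite gerDr ltW | exact: ltW].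
  have c2 : `|primitive m (s + t) - primitive m t| <= `|s| * (m t + e1).
    rewrite -[_ - primitive m t](subrK (s *: m t)); apply: le_trans (ler_normD _ _) _.
    by rewrite normrZ (ger0_norm (m0 t)) mulrDr addrC lerD2l mulrC.
  split.
    by rewrite -(ler_pM2r s0) nq mulrC; exact: le_trans c2.
  move=> {}rk.
  have fq : f k (s + t) - f k t = s * ip (q s) (z k).
    by rewrite /f /q -(ipBl hX) (ipZl hX) mulrA divff ?mul1r // (addrC t).
  move: b2; rewrite fq -mulrBr normrM mulrC ler_pM2r // ler_norml => /andP[b2 _].
  move: b2 rk; clear; lra.
exists (q (r / 2)).
have r2r : `|r / 2| < r by rewrite gtr0_norm ?divr_gt0 //; move: r0; clear; lra.
have r2n : r / 2 != 0 by rewrite gt_eqF // divr_gt0.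
have [A1 A2] := Q _ r2r r2n.
suff : nbhs 0^' (fun s => ball (q (r / 2)) e (q s)) by [].
rewrite /dnbhs /within; apply/nbhs_ballP; exists r => //= s.
move=> sB sn; have sr : `|s| < r by move: sB; rewrite -ball_normE /= sub0r normrN.
have [A3 A4] := Q s sr sn; rewrite -ball_normE /=.
rewrite -(@ltr_pXn2r _ 2) // ?nnegrE ?(ltW e0) //; apply: le_lt_trans He1.
apply: (quotients_close hX (z1 k)) => //; first exact: ltW.
case: rk => rk; first by left; move: rk e10 (m0 t); clear; lra.
by right; split; [exact: A2 | exact: A4].
Qed.

(** * Prox-regularity of the level sets *)

Lemma has_derivative_sqr (R : realType) (s : R) : has_derivative (fun s => s ^+ 2) s (2 * s).
Proof.
move=> e e0; exists e => // s' h.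
have -> : s' ^+ 2 - s ^+ 2 - (s' - s) *: (2 * s) = (s' - s) ^+ 2 by rewrite /GRing.scale /=; ring.
by rewrite normrX expr2; apply: ler_wpM2r => //; exact: ltW.
Qed.

Section prox_regularity.
Variables (R : realType) (X : normedModType R) (ip : X -> X -> R).
Hypothesis hX : hilbert_inner ip.
Variables (F : X -> R) (gr : X -> X) (c lam C0 : R).
Hypothesis c_gt0 : 0 < c.
Hypothesis lam_gt0 : 0 < lam.
Hypothesis C0_gt0 : 0 < C0.
Hypothesis taylor : forall x h, `|F (x + h) - F x - ip (gr x) h| <= C0 * `|h| ^+ 2.
Hypothesis gr_lip : forall x y, `|gr x - gr y| <= C0 * `|x - y|.
Hypothesis gr_ge : forall x, F x = 1 -> c <= `|gr x|.
Hypothesis gr_mono : forall x z, F x = 1 -> F z <= 1 ->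
  - lam * `|x - z| ^+ 2 <= ip (gr x - gr z) (x - z).

Lemma has_derivative_line x d s : has_derivative (fun s => F (x + s *: d)) s (ip (gr (x + s *: d)) d).
Proof.
move=> e e0; pose K := C0 * `|d| ^+ 2 + 1.
have K0 : 0 < K.
  have : 0 <= C0 * `|d| ^+ 2 by rewrite mulr_ge0 ?sqr_ge0 // ltW.
  rewrite /K; lra.
exists (e / K); first exact: divr_gt0.
move=> s' ss; have := taylor (x + s *: d) ((s' - s) *: d).
have -> : x + s *: d + (s' - s) *: d = x + s' *: d by lmod.
rewrite (ipZr hX) normrZ exprMn => h; apply: le_trans h _.
move: ss; rewrite ltr_pdivlMr // => ss.
have -> : C0 * (`|s' - s| ^+ 2 * `|d| ^+ 2) = `|s' - s| * (`|s' - s| * (C0 * `|d| ^+ 2)) by ring.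
rewrite [e * _]mulrC; apply: ler_wpM2l => //; apply: le_trans (ltW ss).
by apply: ler_wpM2l => //; rewrite /K; lra.
Qed.

Lemma continuous_line x d s : forall e, 0 < e -> exists2 eta, 0 < eta &
  forall s', `|s' - s| < eta -> `|F (x + s' *: d) - F (x + s *: d)| < e.
Proof. exact: has_derivative_continuous (has_derivative_line x d s). Qed.

(** A point of the segment from [x] to [z] may lie outside the set, but its value exceeds 1 by at
    most [2 * C0 * s * D ^+ 2]. Pushed back along the unit gradient it satisfies [gr_mono]; the
    displacement costs a term of order [D ^+ 3]. Integration along the segment gives the expected
    constant [lam / 2] up to a factor tending to 1 as [D] tends to 0. *)
Lemma hypomonotone_near x z : F x = 1 -> F z <= 1 ->
  `|z - x| <= 1 -> `|z - x| <= c / (6 * C0) ->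
  ip (gr x) (z - x) <=
    (lam + (lam * (2 * (8 * C0 / c) + (8 * C0 / c) ^+ 2)
      + C0 * (2 * (8 * C0 / c) + (8 * C0 / c) ^+ 2)) * `|z - x|) / 2 * `|z - x| ^+ 2.
Proof.
move=> Fx Fz d1 d2; set d := z - x in d1 d2 *.
have c0 := c_gt0; have l0 := lam_gt0; have C00 := C0_gt0.
set E := 8 * C0 / c; have E0 : 0 < E by rewrite !mulr_gt0 // invr_gt0.
set C := lam * _ + _.
set D := `|d| in d1 d2 *; have D0 : 0 <= D by exact: normr_ge0.
have g0 : c <= `|gr x| by exact: gr_ge.
have gp : 0 < `|gr x| by exact: lt_le_trans g0.
pose n := `|gr x|^-1 *: gr x.
have n1 : `|n| = 1 by rewrite /n normrZ normfV normr_id mulVf // gt_eqF.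
have grn : ip (gr x) n = `|gr x|.
  by rewrite /n (ipZr hX) (ipxx hX) expr2 mulrA mulVf ?mul1r // gt_eqF.
have i0 : ip (gr x) d <= C0 * D ^+ 2.
  have := taylor x d; rewrite /d subrKC Fx ler_norml => /andP[+ _].
  by rewrite -/d -/D; move: Fz; lra.
have d2' : 6 * C0 * D <= c by move: d2; rewrite ler_pdivlMr ?mulr_gt0 // mulrC.
have key s : 0 <= s <= 1 ->
    s * ip (gr x) d - lam * s ^+ 2 * D ^+ 2 - C * s ^+ 2 * D ^+ 3 <= s * ip (gr (x + s *: d)) d.
  move=> /andP[s0 s1]; set xs := x + s *: d.
  (* With [k * c = 8 * C0 * s * D ^+ 2] and [C0 * D <= c / 6], the first order decrease along [n]
     outweighs the excess and both second order errors. *)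
  pose k := E * s * D ^+ 2.
  have k0 : 0 <= k.
    by apply: mulr_ge0; [apply: mulr_ge0 => //; exact: ltW | exact: sqr_ge0].
  have xsx : `|xs - x| = s * D.
    by rewrite /xs (_ : _ - x = s *: d) ?normrZ ?ger0_norm //; lmod.
  pose y := xs - k *: n.
  have Fxs : F xs <= 1 + 2 * C0 * s * D ^+ 2.
    have := taylor x (s *: d); rewrite -/xs Fx (ipZr hX) normrZ (ger0_norm s0) exprMn -/D.
    rewrite ler_norml => /andP[_].
    have : s * ip (gr x) d <= s * (C0 * D ^+ 2) by apply: ler_wpM2l.
    have : C0 * (s ^+ 2 * D ^+ 2) <= C0 * (s * D ^+ 2).
      apply: ler_wpM2l; first exact: ltW.
      by apply: ler_wpM2r; [exact: sqr_ge0 | rewrite expr2 ler_piMl].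
    lra.
  have gxs : c - C0 * D <= ip (gr xs) n.
    have : `|ip (gr xs - gr x) n| <= C0 * D.
      apply: le_trans (cauchy_schwarz hX _ _) _; rewrite n1 mulr1.
      apply: le_trans (gr_lip _ _) _; apply: ler_wpM2l; first exact: ltW.
      by rewrite xsx ler_piMl.
    rewrite (ipBl hX) grn ler_norml => /andP[h _]; lra.
  have Fy : F y <= 1.
    have := taylor xs (- (k *: n)); rewrite -/y normrN (ipNr hX) (ipZr hX) normrZ n1 mulr1.
    rewrite (ger0_norm k0) ler_norml => /andP[_].
    have : k * (c - C0 * D) <= k * ip (gr xs) n by apply: ler_wpM2l.
    have kE : k * c = 8 * C0 * s * D ^+ 2.
      by rewrite /k /E; field; rewrite gt_eqF.
    have : C0 * k ^+ 2 <= k * (c / 2).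
      have -> : C0 * k ^+ 2 = k * (C0 * k) by ring.
      apply: ler_wpM2l => //.
      rewrite -(ler_pM2r c0) -mulrA kE.
      have q1 : (C0 * D) ^+ 2 <= (c / 6) ^+ 2.
        by rewrite ler_sqr ?nnegrE ?mulr_ge0 ?invr_ge0 ?(ltW c0) ?(ltW C00) //; lra.
      have q2 : s * (C0 * D) ^+ 2 <= (C0 * D) ^+ 2 by rewrite ler_piMl ?sqr_ge0.
      have -> : C0 * (8 * C0 * s * D ^+ 2) = 8 * (s * (C0 * D) ^+ 2) by ring.
      have : 0 <= c ^+ 2 by exact: sqr_ge0.
      lra_with q2 q1.
    have : k * (C0 * D) <= k * (c / 6) by apply: ler_wpM2l => //; lra.
    have : 0 <= C0 * s * D ^+ 2 by rewrite mulr_ge0 ?sqr_ge0 // mulr_ge0 // ltW.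
    lra_with Fxs.
  have := gr_mono Fx Fy.
  have yx : `|x - y| <= s * D + k.
    have -> : x - y = k *: n - (xs - x) by rewrite /y; lmod.
    apply: le_trans (ler_normB _ _) _; rewrite normrZ n1 mulr1 (ger0_norm k0) xsx; (drop_order_hyps; lra).
  have yxs : `|gr xs - gr y| <= C0 * k.
    apply: le_trans (gr_lip _ _) _; apply: ler_wpM2l; first exact: ltW.
    by rewrite /y opprB addrCA subrr addr0 normrZ n1 mulr1 ger0_norm.
  have gyx : `|gr y - gr x| <= C0 * (s * D + k).
    apply: le_trans (gr_lip _ _) _; apply: ler_wpM2l; first exact: ltW.
    by rewrite distrC.
  (* Passage through the pushed-back point [y]: one term for [gr_mono], two errors due to the
     displacement [k]. *)
  have dec : s * ip (gr xs) d - s * ip (gr x) d =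
      ip (gr x - gr y) (x - y) + k * ip (gr y - gr x) n + s * ip (gr xs - gr y) d.
    have -> : x - y = k *: n - s *: d by rewrite /y /xs; lmod.
    by rewrite !(ipE hX); ring.
  have b1 : - (k * (C0 * (s * D + k))) <= k * ip (gr y - gr x) n.
    rewrite -mulrN; apply: ler_wpM2l => //.
    have := cauchy_schwarz hX (gr y - gr x) n; rewrite n1 mulr1 ler_norml => /andP[+ _].
    by apply: le_trans; rewrite lerN2.
  have b2 : - (s * (C0 * k * D)) <= s * ip (gr xs - gr y) d.
    rewrite -mulrN; apply: ler_wpM2l => //.
    have := cauchy_schwarz hX (gr xs - gr y) d; rewrite ler_norml => /andP[+ _].
    by apply: le_trans; rewrite lerN2; apply: ler_wpM2r.
  have b3 : lam * `|x - y| ^+ 2 <= lam * (s * D + k) ^+ 2.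
    by apply: ler_wpM2l; [exact: ltW | rewrite ler_sqr ?nnegrE // addr_ge0 // mulr_ge0].
  have b4 : lam * (s * D + k) ^+ 2 + k * (C0 * (s * D + k)) + s * (C0 * k * D)
      <= lam * s ^+ 2 * D ^+ 2 + C * s ^+ 2 * D ^+ 3.
    have : (lam + C0) * E ^+ 2 * s ^+ 2 * D ^+ 4 <= (lam + C0) * E ^+ 2 * s ^+ 2 * D ^+ 3.
      apply: ler_wpM2l; first by rewrite mulr_ge0 ?sqr_ge0 // mulr_ge0 ?sqr_ge0 // addr_ge0 // ltW.
      by rewrite [in leLHS]exprS ler_piMl // exprn_ge0.
    rewrite /k /C; move=> h; rewrite -subr_ge0.
    by apply: le_trans (_ : _ <= (lam + C0) * E ^+ 2 * s ^+ 2 * D ^+ 3 - (lam + C0) * E ^+ 2 * s ^+ 2 * D ^+ 4) _;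
      [rewrite subr_ge0 | rewrite le_eqVlt; apply/orP; left; apply/eqP; ring].
  move=> b5; move: dec b1 b2 b3 b4 b5; clear; lra.
have : F x <= F z + lam / 2 * D ^+ 2 + C / 2 * D ^+ 3 - ip (gr x) d.
  pose A := lam / 2 * D ^+ 2 + C / 2 * D ^+ 3.
  (* [key] says that [f] has a nonpositive derivative: [A * s ^+ 2] is the primitive of the
     admissible gradient loss. *)
  pose f s := - F (x + s *: d) + ip (gr x) d * s - A * s ^+ 2.
  have : f 1 <= f 0.
    apply: derivative_le0 => // s s01.
    exists (- ip (gr (x + s *: d)) d + ip (gr x) d - A * (2 * s)).
      have := key s s01; have /andP[s0 _] := s01.
      move: s0; rewrite le_eqVlt => /orP[/eqP <-|sp]; first by rewrite scale0r addr0 !mulr0; lra.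
      have -> : s * ip (gr x) d - lam * s ^+ 2 * D ^+ 2 - C * s ^+ 2 * D ^+ 3
         = s * (ip (gr x) d - A * (2 * s)) by rewrite /A; field.
      rewrite ler_pM2l //; lra.
    have := has_derivativeD (has_derivativeD (has_derivativeZ (-1) (has_derivative_line x d s))
       (has_derivativeZ (ip (gr x) d) (has_derivative_id s)))
       (has_derivativeZ (- A) (has_derivative_sqr s)).
    rewrite /f (_ : -1 *: _ + _ *: 1 + - A *: _ = - ip (gr (x + s *: d)) d + ip (gr x) d - A * (2 * s)); last first.
      by rewrite /GRing.scale /=; ring.
    apply: (has_derivative_ext ltr01) => s' _; rewrite /GRing.scale /=; ring.
  rewrite /f scale0r addr0 scale1r {1}/d subrKC expr1n expr0n /= /A; lra.
rewrite Fx; have -> : (lam + C * D) / 2 * D ^+ 2 = lam / 2 * D ^+ 2 + C / 2 * D ^+ 3 by ring.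
lra.
Qed.

Let unit_gr y := `|gr y|^-1 *: gr y.

Lemma unit_gr_props y : F y = 1 ->
  [/\ `|unit_gr y| = 1, gr y = `|gr y| *: unit_gr y & 0 < `|gr y|].
Proof.
move=> /gr_ge g; have gp : 0 < `|gr y| by exact: lt_le_trans g.
have gn : `|gr y| != 0 by rewrite gt_eqF.
split => //; first by rewrite /unit_gr normrZ normfV normr_id mulVf.
by rewrite /unit_gr scalerA divff // scale1r.
Qed.

(* Moving an almost nearest point [y] of [p] by a multiple of
   [(p - y) / |p - y| - n_y] stays in the set and would come too close to
   [p] unless these two unit vectors almost coincide. *)
Lemma almost_nearest_aligned y p rho e1 s : F y = 1 -> 0 < rho -> 0 < s ->
  s <= c / (2 * C0) -> s <= rho / 2 -> 0 <= e1 -> e1 <= rho ^+ 2 ->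
  (forall v, F v <= 1 -> rho <= `|v - p|) -> `|p - y| ^+ 2 <= rho ^+ 2 + e1 ->
  `|p - y - rho *: unit_gr y| ^+ 2 <= e1 * (8 * rho / s + 2).
Proof.
move=> Fy r0 s0 sc sr e10 e1r far near_; have [n1 gE gp] := unit_gr_props Fy.
set n := unit_gr y in n1 gE *; set w := p - y in near_ *; set g := `|gr y| in gE gp.
have cg : c <= g by exact: gr_ge.
have wr : rho <= `|w| by rewrite /w distrC; apply: far; rewrite Fy.
have w0 : 0 < `|w| by exact: lt_le_trans wr.
pose u := `|w|^-1 *: w.
have wn : `|w| != 0 by rewrite gt_eqF.
have u1 : `|u| = 1 by rewrite /u normrZ normfV normr_id mulVf.
have wE : w = `|w| *: u by rewrite /u scalerA divff // scale1r.
set V := `|u - n| ^+ 2.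
have VE : V = 2 - 2 * ip u n by rewrite /V (normB_sqr hX) u1 n1; ring.
have V0 : 0 <= V by exact: sqr_ge0.
pose h := s *: (u - n).
have h2 : `|h| ^+ 2 = s ^+ 2 * V by rewrite /h normrZ exprMn gtr0_norm.
have ih : ip (gr y) h = - (s * g * V / 2).
  by rewrite gE /h (ipZl hX) (ipZr hX) (ipBr hX) (ipxx hX) n1 (ipC hX n u) VE; field.
have Fh : F (y + h) <= 1.
  have := taylor y h; rewrite Fy ih h2 ler_norml => /andP[_].
  have : C0 * s * (s * V) <= g / 2 * (s * V).
    apply: ler_wpM2r; first by rewrite mulr_ge0 // ltW.
    have : C0 * s <= C0 * (c / (2 * C0)) by apply: ler_wpM2l => //; exact: ltW.
    have -> : C0 * (c / (2 * C0)) = c / 2 by field; rewrite gt_eqF.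
    lra.
  lra.
have := far _ Fh.
have -> : y + h - p = - (w - h) by rewrite /w; lmod.
rewrite normrN => b0; have : rho ^+ 2 <= `|w - h| ^+ 2.
  by rewrite ler_sqr ?nnegrE ?(ltW r0).
rewrite (normB_sqr hX) h2.
have -> : ip w h = `|w| * s * V / 2.
  by rewrite {1}wE /h (ipZl hX) (ipZr hX) (ipBr hX) (ipxx hX) u1 VE; field.
move=> b1.
have b2 : V * (s * rho / 2) <= e1.
  have : V * s * (rho / 2) <= V * s * (`|w| - s).
    apply: ler_wpM2l; first by rewrite mulr_ge0 // ltW.
    lra.
  lra.
have b3 : V <= 2 * e1 / (s * rho).
  by rewrite ler_pdivlMr ?mulr_gt0 //; lra.
have -> : w - rho *: n = `|w| *: (u - n) + (`|w| - rho) *: n.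
  by rewrite {1}wE; lmod.
have b4 : `| `|w| *: (u - n) + (`|w| - rho) *: n| ^+ 2 <= 2 * (`|w| ^+ 2 * V) + 2 * (`|w| - rho) ^+ 2.
  set A := _ *: (u - n); set B := _ *: n.
  have -> : `|w| ^+ 2 * V = `|A| ^+ 2 by rewrite /A normrZ exprMn normr_id.
  have -> : (`|w| - rho) ^+ 2 = `|B| ^+ 2.
    by rewrite /B normrZ n1 mulr1 real_normK // num_real.
  have := sqr_ge0 `|A - B|; rewrite (normD_sqr hX A B) (normB_sqr hX A B); lra.
apply: le_trans b4 _.
have b5 : (`|w| - rho) ^+ 2 <= e1.
  have : 0 <= rho * (`|w| - rho) by rewrite mulr_ge0 ?subr_ge0 // ltW.
  lra.
have b6 : `|w| ^+ 2 * V <= 2 * rho ^+ 2 * (2 * e1 / (s * rho)).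
  by apply: ler_pM => //; lra_with near_ e1r.
have -> : e1 * (8 * rho / s + 2) = 2 * (2 * rho ^+ 2 * (2 * e1 / (s * rho))) + 2 * e1.
  by field; rewrite !gt_eqF.
lra_with b6 b5.
Qed.

(** The points [x + rho n_x] and [y + rho n_y] differ by [e]. If they coincided,
    [|x - y| = rho |n_x - n_y|] would turn hypomonotonicity into [c / rho <= lam] unless [x = y];
    for [rho < c / lam] a small [e] thus forces [x] and [y] together. *)
Lemma common_center_ineq x y rho (e : X) : F x = 1 -> F y = 1 -> 0 < rho ->
  x - y = e - rho *: (unit_gr x - unit_gr y) ->
  (c / rho - lam) * `|x - y| ^+ 2 <=
    `|e| * (`|gr x| + `|gr y| + 2 * c / rho * `|x - y|).
Proof.
move=> Fx Fy r0 E.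
have [n1 gE gp] := unit_gr_props Fx; have [n1' gE' gp'] := unit_gr_props Fy.
have cg := gr_ge Fx; have cg' := gr_ge Fy.
have Fy1 : F y <= 1 by rewrite Fy.
move: n1 gE n1' gE' E; move: (unit_gr x) (unit_gr y) => n n' n1 gE n1' gE' E.
set g := `|gr x| in gE gp cg *; set g' := `|gr y| in gE' gp' cg' *.
set D := `|x - y|; set V := `|n - n'| ^+ 2.
have VE : V = 2 - 2 * ip n n' by rewrite /V (normB_sqr hX) n1 n1'; ring.
have V0 : 0 <= V by exact: sqr_ge0.
have i1 : ip (gr x - gr y) (n - n') = (g + g') * V / 2.
  by rewrite gE gE' !(ipE hX) !(ipxx hX) n1 n1' (ipC hX n' n) VE; field.
have i2 : ip (gr x - gr y) e <= (g + g') * `|e|.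
  by apply: le_trans (ip_le hX _ _) _; apply: ler_wpM2r => //; exact: ler_normB.
have b1 : - lam * D ^+ 2 <= (g + g') * `|e| - rho * ((g + g') * V / 2).
  apply: le_trans (gr_mono Fx Fy1) _; rewrite E (ipBr hX) (ipZr hX) i1; lra.
have b2 : rho * c * V <= rho * ((g + g') * V / 2).
  have -> : rho * ((g + g') * V / 2) = rho * ((g + g') / 2) * V by ring.
  by apply: ler_wpM2r => //; rewrite ler_pM2l //; lra.
have b3 : D ^+ 2 - 2 * (`|e| * D) <= rho ^+ 2 * V.
  have -> : rho ^+ 2 * V = `|e - (x - y)| ^+ 2.
    have -> : e - (x - y) = rho *: (n - n') by rewrite E; lmod.
    by rewrite normrZ exprMn gtr0_norm.
  rewrite (normB_sqr hX e (x - y)) -/D; have := ip_le hX e (x - y); rewrite -/D.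
  have := sqr_ge0 `|e|; lra.
have cr : 0 < c / rho by rewrite divr_gt0.
have b4 : c / rho * (D ^+ 2 - 2 * (`|e| * D)) <= c / rho * (rho ^+ 2 * V) by rewrite ler_pM2l.
have b5 : c / rho * (rho ^+ 2 * V) = rho * c * V by field; rewrite gt_eqF.
rewrite b5 in b4.
have -> : (c / rho - lam) * D ^+ 2 = c / rho * (D ^+ 2 - 2 * (`|e| * D)) - lam * D ^+ 2 + 2 * c / rho * D * `|e|.
  by ring.
have -> : `|e| * (g + g' + 2 * c / rho * D) = (g + g') * `|e| + 2 * c / rho * D * `|e| by ring.
lra_with b4 b2 b1.
Qed.

(** If the inequality fails, the largest exterior ball touching at [x] has radius [rho < c / lam].
    Its centre [p] has another almost nearest point, and this one stays away from [x] by the local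
    estimate. There [p] lies almost on the normal ray, so [x] and that point nearly share a centre,
    against [common_center_ineq]. Nearest points need not exist in infinite dimension, hence the
    quantitative argument with [eps]. *)
Lemma prox_regular x z : F x = 1 -> F z <= 1 ->
  ip (gr x) (z - x) <= `|gr x| * (lam / (2 * c)) * `|z - x| ^+ 2.
Proof.
move=> Fx Fz; rewrite leNgt; apply/negP => bad.
have c0 := c_gt0; have l0 := lam_gt0; have C00 := C0_gt0.
have [n1 gE gp] := unit_gr_props Fx; have cg := gr_ge Fx.
pose n := unit_gr x; have nE : unit_gr x = n by [].
rewrite nE in n1 gE; clearbody n; set g := `|gr x| in gE gp cg bad.
have ngr v : ip (gr x) v = g * ip n v by rewrite gE (ipZl hX).
pose Q := [set q : R | exists y, [/\ F y <= 1, y != x & q = 2 * ip n (y - x) / `|y - x| ^+ 2]].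
have pos y : y != x -> 0 < `|y - x| ^+ 2 by move=> yx; rewrite exprn_gt0 // normr_gt0 subr_eq0.
have Qub q : Q q -> q <= 2 * C0 / c.
  move=> [y [Fy yx ->]]; rewrite ler_pdivrMr ?pos //.
  have := taylor x (y - x); rewrite subrKC Fx ler_norml => /andP[+ _].
  rewrite ngr => h; have {}h : g * ip n (y - x) <= C0 * `|y - x| ^+ 2 by lra.
  have [i0|i0] := leP (ip n (y - x)) 0.
    have : 0 <= 2 * C0 / c * `|y - x| ^+ 2.
      by rewrite mulr_ge0 ?sqr_ge0 // divr_ge0 ?mulr_ge0 // ltW.
    lra.
  have : c * ip n (y - x) <= g * ip n (y - x) by rewrite ler_pM2r.
  move=> h'; have -> : 2 * C0 / c * `|y - x| ^+ 2 = 2 * (C0 * `|y - x| ^+ 2 / c) by ring.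
  by rewrite ler_pM2l // ler_pdivlMr //; lra.
have zx : z != x.
  by apply: contraTneq bad => ->; rewrite subrr (ip0r hX) normr0 expr0n mulr0 ltxx.
pose qz := 2 * ip n (z - x) / `|z - x| ^+ 2.
have Qz : Q qz by exists z.
have qzl : lam / c < qz.
  rewrite ltr_pdivlMr ?pos //; move: bad; rewrite ngr.
  have -> : g * (lam / (2 * c)) * `|z - x| ^+ 2 = g * (lam / c * `|z - x| ^+ 2 / 2).
    by field; rewrite gt_eqF.
  by rewrite ltr_pM2l //; lra.
have hQ : has_sup Q by split; [exists qz | exists (2 * C0 / c)].
pose S := sup Q.
have SQ q : Q q -> q <= S by move=> Hq; apply: ub_le_sup => //; case: hQ.
have Sl : lam / c < S by exact: lt_le_trans (SQ _ Qz).
have lc : 0 < lam / c by rewrite divr_gt0.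
have S0 : 0 < S by exact: lt_trans Sl.
(* The quotient in [Q] at [y] is the reciprocal of the radius of the ball tangent at [x] whose
   sphere passes through [y], so [S^-1] is the largest admissible radius. *)
pose rho := S^-1; have r0 : 0 < rho by rewrite invr_gt0.
have rS : rho * S = 1 by rewrite mulVf // gt_eqF.
pose p := x + rho *: n.
have yp y : `|y - p| ^+ 2 = `|y - x| ^+ 2 - 2 * rho * ip n (y - x) + rho ^+ 2.
  have -> : y - p = (y - x) - rho *: n by rewrite /p; lmod.
  by rewrite (normB_sqr hX) (ipZr hX) normrZ n1 mulr1 (ipC hX (y - x)) gtr0_norm //; ring.
have far y : F y <= 1 -> rho <= `|y - p|.
  move=> Fy; suff : rho ^+ 2 <= `|y - p| ^+ 2 by rewrite ler_sqr ?nnegrE ?(ltW r0).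
  rewrite yp; have [->|yx] := eqVneq y x; first by rewrite subrr (ip0r hX) normr0 expr0n /= mulr0 subr0 add0r.
  have : 2 * ip n (y - x) / `|y - x| ^+ 2 <= S by apply: SQ; exists y.
  rewrite ler_pdivrMr ?pos // => h.
  have : rho * (2 * ip n (y - x)) <= rho * (S * `|y - x| ^+ 2) by rewrite ler_pM2l.
  by rewrite [rho * (S * _)]mulrA rS mul1r; lra.
have Fp : 1 < F p.
  rewrite ltNge; apply/negP => /far; rewrite subrr normr0; lra.
pose s1 := (lam / c + S) / 2.
have s1l : lam / c < s1 by rewrite /s1; lra.
have s1S : s1 < S by rewrite /s1; lra.
pose CC := lam * (2 * (8 * C0 / c) + (8 * C0 / c) ^+ 2)
      + C0 * (2 * (8 * C0 / c) + (8 * C0 / c) ^+ 2).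
have CC0 : 0 <= CC.
  have E0 : 0 <= 2 * (8 * C0 / c) + (8 * C0 / c) ^+ 2.
    by rewrite addr_ge0 ?sqr_ge0 // mulr_ge0 // divr_ge0 ?mulr_ge0 // ltW.
  by rewrite addr_ge0 // mulr_ge0 // ltW.
(* Within distance [kap] of [x] the local estimate keeps the quotient at most [s1 < S], so almost
   extremal points are farther away. *)
pose kap := Num.min 1 (Num.min (c / (6 * C0)) (c * (s1 - lam / c) / (CC + 1))).
have kap0 : 0 < kap.
  rewrite !lt_min ltr01 !divr_gt0 ?mulr_gt0 ?subr_gt0 //; lra_with CC0.
have [k1 k2 k3] : [/\ kap <= 1, kap <= c / (6 * C0) & kap * (CC + 1) <= c * (s1 - lam / c)].
  split; rewrite /kap ?ge_min ?lexx ?orbT //.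
  by rewrite -ler_pdivlMr ?ge_min ?lexx ?orbT //; lra_with CC0.
have near_ y : F y <= 1 -> y != x -> s1 < 2 * ip n (y - x) / `|y - x| ^+ 2 -> kap < `|y - x|.
  move=> Fy yx h; rewrite ltNge; apply/negP => yk; move: h.
  rewrite ltr_pdivlMr ?pos // => h.
  have := hypomonotone_near Fx Fy (le_trans yk k1) (le_trans yk k2).
  rewrite -/CC ngr; set D := `|y - x| in yk h *.
  have D20 : 0 < D ^+ 2 by exact: pos.
  have D_ge0 : 0 <= D by exact: normr_ge0.
  have : CC * D <= c * s1 - lam.
    have -> : c * s1 - lam = c * (s1 - lam / c) by field; rewrite gt_eqF.
    apply: le_trans k3; rewrite mulrC; apply: ler_pM => //; (drop_order_hyps; lra).
  move=> a1 a2.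
  have a3 : (lam + CC * D) / 2 * D ^+ 2 <= (c * s1) / 2 * D ^+ 2 by rewrite ler_pM2r //; lra_with a1.
  have i0 : 0 < ip n (y - x).
    have : 0 < s1 * D ^+ 2 by rewrite mulr_gt0 // (lt_trans lc).
    lra_with h.
  have : c * ip n (y - x) <= g * ip n (y - x) by rewrite ler_pM2r.
  have : c * (s1 * D ^+ 2) < c * (2 * ip n (y - x)) by rewrite ltr_pM2l.
  lra_with a3 a2.
(* Upper bound on the distance of almost extremal points: a quotient above [lam / c] together with
   [<n, y - x> <= |y - x|]. *)
pose D := 2 * c / lam.
have D0 : 0 < D by rewrite divr_gt0 ?mulr_gt0.
pose s := Num.min (c / (2 * C0)) (rho / 2).
have s0 : 0 < s by rewrite lt_min !divr_gt0 ?mulr_gt0.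
(* [A] bounds the left side of [common_center_ineq] from below; [B * eps] will bound the square of
   its right side. *)
pose A := (c / rho - lam) * (kap / 2) ^+ 2.
have A0 : 0 < A.
  rewrite mulr_gt0 // ?exprn_gt0 ?divr_gt0 // subr_gt0 ltr_pdivlMr //.
  have : lam / c * rho < S * rho by rewrite ltr_pM2r.
  by rewrite [S * rho]mulrC rS mulrAC ltr_pdivrMr // mul1r.
pose B := (g + (g + C0 * (D + kap)) + 2 * c / rho * (D + kap)) ^+ 2 * (rho * D ^+ 2 * (8 * rho / s + 2)).
have B0 : 0 <= B.
  apply: mulr_ge0; first exact: sqr_ge0.
  apply: mulr_ge0; first by rewrite mulr_ge0 ?sqr_ge0 // ltW.
  by rewrite addr_ge0 // divr_ge0 ?mulr_ge0 // ltW.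
have key eps : 0 < eps -> eps < S - s1 -> rho * D ^+ 2 * eps <= rho ^+ 2 -> eps * D ^+ 2 <= kap / 2 ->
    A ^+ 2 <= B * eps.
  move=> e0 eS e1 e2.
  have [_ [y [Fy yx ->]] Sy] := sup_adherent e0 hQ.
  rewrite -/S in Sy.
  have yk : kap < `|y - x| by apply: near_ => //; apply: lt_trans Sy; lra_with eS.
  have P2 := pos _ yx.
  have yD : `|y - x| <= D.
    have yx0 : 0 < `|y - x| by rewrite normr_gt0 subr_eq0.
    have : lam / c < 2 * ip n (y - x) / `|y - x| ^+ 2 by apply: lt_trans Sy; lra_with eS s1l.
    rewrite ltr_pdivlMr // => h.
    have := ip_le hX n (y - x); rewrite n1 mul1r => h2.
    have : lam / c * `|y - x| * `|y - x| <= 2 * `|y - x| by rewrite -mulrA -expr2; lra_with h2 h.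
    rewrite ler_pM2r // mulrAC ler_pdivrMr // /D => h3.
    by rewrite ler_pdivlMr // mulrC.
  have near1 : `|p - y| ^+ 2 <= rho ^+ 2 + rho * D ^+ 2 * eps.
    rewrite distrC yp.
    move: Sy; rewrite ltr_pdivlMr // => Sy.
    have {}Sy : rho * ((S - eps) * `|y - x| ^+ 2) < rho * (2 * ip n (y - x)) by rewrite ltr_pM2l.
    rewrite [rho * ((S - eps) * _)]mulrA mulrBr rS in Sy.
    have : rho * eps * `|y - x| ^+ 2 <= rho * eps * D ^+ 2.
      by apply: ler_wpM2l; [rewrite mulr_ge0 // ltW | rewrite ler_sqr ?nnegrE // ltW].
    lra_with Sy.
  have [th /andP[th0 th1] Fth] : exists2 th, 0 <= th <= 1 & F (y + th *: (p - y)) = 1.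
    apply: creeping_ivt => //.
    - by rewrite scale0r addr0.
    - by rewrite scale1r subrKC ltW.
    - move=> t _ e e0'; have [eta eta0 He] := continuous_line y (p - y) t e0'.
      by exists eta => // t' _; exact: He.
  set y' := y + th *: (p - y) in Fth.
  have py' : p - y' = (1 - th) *: (p - y) by rewrite /y'; lmod.
  have npy' : `|p - y'| = (1 - th) * `|p - y| by rewrite py' normrZ ger0_norm // subr_ge0.
  have far' : rho <= `|p - y'| by rewrite distrC; apply: far; rewrite Fth.
  have py0 : 0 <= `|p - y| by exact: normr_ge0.
  have thp : 0 <= th * `|p - y| by rewrite mulr_ge0.
  have near2 : `|p - y'| ^+ 2 <= rho ^+ 2 + rho * D ^+ 2 * eps.
    apply: le_trans near1; rewrite ler_sqr ?nnegrE // npy'; lra_with thp.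
  have yy' : `|y' - y| <= eps * D ^+ 2.
    have -> : y' - y = th *: (p - y) by rewrite /y'; lmod.
    rewrite normrZ ger0_norm // -(ler_pM2l r0).
    have -> : th * `|p - y| = `|p - y| - `|p - y'| by rewrite npy'; ring.
    have : rho * (`|p - y| - rho) <= `|p - y| ^+ 2 - rho ^+ 2.
      have rp : rho <= `|p - y| by rewrite npy' in far'; lra_with far' thp.
      have : 0 <= `|p - y| * (`|p - y| - rho) by rewrite mulr_ge0 // subr_ge0.
      (drop_order_hyps; lra).
    have : rho * rho <= rho * `|p - y'| by rewrite ler_pM2l.
    lra_with near1.
  have xy'1 : kap / 2 <= `|x - y'|.
    have := ler_normD (x - y') (y' - y); rewrite addrA subrK [`|x - y|]distrC; lra_with yy' yk e2.
  have xy'2 : `|x - y'| <= D + kap.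
    have := ler_normB (x - y) (y' - y); rewrite opprB addrA subrK [`|x - y|]distrC; lra_with yy' yD e2 kap0.
  have re0 : 0 <= rho * D ^+ 2 * eps.
    by apply: mulr_ge0; [rewrite mulr_ge0 ?sqr_ge0 // ltW | exact: ltW].
  have sl1 : s <= c / (2 * C0) by rewrite ge_min lexx.
  have sl2 : s <= rho / 2 by rewrite ge_min lexx orbT.
  have al := almost_nearest_aligned Fth r0 s0 sl1 sl2 re0 e1 far near2.
  set e := p - y' - rho *: unit_gr y' in al.
  have Exy : x - y' = e - rho *: (unit_gr x - unit_gr y').
    by rewrite /e /p nE; lmod.
  have := common_center_ineq Fx Fth r0 Exy.
  have gy' : `|gr y'| <= g + C0 * (D + kap).
    have := gr_lip x y'; have := ler_normB (gr x) (gr x - gr y'); rewrite opprB addrCA subrr addr0 -/g.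
    have : C0 * `|x - y'| <= C0 * (D + kap) by rewrite ler_pM2l.
    (drop_order_hyps; lra).
  move=> fin.
  have f1 : A <= `|e| * (g + (g + C0 * (D + kap)) + 2 * c / rho * (D + kap)).
    apply: (@le_trans _ _ ((c / rho - lam) * `|x - y'| ^+ 2)).
      rewrite /A ler_pM2l; first by rewrite ler_sqr ?nnegrE // divr_ge0 // ltW.
      by move: A0; rewrite /A pmulr_lgt0 // exprn_gt0 // divr_gt0.
    apply: le_trans fin _; apply: ler_wpM2l => //.
    apply: lerD; first by rewrite -/g; lra_with gy'.
    by apply: ler_wpM2l => //; rewrite divr_ge0 ?mulr_ge0 // ltW.
  have f2 : A ^+ 2 <= (`|e| * (g + (g + C0 * (D + kap)) + 2 * c / rho * (D + kap))) ^+ 2.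
    by rewrite ler_sqr ?nnegrE ?(ltW A0) // (le_trans (ltW A0)).
  apply: le_trans f2 _; set Kg := g + _ + _.
  apply: (@le_trans _ _ (Kg ^+ 2 * `|e| ^+ 2)); first by rewrite exprMn mulrC.
  apply: (@le_trans _ _ (Kg ^+ 2 * (rho * D ^+ 2 * eps * (8 * rho / s + 2)))).
    by apply: ler_wpM2l; [exact: sqr_ge0 | exact: al].
  by rewrite /B -/Kg le_eqVlt; apply/orP; left; apply/eqP; ring.
(* The four bounds keep the quotient above [s1], allow the alignment estimate, keep [y'] within
   [kap / 2] of [y], and make [B * eps < A ^+ 2]. *)
pose eps := Num.min (Num.min ((S - s1) / 2) (rho / D ^+ 2)) (Num.min (kap / (2 * D ^+ 2)) (A ^+ 2 / (2 * (B + 1)))).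
have D2 : 0 < D ^+ 2 by rewrite exprn_gt0.
have B1 : 0 < 2 * (B + 1) by lra_with B0.
have eps0 : 0 < eps.
  have q1 : 0 < (S - s1) / 2 by lra_with s1S.
  have q2 : 0 < rho / D ^+ 2 by exact: divr_gt0.
  have q3 : 0 < kap / (2 * D ^+ 2) by rewrite divr_gt0 // mulr_gt0.
  have q4 : 0 < A ^+ 2 / (2 * (B + 1)) by rewrite divr_gt0 // exprn_gt0.
  by rewrite /eps !lt_min q1 q2 q3 q4.
have e1 : eps <= (S - s1) / 2 by rewrite /eps !ge_min lexx.
have e2 : eps * D ^+ 2 <= rho by rewrite -ler_pdivlMr // /eps !ge_min lexx !orbT.
have D2' : 0 < 2 * D ^+ 2 by rewrite mulr_gt0.
have e3 : eps * (2 * D ^+ 2) <= kap by rewrite -ler_pdivlMr // /eps !ge_min lexx !orbT.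
have e4 : eps * (2 * (B + 1)) <= A ^+ 2 by rewrite -ler_pdivlMr // /eps !ge_min lexx !orbT.
have := key eps eps0.
have h1 : eps < S - s1 by lra_with e1 eps0.
have h2 : rho * D ^+ 2 * eps <= rho ^+ 2.
  have : rho * (eps * D ^+ 2) <= rho * rho by rewrite ler_pM2l.
  (drop_order_hyps; lra).
have h3 : eps * D ^+ 2 <= kap / 2 by lra_with e3.
move=> /(_ h1 h2 h3) h4.
have : 0 <= B * eps by rewrite mulr_ge0 // ltW.
lra_with h4 e4 eps0.
Qed.

End prox_regularity.

(** * Right derivatives *)

Section right_derivative.
Variables (R : realType) (X : normedModType R).

(** One-sided because concatenated trajectories have corners at the nodes, and a right derivative
    ignores the preceding piece. *)
Definition right_derivative (f : R -> X) (t : R) (d : X) :=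
  forall e, 0 < e -> exists2 eta, 0 < eta & forall s, t <= s -> s < t + eta ->
    `|f s - f t - (s - t) *: d| <= e * (s - t).

Lemma has_derivative_right f t d : has_derivative f t d -> right_derivative f t d.
Proof.
move=> H e e0; have [eta eta0 He] := H e e0; exists eta => // s ts st.
have st0 : `|s - t| = s - t by rewrite ger0_norm // subr_ge0.
by have := He s; rewrite st0 ltrBlDl; apply.
Qed.

Lemma right_derivative_ext f f' t d r : 0 < r ->
  (forall s, t <= s -> s < t + r -> f s = f' s) ->
  right_derivative f t d -> right_derivative f' t d.
Proof.
move=> r0 E H e e0; have [eta eta0 He] := H e e0.
exists (Num.min r eta) => [|s ts]; rewrite ?lt_min ?r0 // -ltrBlDl lt_min !ltrBlDl => /andP[s1 s2].
by rewrite -!E ?ltrDl //; exact: He.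
Qed.

Lemma right_derivative_const f t d r : 0 < r ->
  (forall s, t <= s -> s < t + r -> f s = f t) -> right_derivative f t d -> d = 0.
Proof.
move=> r0 E H; apply/eqP; rewrite -normr_le0; apply/ler_addgt0Pl => e e0.
rewrite addr0; have [eta eta0 He] := H e e0.
pose h := Num.min r eta / 2.
have m0 : 0 < Num.min r eta by rewrite lt_min r0.
have h0 : 0 < h by rewrite divr_gt0.
have : h < Num.min r eta by rewrite /h; lra.
rewrite lt_min => /andP[h1 h2].
have th : t <= t + h by rewrite lerDl ltW.
have := He (t + h) th; rewrite ltrD2l => /(_ h2).
rewrite E ?ltrD2l // subrr sub0r normrN (addrC t h) addrK normrZ gtr0_norm // mulrC.
by rewrite ler_pM2r.
Qed.

End right_derivative.

(** * Catching-up steps and their concatenation *)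

Section step.
Variables (R : realType) (X : normedModType R) (ip : X -> X -> R).
Hypothesis hX : hilbert_inner ip.
Variables (T c delta CG CP C4 : R) (M : R -> R).
Variables (Gam : R -> X -> R) (Pg : R -> X -> X).
Hypothesis c_gt0 : 0 < c.
Hypothesis delta0 : 0 <= delta.
Hypothesis delta1 : delta < 1.
Hypothesis CG0 : 0 <= CG.
Hypothesis CP0 : 0 <= CP.
Hypothesis C40 : 0 <= C4.
Hypothesis M_nd : forall s t, 0 <= s -> s <= t -> t <= T -> M s <= M t.
Hypothesis M_unif : forall e, 0 < e -> exists2 d, 0 < d & forall s t, 0 <= s -> s <= t -> t <= T ->
  t - s < d -> M t - M s < e.
Hypothesis Gam_lip : forall s t xi ze, 0 <= s -> s <= t -> t <= T ->
  `|Gam t xi - Gam s ze| <= CG * (`|xi - ze| + (M t - M s)).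
Hypothesis P_lip : forall s t xi ze, 0 <= s -> s <= t -> t <= T ->
  `|Pg t xi - Pg s ze| <= CP * (`|xi - ze| + (M t - M s)).
Hypothesis P_ge : forall t xi, 0 <= t -> t <= T -> Gam t xi = 1 -> c <= `|Pg t xi|.
(** The minus sign comes from [x = u - xi]; the term [delta * c * |v|] is what the state-dependent
    parameter of the set can undo. *)
Hypothesis Gam_dec : forall t xi v, 0 <= t -> t <= T ->
  Gam t (xi + v) <= Gam t xi - ip (Pg t xi) v + delta * c * `|v| + C4 * `|v| ^+ 2.

Let sig := (1 - delta) / 2.
(** [Gam] rises by at most [CG] per unit of clock, each unit along the correction vector lowers it
    by [sig], and this vector has norm at most [c^-1]. *)
Definition step_rate := CG / (c * sig).

Definition step_error := CP * (step_rate + 1).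

Lemma sig_gt0 : 0 < sig.
Proof. by rewrite /sig divr_gt0 // subr_gt0. Qed.

Lemma Gam_lip_time s t o xi : 0 <= s -> s <= T -> 0 <= t -> t <= T -> `|M t - M s| <= o ->
  `|Gam t xi - Gam s xi| <= CG * o.
Proof.
move=> s0 sT t0 tT; have [st|/ltW ts] := leP s t.
  rewrite ger0_norm ?subr_ge0; last exact: M_nd.
  move=> h; apply: le_trans (Gam_lip xi xi s0 st tT) _.
  by rewrite subrr normr0 add0r; apply: ler_wpM2l.
rewrite distrC ger0_norm ?subr_ge0; last exact: M_nd.
move=> h; rewrite distrC; apply: le_trans (Gam_lip xi xi t0 ts sT) _.
by rewrite subrr normr0 add0r; apply: ler_wpM2l.
Qed.

Lemma P_lip_sym s t xi ze o : 0 <= s -> s <= T -> 0 <= t -> t <= T -> `|M t - M s| <= o ->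
  `|Pg t xi - Pg s ze| <= CP * (`|xi - ze| + o).
Proof.
move=> s0 sT t0 tT; have [st|/ltW ts] := leP s t.
  rewrite ger0_norm ?subr_ge0; last exact: M_nd.
  move=> h; apply: le_trans (P_lip xi ze s0 st tT) _.
  by apply: ler_wpM2l => //; rewrite lerD2l.
rewrite distrC ger0_norm ?subr_ge0; last exact: M_nd.
move=> h; rewrite distrC; apply: le_trans (P_lip ze xi t0 ts sT) _.
by rewrite [`|ze - xi|]distrC; apply: ler_wpM2l => //; rewrite lerD2l.
Qed.

Lemma catching_up_step : exists2 o0, 0 < o0 & forall o s0 s1 x0,
  0 < o -> o <= o0 -> 0 <= s0 -> s0 <= s1 -> s1 <= T -> M s1 - M s0 <= o -> Gam s0 x0 <= 1 ->
  exists ze : R -> X, [/\ ze s0 = x0,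
    forall s t, s0 <= s -> s <= t -> t <= s1 -> `|ze t - ze s| <= step_rate * (M t - M s),
    forall t, s0 <= t -> t <= s1 -> Gam t (ze t) <= 1 &
    forall t d, s0 <= t -> t < s1 -> right_derivative ze t d ->
      slope_cond c Gam Pg (step_error * o) t (ze t) d].
Proof.
have c0 := c_gt0; have sg := sig_gt0.
have d1 := delta1; have d0 := delta0.
(* Displacements up to [a0] change the gradient and the quadratic term by at most [sig / 2]. *)
pose a0 := sig / (2 * ((CP + C4) / c ^+ 2) + 1).
have cc : 0 <= (CP + C4) / c ^+ 2 by rewrite divr_ge0 ?sqr_ge0 // addr_ge0.
have a00 : 0 < a0 by rewrite divr_gt0 //; lra.
have a01 : (CP + C4) / c ^+ 2 * a0 <= sig / 2.
  have : a0 * (2 * ((CP + C4) / c ^+ 2) + 1) = sig by rewrite /a0 mulfVK // gt_eqF //; lra.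
  lra.
(* The first bound limits the change of gradient in time; the second ensures that the displacement
   [a0] compensates any rise of [Gam] during the step. *)
pose o0 := Num.min (sig / (2 * (CP / c) + 1)) (sig * a0 / (CG + 1)).
have cpc : 0 <= CP / c by rewrite divr_ge0 // ltW.
have CG1 : 0 < CG + 1 by have := CG0; lra.
have o00 : 0 < o0.
  by rewrite lt_min; apply/andP; split; [apply: divr_gt0 => //; lra | rewrite divr_gt0 // mulr_gt0].
have o01 : CP / c * o0 <= sig / 2.
  have : o0 * (2 * (CP / c) + 1) <= sig.
    by rewrite -ler_pdivlMr ?ge_min ?lexx //; lra.
  lra.
have o02 : CG * o0 <= sig * a0.
  have : o0 * (CG + 1) <= sig * a0 by rewrite -ler_pdivlMr ?ge_min ?lexx ?orbT.
  lra.
exists o0 => // o s0 s1 x0 o_gt0 oo s00 s01 s1T Mo G0.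
have MO t t' : s0 <= t -> t <= s1 -> s0 <= t' -> t' <= s1 -> `|M t - M t'| <= o.
  move=> h1 h2 h3 h4; have q1 := M_nd s00 h1 (le_trans h2 s1T).
  have q2 := M_nd (le_trans s00 h1) h2 s1T.
  have q3 := M_nd s00 h3 (le_trans h4 s1T).
  have q4 := M_nd (le_trans s00 h3) h4 s1T.
  by rewrite ler_norml; apply/andP; split; lra_with q4 q1 Mo q3 q2.
have t0' t : s0 <= t -> 0 <= t by exact: le_trans.
have tT' t : t <= s1 -> t <= T by move=> h; exact: le_trans s1T.
have rate0 : 0 <= step_rate by rewrite divr_ge0 // mulr_ge0 // ltW.
have Mmono s t : s0 <= s -> s <= t -> t <= s1 -> 0 <= M t - M s.
  by move=> *; rewrite subr_ge0; apply: M_nd; [exact: t0' | | exact: tT'].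
have [allin|] := pselect (forall t, s0 <= t -> t <= s1 -> Gam t x0 < 1).
  exists (fun=> x0); split => //.
  - by move=> s t h1 h2 h3; rewrite subrr normr0 mulr_ge0 // Mmono.
  - by move=> t h1 h2; apply: ltW; exact: allin.
  move=> t d h1 h2 rd; split => [_|G1].
    by apply: (right_derivative_const _ _ rd) => //; exact: ltr01.
  by have := allin t h1 (ltW h2); rewrite G1 ltxx.
move=> /existsNP[t1 /not_implyP[t1a /not_implyP[t1b /negP]]]; rewrite -leNgt => G1.
(* An exactly active time is sought because the gradient is bounded below only on the level 1. *)
have [tau /andP[ta1 ta2] Gtau] : exists2 tau, s0 <= tau <= t1 & Gam tau x0 = 1.
  apply: creeping_ivt => // t /andP[h1 h2] e e0.
  have ek : 0 < e / (CG + 1) by rewrite divr_gt0.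
  have [d d_gt0 Hd] := M_unif ek; exists d => // s /andP[h3 h4] st.
  have tt1 : t <= s1 by exact: le_trans t1b.
  have ss1 : s <= s1 by exact: le_trans t1b.
  apply: (@le_lt_trans _ _ (CG * (e / (CG + 1)))).
    apply: Gam_lip_time; [exact: t0' | exact: tT' | exact: t0' | exact: tT' |].
    move: st; have [st|/ltW ts] := leP t s.
      rewrite [`|s - t|]ger0_norm ?subr_ge0 // => st'; rewrite ger0_norm ?Mmono // ltW //.
      by apply: Hd => //; [exact: t0' | exact: tT'].
    rewrite [`|s - t|]distrC ger0_norm ?subr_ge0 // => st'; rewrite distrC ger0_norm ?Mmono // ltW //.
    by apply: Hd => //; [exact: t0' | exact: tT'].
  by rewrite mulrA ltr_pdivrMr // [CG * e]mulrC ltr_pM2l // ltrDl.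
have tas1 : tau <= s1 by exact: le_trans t1b.
pose p := Pg tau x0.
have cp : c <= `|p| by apply: P_ge; [exact: t0' | exact: tT' |].
have p0 : 0 < `|p| by exact: lt_le_trans cp.
have pn : `|p| != 0 by rewrite gt_eqF.
(* Scaled so that [<p, N> = 1]: the displacement parameter measures the first order decrease of
   [Gam]. *)
pose N := (`|p| ^+ 2)^-1 *: p.
have Nn : `|N| = `|p|^-1.
  by rewrite /N normrZ normfV ger0_norm ?sqr_ge0 // expr2 invfM mulfVK.
have N1 : `|N| <= c^-1 by rewrite Nn lef_pV2 ?posrE.
have N0 : 0 <= `|N| by exact: normr_ge0.
have pN : ip p N = 1 by rewrite /N (ipZr hX) (ipxx hX) mulVf // expf_neq0.
have NE : N = (`|p| ^+ 2)^-1 *: p by [].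
clearbody N.
pose psi t a := Gam t (x0 + a *: N).
have dec t a b : s0 <= t -> t <= s1 -> 0 <= a -> 0 <= b -> a + b <= a0 ->
    psi t (a + b) <= psi t a - sig * b.
  move=> h1 h2 a_ge0 b_ge0 ab; rewrite /psi.
  have -> : x0 + (a + b) *: N = x0 + a *: N + b *: N by lmod.
  have tt0 := t0' _ h1; have ttT := tT' _ h2.
  apply: le_trans (Gam_dec (x0 + a *: N) (b *: N) tt0 ttT) _.
  set P := Pg t (x0 + a *: N).
  have Pp : `|P - p| <= CP * (a0 / c + o0).
    have := @P_lip_sym tau t (x0 + a *: N) x0 o (t0' _ ta1) (tT' _ tas1) tt0 ttT (MO _ _ h1 h2 ta1 tas1).
    have -> : x0 + a *: N - x0 = a *: N by lmod.
    rewrite normrZ (ger0_norm a_ge0) => h; apply: le_trans h _.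
    apply: ler_wpM2l => //; apply: lerD => //; apply: ler_pM => //; lra_with ab b_ge0.
  have ipP : 1 - CP * (a0 / c + o0) / c <= ip P N.
    have -> : ip P N = 1 + ip (P - p) N by rewrite (ipBl hX) pN; ring.
    rewrite lerD2l; have := cauchy_schwarz hX (P - p) N; rewrite ler_norml => /andP[+ _].
    by apply: le_trans; rewrite lerN2; apply: ler_pM.
  have : b * (1 - CP * (a0 / c + o0) / c) <= b * ip P N by apply: ler_wpM2l.
  rewrite (ipZr hX) normrZ (ger0_norm b_ge0).
  have : delta * c * (b * `|N|) <= delta * b.
    have -> : delta * b = delta * c * (b * c^-1) by field; rewrite gt_eqF.
    by apply: ler_wpM2l; [rewrite mulr_ge0 // ltW | apply: ler_wpM2l].
  have : C4 * (b * `|N|) ^+ 2 <= b * (C4 * a0 / c ^+ 2).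
    have -> : b * (C4 * a0 / c ^+ 2) = C4 * (b * a0 * c^-1 ^+ 2) by rewrite exprVn; ring.
    apply: ler_wpM2l => //; rewrite exprMn; apply: ler_pM => //; try exact: sqr_ge0.
      by rewrite expr2; apply: ler_wpM2l => //; lra_with ab a_ge0.
    by rewrite ler_sqr ?nnegrE ?invr_ge0 // ltW.
  have : b * (CP * (a0 / c + o0) / c + C4 * a0 / c ^+ 2) <= b * sig.
    apply: ler_wpM2l => //.
    have -> : CP * (a0 / c + o0) / c + C4 * a0 / c ^+ 2 = (CP + C4) / c ^+ 2 * a0 + CP / c * o0.
      by field; rewrite gt_eqF.
    lra_with o01 a01.
  have : sig * 2 = 1 - delta by rewrite /sig; field.
  move=> e1 e2 e3 e4 e5.
  have {}e1 : b * (sig * 2) = b * (1 - delta) by rewrite e1.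
  move: e1 e2 e3 e4 e5.
  move: (CP * (a0 / c + o0) / c) (C4 * a0 / c ^+ 2) (C4 * (b * `|N|) ^+ 2) => U V W.
  move: (delta * c * (b * `|N|)) (ip P N) (Gam t (x0 + a *: N)) => U' V' W' e1 e2 e3 e4 e5.
  have e6 : b * U + b * V <= b * sig by rewrite -mulrDr.
  have e7 : b - b * U <= b * V' by move: e5; rewrite mulrBr mulr1.
  have e8 : b * sig * 2 = b - b * delta by rewrite -mulrA e1 mulrBr mulr1.
  rewrite [sig * b]mulrC; rewrite [delta * b]mulrC in e4.
  move: (b * U) (b * V) (b * sig) (b * V') (b * delta) e3 e4 e6 e7 e8 => q1 q2 q3 q4 q5; (drop_order_hyps; lra).
(* Feasibility is required at all earlier times of the step as well, so that the least displacement
   is nondecreasing in [t]. *)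
pose A t := [set a | [/\ 0 <= a, a <= a0 & forall s, s0 <= s -> s <= t -> psi s a <= 1]].
have ps0 s a : 0 <= a -> a <= a0 -> s0 <= s -> s <= s1 -> forall b, a <= b -> b <= a0 -> psi s b <= psi s a.
  move=> h1 h2 h3 h4 b h5 h6; have -> : b = a + (b - a) by ring.
  apply: le_trans (dec s a (b - a) h3 h4 h1 _ _) _; [lra_with h5|lra_with h6|].
  have : 0 <= sig * (b - a) by rewrite mulr_ge0 ?subr_ge0 // ltW.
  (drop_order_hyps; lra).
have Aa0 t : t <= s1 -> A t a0.
  move=> ts; split; [exact: ltW | by [] |] => s h1 h2.
  have h3 := le_trans h2 ts.
  have := dec s 0 a0 h1 h3 (lexx _) (ltW a00); rewrite add0r => /(_ (lexx _)).
  rewrite {2}/psi scale0r addr0.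
  have := Gam_lip_time x0 s00 (tT' _ s01) (t0' _ h1) (tT' _ h3) (MO _ _ h1 h3 (lexx _) s01).
  rewrite ler_norml => /andP[_].
  have : CG * o <= CG * o0 by apply: ler_wpM2l.
  lra_with G0 o02.
have hA t : t <= s1 -> has_inf (A t).
  by move=> ts; split; [exists a0; exact: Aa0 | exists 0 => a []].
pose al t := inf (A t).
have al0 t : t <= s1 -> 0 <= al t by move=> ts; apply: lb_le_inf; [case: (hA t ts) | move=> a []].
have alle t a : t <= s1 -> A t a -> al t <= a by move=> ts h; apply: ge_inf => //; case: (hA t ts).
have ala0 t : t <= s1 -> al t <= a0 by move=> ts; apply: alle => //; exact: Aa0.
have Aal t : t <= s1 -> A t (al t).
  move=> ts; split; [exact: al0 | exact: ala0 |] => s h1 h2.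
  apply/ler_addgt0Pr => e e0.
  have ek : 0 < e / (CG * `|N| + 1) by rewrite divr_gt0 // ltr_wpDl // mulr_ge0.
  have [a [a_ge0 aa0 Ha] alt] := inf_adherent ek (hA t ts).
  have := Ha s h1 h2.
  have h3 := le_trans h2 ts.
  have := Gam_lip (x0 + al t *: N) (x0 + a *: N) (t0' _ h1) (lexx s) (tT' _ h3).
  have -> : x0 + al t *: N - (x0 + a *: N) = (al t - a) *: N by lmod.
  rewrite subrr addr0 ler_norml normrZ distrC ger0_norm; last by rewrite subr_ge0 alle.
  move=> /andP[_].
  have : CG * ((a - al t) * `|N|) <= e.
    have : (a - al t) * (CG * `|N| + 1) <= e.
      rewrite -ler_pdivlMr; last by rewrite ltr_wpDl // mulr_ge0.
      by apply: ltW; rewrite ltrBlDl.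
    have : al t <= a by exact: alle.
    (drop_order_hyps; lra).
  rewrite -/(psi s (al t)) -/(psi s a); (drop_order_hyps; lra).
have alS : al s0 = 0.
  apply/eqP; rewrite eq_le al0 // andbT; apply: alle => //; split => //; first exact: ltW.
  move=> s h1 h2; have -> : s = s0 by apply/eqP; rewrite eq_le h2.
  by rewrite /psi scale0r addr0.
have almono s t : s0 <= s -> s <= t -> t <= s1 -> al s <= al t.
  move=> h1 h2 h3; apply: alle; first exact: le_trans h3.
  have [q1 q2 q3] := Aal t h3; split => // s' h4 h5; apply: q3 => //; exact: le_trans h2.
have alL s t : s0 <= s -> s <= t -> t <= s1 -> al t <= al s + CG / sig * (M t - M s).
  move=> h1 h2 h3; have ss1 := le_trans h2 h3; have [q1 q2 q3] := Aal s ss1.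
  have dM := Mmono _ _ h1 h2 h3.
  have k0 : 0 <= CG / sig * (M t - M s) by rewrite mulr_ge0 // divr_ge0 // ltW.
  set b := _ + _; have [bl|bl] := leP b a0; last by apply: le_trans (ala0 t h3) (ltW bl).
  apply: alle => //; split => //; first by rewrite addr_ge0.
  move=> s' h4 h5; have h6 := le_trans h5 h3; have [s's|/ltW ss'] := leP s' s.
    by apply: le_trans (ps0 s' (al s) q1 q2 h4 h6 b _ bl) (q3 s' h4 s's); rewrite lerDl.
  apply: le_trans (dec s' (al s) _ h4 h6 q1 k0 bl) _.
  have := q3 s h1 (lexx _).
  have := Gam_lip (x0 + al s *: N) (x0 + al s *: N) (t0' _ h1) ss' (tT' _ h6).
  rewrite subrr normr0 add0r ler_norml => /andP[_]; rewrite -/(psi s' (al s)) -/(psi s (al s)).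
  have -> : sig * (CG / sig * (M t - M s)) = CG * (M t - M s) by field; rewrite gt_eqF.
  have : CG * (M s' - M s) <= CG * (M t - M s).
    by apply: ler_wpM2l => //; rewrite lerD2r; have := Mmono _ _ h4 h5 h3; (drop_order_hyps; lra).
  (drop_order_hyps; lra).
pose ze t := x0 + al t *: N.
have zeB s t : ze t - ze s = (al t - al s) *: N by rewrite /ze; lmod.
have zeL s t : s0 <= s -> s <= t -> t <= s1 -> `|ze t - ze s| <= step_rate * (M t - M s).
  move=> h1 h2 h3; rewrite zeB normrZ ger0_norm; last by rewrite subr_ge0; exact: almono.
  have -> : step_rate * (M t - M s) = CG / sig * (M t - M s) * c^-1.
    by rewrite /step_rate; field; rewrite !gt_eqF.
  apply: ler_pM => //; first by rewrite subr_ge0; exact: almono.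
  by have := alL s t h1 h2 h3; (drop_order_hyps; lra).
exists ze; split => //.
- by rewrite /ze alS scale0r addr0.
- by move=> t h1 h2; have [_ _ q] := Aal t h2; exact: q.
move=> t d h1 h2 rd; have ts1 := ltW h2; split => [Gl|Ge].
  (* While there is slack, the displacement [al t] stays admissible for a short time, so the least
     displacement does not change. *)
  have gap : 0 < (1 - psi t (al t)) / (CG + 1) by rewrite divr_gt0 // subr_gt0.
  have [r r0 Hr] := M_unif gap.
  have m0 : 0 < Num.min r (s1 - t) by rewrite lt_min r0 subr_gt0.
  apply: (right_derivative_const m0 _ rd) => s ts; rewrite -ltrBlDl lt_min => /andP[st1 st2].
  have ss1 : s <= s1 by lra_with st2.
  rewrite /ze; congr (_ + _ *: _); apply/eqP; rewrite eq_le (almono t s) // andbT.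
  have [q1 q2 q3] := Aal t ts1.
  apply: alle => //; split => // s' h3 h4; have [s't|/ltW ts'] := leP s' t; first exact: q3.
  have h5 := le_trans h4 ss1.
  have := Gam_lip (x0 + al t *: N) (x0 + al t *: N) (t0' _ h1) ts' (tT' _ h5).
  rewrite subrr normr0 add0r ler_norml => /andP[_]; rewrite -/(psi s' (al t)) -/(psi t (al t)).
  have Mb : M s' - M t < (1 - psi t (al t)) / (CG + 1).
    by apply: Hr => //; [exact: t0' | exact: tT' | lra_with h4 st1].
  have Mg := Mmono _ _ h1 ts' h5.
  have : (CG + 1) * (M s' - M t) <= 1 - psi t (al t) by rewrite mulrC -ler_pdivlMr // ltW.
  lra_with Mg.
pose a := ip d p.
(* The curve moves only along [N] with a nondecreasing coefficient; within tolerance [e] its right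
   derivative is a nonnegative multiple of [N]. *)
have q1 e : 0 < e -> `|d - a *: N| <= 2 * e /\ - (e * `|p|) <= a.
  move=> e0; have [r r0 Hr] := rd e e0.
  pose h := Num.min r (s1 - t) / 2.
  have m0 : 0 < Num.min r (s1 - t) by rewrite lt_min r0 subr_gt0.
  have h0 : 0 < h by rewrite divr_gt0.
  have : h < Num.min r (s1 - t) by rewrite /h; lra_with m0.
  rewrite lt_min => /andP[hr hs].
  have th : t <= t + h by rewrite lerDl ltW.
  have ths : t + h <= s1 by lra_with hs.
  have := Hr (t + h) th; rewrite ltrD2l => /(_ hr); rewrite zeB.
  have -> : t + h - t = h by ring.
  set k := al (t + h) - al t; have k0 : 0 <= k by rewrite subr_ge0; exact: almono.
  move=> b; set v := k *: N - h *: d in b.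
  have ipv : ip v p = k - h * a.
    by rewrite /v (ipBl hX) !(ipZl hX) (ipC hX N) pN /a; ring.
  have ipvb : `|ip v p| <= e * h * `|p|.
    by apply: le_trans (cauchy_schwarz hX _ _) _; apply: ler_wpM2r.
  split.
    rewrite -(ler_pM2l h0) -{1}(gtr0_norm h0) -normrZ.
    have -> : h *: (d - a *: N) = ip v p *: N - v by rewrite ipv /v; lmod.
    apply: le_trans (ler_normB _ _) _; rewrite normrZ Nn.
    have : `|ip v p| * `|p|^-1 <= e * h * `|p| * `|p|^-1 by apply: ler_wpM2r => //; rewrite invr_ge0.
    rewrite mulfK //; lra_with b.
  rewrite -(ler_pM2l h0); move: ipvb; rewrite ipv ler_norml => /andP[_]; lra_with k0.
have dE : d = a *: N.
  apply/eqP; rewrite -subr_eq0 -normr_le0; apply/ler_addgt0Pl => e e0; rewrite addr0.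
  by have [|h _] := q1 (e / 2); [lra_with e0 | lra_with h].
have a_ge0 : 0 <= a.
  rewrite -oppr_le0; apply/ler_addgt0Pl => e e0; rewrite addr0.
  have [|_] := q1 (e / `|p|); first exact: divr_gt0.
  by rewrite mulfVK //; (drop_order_hyps; lra).
exists (a / `|p| ^+ 2), p; split => //.
- by rewrite divr_ge0 ?sqr_ge0.
- rewrite distrC.
  have := @P_lip_sym tau t (ze t) x0 o (t0' _ ta1) (tT' _ tas1) (t0' _ h1) (tT' _ ts1) (MO _ _ h1 ts1 ta1 tas1).
  move=> h; apply: le_trans h _; rewrite /step_error -mulrA; apply: ler_wpM2l => //.
  rewrite mulrDl mul1r lerD2r.
  have := zeL s0 t (lexx _) h1 ts1; rewrite /ze alS scale0r addr0 => h; apply: le_trans h _.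
  apply: ler_wpM2l => //; have := MO t s0 h1 ts1 (lexx _) s01; rewrite ler_norml => /andP[]; (drop_order_hyps; lra).
- by rewrite {1}dE NE scalerA.
Qed.

(** Uniform continuity of the clock makes [M] grow by at most [o] on each of finitely many equal
    intervals, and each step restarts from the feasible end point of the previous one. *)
Lemma exists_approx x0 : 0 < T -> Gam 0 x0 <= 1 -> forall eps, 0 < eps -> exists ze : R -> X,
  [/\ ze 0 = x0,
    forall s t, 0 <= s -> s <= t -> t <= T -> `|ze t - ze s| <= step_rate * (M t - M s),
    forall t, 0 <= t -> t <= T -> Gam t (ze t) <= 1 &
    forall t d, 0 <= t -> t < T -> right_derivative ze t d -> slope_cond c Gam Pg eps t (ze t) d].
Proof.
move=> T0 G0 eps eps0; have [q0 q00 Hstep] := catching_up_step.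
have rate0 : 0 <= step_rate by rewrite divr_ge0 // mulr_ge0 ?(ltW sig_gt0) // ltW.
have err0 : 0 <= step_error by rewrite mulr_ge0 // addr_ge0.
pose o := Num.min q0 (eps / (step_error + 1)).
have e1 : 0 < step_error + 1 by lra.
have o_gt0 : 0 < o by rewrite lt_min q00 divr_gt0.
have oo0 : o <= q0 by rewrite ge_min lexx.
have oeps : step_error * o <= eps.
  have : o * (step_error + 1) <= eps by rewrite -ler_pdivlMr // ge_min lexx orbT.
  lra.
have [d d0 Hd] := M_unif o_gt0.
pose n := (Num.truncn (T / d)).+1.
have n0 : 0 < n%:R :> R by rewrite ltr0n.
have nd : T / n%:R < d.
  by rewrite ltr_pdivrMr // mulrC -ltr_pdivrMr //; exact: truncnS_gt.
pose tt k := k%:R * (T / n%:R).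
have tt0 : tt 0%N = 0 by rewrite /tt mul0r.
have ttn : tt n = T by rewrite /tt mulrCA divff ?mulr1 // gt_eqF.
have ttS k : tt k.+1 - tt k = T / n%:R by rewrite /tt -mulrBl -natrB // subSnn mul1r.
have len0 : 0 < T / n%:R by rewrite divr_gt0.
have tt_ge0 k : 0 <= tt k by rewrite mulr_ge0 // ltW.
have slope_weaken t x v : slope_cond c Gam Pg (step_error * o) t x v -> slope_cond c Gam Pg eps t x v.
  move=> [h1 h2]; split => // /h2[a [p [q1 q2 q3 q4]]]; exists a, p; split => //; exact: le_trans oeps.
suff H k : (k <= n)%N -> exists ze : R -> X,
  [/\ ze 0 = x0,
    forall s t, 0 <= s -> s <= t -> t <= tt k -> `|ze t - ze s| <= step_rate * (M t - M s),
    forall t, 0 <= t -> t <= tt k -> Gam t (ze t) <= 1 &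
    forall t d, 0 <= t -> t < tt k -> right_derivative ze t d -> slope_cond c Gam Pg eps t (ze t) d].
  by have := H n (leqnn n); rewrite ttn.
elim: k => [|k IH] kn.
  exists (fun=> x0); split => //.
  - move=> s t s0 st t0; rewrite subrr normr0 mulr_ge0 // subr_ge0; apply: M_nd => //.
    by rewrite tt0 in t0; lra.
  - by move=> t t0; rewrite tt0 => t0'; have -> : t = 0 by lra.
  - by move=> t v t0; rewrite tt0; lra.
have [ze [z1 z2 z3 z4]] := IH (ltnW kn).
have tkS : tt k <= tt k.+1 by have := ttS k; lra_with len0.
have tkT : tt k.+1 <= T by rewrite -ttn /tt ler_pM2r // ler_nat.
have Mk : M (tt k.+1) - M (tt k) <= o by apply/ltW/Hd => //; rewrite ttS.
have [st [y1 y2 y3 y4]] := Hstep o _ _ _ o_gt0 oo0 (tt_ge0 k) tkS tkT Mk (z3 _ (tt_ge0 k) (lexx _)).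
(* At the node both pieces agree, and the right derivative there belongs to the new piece. *)
pose zz t := if t <= tt k then ze t else st t.
have zzl t : t <= tt k -> zz t = ze t by rewrite /zz => ->.
have zzr t : tt k <= t -> zz t = st t.
  rewrite /zz; have [h1 h2|//] := leP t (tt k).
  by have -> : t = tt k by apply/eqP; rewrite eq_le h1.
exists zz; split.
- by rewrite zzl.
- move=> s t s0 st' tk; have [tl|/ltW tr] := leP t (tt k).
    by rewrite !zzl //; [exact: z2 | exact: le_trans tl].
  have [sl|/ltW sr] := leP s (tt k); last by rewrite !zzr //; exact: y2.
  have -> : zz t - zz s = (st t - st (tt k)) + (ze (tt k) - ze s).
    by rewrite zzr // zzl // y1; lmod.
  apply: le_trans (ler_normD _ _) _.
  have := y2 _ _ (lexx _) tr tk; have := z2 _ _ s0 sl (lexx _); (drop_order_hyps; lra).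
- move=> t t0 tk; have [tl|/ltW tr] := leP t (tt k); first by rewrite zzl //; exact: z3.
  by rewrite zzr //; exact: y3.
- move=> t v t0 tk rd; have [tr|tl] := leP (tt k) t.
    rewrite zzr //; apply: slope_weaken; apply: y4 => //.
    by apply: (right_derivative_ext ltr01 _ rd) => s ts _; apply: zzr; exact: le_trans ts.
  rewrite zzl ?(ltW tl) //; apply: z4 => //.
  have r0 : 0 < tt k - t by rewrite subr_gt0.
  apply: (right_derivative_ext r0 _ rd) => s ts; rewrite -ltrBlDl => sk; apply: zzl; lra_with sk.
Qed.

End step.

Lemma has_derivative_ge0 (R : realType) (f : R -> R) t d r : 0 < r ->
  (forall s, t <= s -> s < t + r -> f t <= f s) -> has_derivative f t d -> 0 <= d.
Proof.
move=> r0 H /has_derivative_right D; rewrite -oppr_le0; apply/ler_addgt0Pl => e e0; rewrite addr0.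
have [eta eta0 He] := D e e0.
have m0 : 0 < Num.min r eta by rewrite lt_min r0.
pose h := Num.min r eta / 2.
have h0 : 0 < h by rewrite divr_gt0.
have : h < Num.min r eta by rewrite /h; lra.
rewrite lt_min => /andP[h1 h2].
have th : t <= t + h by rewrite lerDl ltW.
have := He (t + h) th; rewrite ltrD2l => /(_ h2).
have := H (t + h) th; rewrite ltrD2l => /(_ h1).
have -> : t + h - t = h by ring.
rewrite /GRing.scale /= ler_norml => a1 /andP[_ a2].
by rewrite -(ler_pM2l h0); lra.
Qed.

Lemma ae_increment_le (R : realType) (V : normedModType R) (f : R -> V) (M phi : R -> R) (k a b : R) :
  a <= b -> 0 <= k -> null_variation a b f ->
  (forall x y, a <= x -> x <= y -> y <= b -> M x <= M y) ->
  {ae @lebesgue_measure R, forall t, a < t < b -> has_derivative M t (phi t)} ->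
  {ae @lebesgue_measure R, forall t, a < t < b -> exists2 v, has_derivative f t v & `|v| <= k * phi t} ->
  `|f b - f a| <= k * (M b - M a).
Proof.
move=> ab k0 Nf M_nd M_der D; rewrite mulrBr.
apply: (@ae_mean_value_ineq _ _ a b f (fun t => k * M t)) => //.
  by move=> s t xs st ty; apply: ler_wpM2l => //; exact: M_nd.
apply: (ae_imply (ae_and D M_der)) => t [Dt Mt] tab e e0.
have [v Dv vk] := Dt tab.
have [e' e2 ee] : exists2 e', 0 < e' & e = e' + k * e'.
  have k1 : 0 < 1 + k by rewrite ltr_pwDl.
  have kn : 1 + k != 0 by rewrite gt_eqF.
  by exists (e / (1 + k)); [exact: divr_gt0 | field].
have [r1 r10 H1] := has_derivative_norm_straddle Dv vk e2.
have [r2 r20 H2] := has_derivative_straddle (Mt tab) e2.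
exists (Num.min r1 r2) => [|s s' xs st ts s'y]; first by rewrite lt_min r10.
move=> w1 w2; have [h1 h2 h3 h4] := window_min w1 w2.
have a1 := H1 s s' st ts h1 h2; have := H2 s s' st ts h3 h4.
rewrite /GRing.scale /= ler_norml => /andP[a2 _].
have a3 : k * (- (e' * (s' - s))) <= k * (M s' - M s - (s' - s) * phi t) by apply: ler_wpM2l.
apply: le_trans a1 _; rewrite -subr_ge0.
have -> : k * M s' - k * M s + e * (s' - s) - (k * phi t + e') * (s' - s)
  = k * (M s' - M s - (s' - s) * phi t) - k * (- (e' * (s' - s))).
  by rewrite ee; ring.
by rewrite subr_ge0.
Qed.

(** * Passage to the limit in the slope condition *)

Section limit.
Variables (R : realType) (X : normedModType R) (ip : X -> X -> R).
Hypothesis hX : hilbert_inner ip.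
Variables (T c CG CP kap : R) (phi M : R -> R).
Variables (Gam : R -> X -> R) (Pg : R -> X -> X).
Hypothesis c_gt0 : 0 < c.
Hypothesis CG0 : 0 <= CG.
Hypothesis CP0 : 0 <= CP.
Hypothesis kap0 : 0 <= kap.
Hypothesis M_nd : forall s t, 0 <= s -> s <= t -> t <= T -> M s <= M t.
Hypothesis M_null : null_variation 0 T M.
Hypothesis M_der : {ae @lebesgue_measure R, forall t, 0 < t < T -> has_derivative M t (phi t)}.
Hypothesis Gam_lip : forall s t xi ze, 0 <= s -> s <= t -> t <= T ->
  `|Gam t xi - Gam s ze| <= CG * (`|xi - ze| + (M t - M s)).
Hypothesis P_lip : forall s t xi ze, 0 <= s -> s <= t -> t <= T ->
  `|Pg t xi - Pg s ze| <= CP * (`|xi - ze| + (M t - M s)).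
Hypothesis P_ge : forall t xi, 0 <= t -> t <= T -> Gam t xi = 1 -> c <= `|Pg t xi|.

Lemma dominated_null_variation (V : normedModType R) (f : R -> V) (K x y : R) : 0 <= K ->
  0 <= x -> x <= y -> y <= T ->
  (forall s t, 0 <= s -> s <= t -> t <= T -> `|f t - f s| <= K * (M t - M s)) ->
  null_variation x y f.
Proof.
move=> K0 x0 xy yT H; apply: (@null_variation_le _ _ _ _ _ M _ (K + 1)); first by rewrite ltr_wpDl.
  move=> s t xs st ty; have s0 := le_trans x0 xs; have tT := le_trans ty yT.
  have dM : 0 <= M t - M s by rewrite subr_ge0; exact: M_nd.
  rewrite [`|M t - M s|]ger0_norm //; apply: le_trans (H s t s0 st tT) _.
  by rewrite mulrDl mul1r lerDl.
exact: (null_variation_sub x0 xy yT).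
Qed.

Lemma dominated_increment (V : normedModType R) (f : R -> V) (K k x y : R) : 0 <= K -> 0 <= k ->
  0 <= x -> x <= y -> y <= T ->
  (forall s t, 0 <= s -> s <= t -> t <= T -> `|f t - f s| <= K * (M t - M s)) ->
  {ae @lebesgue_measure R, forall t, x < t < y -> exists2 v, has_derivative f t v & `|v| <= k * phi t} ->
  `|f y - f x| <= k * (M y - M x).
Proof.
move=> K0 k0 x0 xy yT H D; apply: ae_increment_le D => //.
- exact: (dominated_null_variation K0).
- by move=> s t xs st ty; apply: M_nd => //; [exact: le_trans xs | exact: le_trans yT].
apply: (ae_imply M_der) => t Mt /andP[h1 h2]; apply: Mt.
by rewrite (le_lt_trans x0 h1) (lt_le_trans h2 yT).
Qed.

Lemma dominated_monotone (f : R -> R) (K x y : R) : 0 <= K ->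
  0 <= x -> x <= y -> y <= T ->
  (forall s t, 0 <= s -> s <= t -> t <= T -> `|f t - f s| <= K * (M t - M s)) ->
  {ae @lebesgue_measure R, forall t, x < t < y -> exists2 v, has_derivative f t v & 0 <= v} ->
  f x <= f y.
Proof.
move=> K0 x0 xy yT H D.
suff : - f y - - f x <= 0 - 0 by lra.
apply: (@ae_upper_derivative_le _ x y (fun t => - f t) (fun=> 0)) => //.
  apply: (dominated_null_variation K0) => // s t s0 st tT.
  by rewrite -opprD normrN; exact: H.
apply: (ae_imply D) => t Dt txy e e0; have [v Dv v0] := Dt txy.
have [r r0 Hr] := has_derivative_straddle Dv e0; exists r => // s s' xs st ts s'y h1 h2.
have := Hr s s' st ts h1 h2; rewrite /GRing.scale /= ler_norml => /andP[a1 _].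
have : 0 <= (s' - s) * v by rewrite mulr_ge0 // subr_ge0 (le_trans st).
rewrite subrr add0r; lra.
Qed.

(** Velocities need not converge, so the slope condition passes to the limit through increments over
    short intervals to the right of [t]. At an inactive point the approximations are constant there.
    At an active point their component along [P] is nondecreasing and their component orthogonal to
    [P] moves by a small multiple of the clock; both facts survive uniform convergence and are then
    differentiated. *)
Lemma approx_sol_limit (xs : nat -> R -> X) (eps : nat -> R) (xi : R -> X) :
  (forall n, approx_sol T c kap M Gam Pg (eps n) (xs n)) ->
  (forall e, 0 < e -> exists n0, forall n, (n0 <= n)%N -> eps n <= e /\
     forall t, 0 <= t -> t <= T -> `|xs n t - xi t| <= e) ->
  {ae @lebesgue_measure R, forall t, 0 < t < T -> exists d, has_derivative xi t d} ->
  approx_sol T c kap M Gam Pg 0 xi.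
Proof.
move=> As Lim Der; have c0 := c_gt0.
have L : forall s t, 0 <= s -> s <= t -> t <= T -> `|xi t - xi s| <= kap * (M t - M s).
  move=> s t s0 st tT; apply/ler_addgt0Pr => e e0.
  have e2 : 0 < e / 2 by rewrite divr_gt0.
  have [n Hn] := Lim _ e2; have [_ Hn'] := Hn n (leqnn n); have [L _ _] := As n.
  have t0 := le_trans s0 st; have sT := le_trans st tT.
  have -> : xi t - xi s = (xs n t - xs n s) - (xs n t - xi t) + (xs n s - xi s) by lmod.
  apply: le_trans (ler_normD _ _) _.
  have := ler_normB (xs n t - xs n s) (xs n t - xi t).
  have := L s t s0 st tT; have := Hn' t t0 tT; have := Hn' s s0 sT; lra.
have GL t : 0 <= t -> t <= T -> Gam t (xi t) <= 1.
  move=> t0 tT; apply/ler_addgt0Pr => e e0.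
  have e2 : 0 < e / (CG + 1) by rewrite divr_gt0 // ltr_wpDl.
  have [n Hn] := Lim _ e2; have [_ Hn'] := Hn n (leqnn n); have [_ G1 _] := As n.
  have := Gam_lip (xi t) (xs n t) t0 (lexx t) tT; rewrite subrr addr0 ler_norml => /andP[_].
  have : CG * `|xi t - xs n t| <= e.
    rewrite distrC; apply: (@le_trans _ _ (CG * (e / (CG + 1)))).
      by apply: ler_wpM2l => //; exact: Hn'.
    rewrite mulrA ler_pdivrMr ?ltr_wpDl // [CG * e]mulrC; apply: ler_wpM2l; first exact: ltW.
    by rewrite lerDl.
  have := G1 t t0 tT; lra.
split => //; apply: (ae_imply (ae_and Der M_der)) => t [Dt Mt] tT.
have [d Dd] := Dt tT; have {}Mt := Mt tT; exists d => //.
have /andP[t0 tT'] := tT; have tt0 := ltW t0; have ttT := ltW tT'.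
have rd := has_derivative_right Dd.
have Mcont e : 0 < e -> exists2 r, 0 < r & forall s, t <= s -> s < t + r -> s <= T -> M s - M t <= e.
  move=> e0; have [r r0 Hr] := has_derivative_continuous Mt e0; exists r => // s ts sr sT.
  have := Hr s; rewrite ger0_norm ?subr_ge0 // ltrBlDl => /(_ sr).
  by move=> h; apply: ltW; apply: le_lt_trans h; exact: ler_norm.
split => [Gl|G1].
(* Chosen so that distance to the limit, drift of the limit and growth of the clock together cannot
   raise [Gam] to 1. *)
- pose gap := (1 - Gam t (xi t)) / (CG * (kap + 2) + 1).
  have D0 : 0 < CG * (kap + 2) + 1 by rewrite ltr_wpDl // mulr_ge0 // addr_ge0.
  have gap0 : 0 < gap by rewrite divr_gt0 // subr_gt0.
  have [r r0 Hr] := Mcont _ gap0; have [n0 Hn] := Lim _ gap0.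
  have m0 : 0 < Num.min r (T - t) by rewrite lt_min r0 subr_gt0.
  apply: (right_derivative_const m0 _ rd) => s ts; rewrite -ltrBlDl lt_min !ltrBlDl => /andP[s1 s2].
  have sT : s <= T by apply: ltW; rewrite addrC subrK in s2.
  have cst n : (n0 <= n)%N -> xs n s = xs n t.
    move=> nn; have [Ln Gn Sn] := As n; have [_ Hn'] := Hn n nn.
    apply/eqP; rewrite -subr_eq0 -normr_le0.
    rewrite (_ : 0 = 0 * (M s - M t)); last by rewrite mul0r.
    apply: (@dominated_increment _ (xs n) kap) => //.
    apply: (ae_imply Sn) => z Dz /andP[tz zs].
    have zT : 0 < z < T by rewrite (lt_trans t0 tz) (lt_le_trans zs sT).
    have [dz Dz' [Sz _]] := Dz zT; exists dz => //.
    have z0 := ltW (lt_trans t0 tz); have zT' := le_trans (ltW zs) sT.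
    rewrite Sz ?normr0 ?mul0r //.
    have Mz : M z - M t <= gap by apply: Hr => //; [exact: ltW | exact: lt_trans s1].
    have := Gam_lip (xs n z) (xi t) tt0 (ltW tz) zT'; rewrite ler_norml => /andP[_ h1].
    have h2 : `|xs n z - xi t| <= gap + kap * gap.
      have -> : xs n z - xi t = (xs n z - xi z) + (xi z - xi t) by lmod.
      apply: le_trans (ler_normD _ _) _; apply: lerD; first exact: Hn'.
      apply: le_trans (L t z tt0 (ltW tz) zT') _; exact: ler_wpM2l.
    have h3 : CG * (`|xs n z - xi t| + (M z - M t)) <= CG * ((kap + 2) * gap).
      by apply: ler_wpM2l => //; lra_with h2 Mz.
    have h4 : (CG * (kap + 2) + 1) * gap = 1 - Gam t (xi t) by rewrite mulrC mulfVK // gt_eqF.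
    lra_with h3 h1 gap0.
  apply/eqP; rewrite -subr_eq0 -normr_le0; apply/ler_addgt0Pl => e e0; rewrite addr0.
  have e2 : 0 < e / 2 by rewrite divr_gt0.
  have [n1 Hn1] := Lim _ e2; have [_ q] := Hn1 (maxn n0 n1) (leq_maxr _ _).
  have := cst _ (leq_maxl n0 n1) => E.
  have -> : xi s - xi t = (xs (maxn n0 n1) t - xi t) - (xs (maxn n0 n1) s - xi s) by rewrite E; lmod.
  apply: le_trans (ler_normB _ _) _.
  have := q t tt0 ttT; have := q s (le_trans tt0 ts) sT; (drop_order_hyps; lra).
pose P := Pg t (xi t).
have cP : c <= `|P| by exact: P_ge.
have P0 : 0 < `|P| by exact: lt_le_trans cP.
have Pn : `|P| != 0 by rewrite gt_eqF.
pose N := (`|P| ^+ 2)^-1 *: P.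
have Nn : `|N| = `|P|^-1.
  by rewrite /N normrZ normfV ger0_norm ?sqr_ge0 // expr2 invfM mulfVK.
have pN : ip P N = 1 by rewrite /N (ipZr hX) (ipxx hX) mulVf // expf_neq0.
have NE : N = (`|P| ^+ 2)^-1 *: P by [].
clearbody N.
(* Orthogonal projection along [P]; the bound 2 on its norm is not sharp but sufficient. *)
pose pr v : X := v - ip v P *: N.
have prB v w : pr v - pr w = pr (v - w) by rewrite /pr (ipBl hX); lmod.
have prn v : `|pr v| <= 2 * `|v|.
  rewrite /pr; apply: le_trans (ler_normB _ _) _; rewrite normrZ Nn.
  have : `|ip v P| * `|P|^-1 <= `|v| * `|P| * `|P|^-1.
    by apply: ler_wpM2r; [rewrite invr_ge0 | exact: cauchy_schwarz].
  rewrite mulfK //; lra.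
have prZP k : pr (k *: P) = 0.
  rewrite /pr (ipZl hX) (ipxx hX) NE scalerA mulfK ?subrr // expf_neq0 //.
have prD (z : R -> X) s v : has_derivative z s v -> has_derivative (fun s => pr (z s)) s (pr v).
  move=> Dz e e0; have e2 : 0 < e / 2 by rewrite divr_gt0.
  have [r r0 Hr] := Dz _ e2; exists r => // s' h; have := Hr s' h.
  have -> : pr (z s') - pr (z s) - (s' - s) *: pr v = pr (z s' - z s - (s' - s) *: v).
    by rewrite prB /pr !(ipBl hX) (ipZl hX); lmod.
  move=> h1; apply: le_trans (prn _) _; lra_with h1.
(* [2 * th] bounds the angle error: [th] for the tolerance [eps n], [th] for the change of gradient
   near [t]. The condition [2 * th <= c] keeps the component along [P] nondecreasing. *)
have local th : 0 < th -> 2 * th <= c -> exists2 r, 0 < r & forall s, t <= s -> s < t + r ->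
    `|pr (xi s) - pr (xi t)| <= 4 * th * kap / c * (M s - M t) /\ ip (xi t) P <= ip (xi s) P.
  move=> th0 thc; pose e := th / (CP * (kap + 2) + 1).
  have D0 : 0 < CP * (kap + 2) + 1 by rewrite ltr_wpDl // mulr_ge0 // addr_ge0.
  have e_gt0 : 0 < e by rewrite divr_gt0.
  have [r r0 Hr] := Mcont _ e_gt0; have [n0 Hn] := Lim _ e_gt0; have [n1 Hn1] := Lim _ th0.
  have m0 : 0 < Num.min r (T - t) by rewrite lt_min r0 subr_gt0.
  exists (Num.min r (T - t)) => // s ts; rewrite -ltrBlDl lt_min !ltrBlDl => /andP[s1 s2].
  have sT : s <= T by apply: ltW; rewrite addrC subrK in s2.
  have s0 := le_trans tt0 ts.
  have inc n : (maxn n0 n1 <= n)%N ->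
      `|pr (xs n s) - pr (xs n t)| <= 4 * th * kap / c * (M s - M t) /\ ip (xs n t) P <= ip (xs n s) P.
    rewrite geq_max => /andP[nn0 nn1]; have [Ln Gn Sn] := As n.
    have [_ Hn'] := Hn n nn0; have [en _] := Hn1 n nn1.
    have slope : {ae @lebesgue_measure R, forall z, t < z < s -> exists2 v, has_derivative (xs n) z v &
        `|v| <= kap * phi z /\ (v = 0 \/ exists a p, [/\ 0 <= a, `|p - P| <= 2 * th, c <= `|p| & v = a *: p])}.
      apply: (ae_imply (ae_and Sn M_der)) => z [Dz Mz] /andP[tz zs].
      have zT : 0 < z < T by rewrite (lt_trans t0 tz) (lt_le_trans zs sT).
      have [dz Dz' [Sz Sz']] := Dz zT; exists dz => //; have {}Mz := Mz zT.
      have /andP[z0 zT'] := zT.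
      split.
        apply: (has_derivative_dominated (r := T - z) _ kap0 _ Dz' Mz) => [|s' zs' s'T].
          by rewrite subr_gt0.
        by apply: Ln => //; [exact: ltW | rewrite addrC subrK in s'T; exact: ltW].
      have := Gn z (ltW z0) (ltW zT'); rewrite le_eqVlt => /orP[/eqP E|E]; last by left; exact: Sz.
      right; have [a [p [q1 q2 q3 q4]]] := Sz' E; exists a, p; split => //.
      have -> : p - P = (p - Pg z (xs n z)) + (Pg z (xs n z) - P) by lmod.
      apply: le_trans (ler_normD _ _) _.
      have Mz' : M z - M t <= e by apply: Hr; [exact: ltW | exact: lt_trans s1 | exact: ltW].
      have h1 := P_lip (xs n z) (xi t) tt0 (ltW tz) (ltW zT'); rewrite -/P in h1.
      have h2 : `|xs n z - xi t| <= e + kap * e.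
        have -> : xs n z - xi t = (xs n z - xi z) + (xi z - xi t) by lmod.
        apply: le_trans (ler_normD _ _) _; apply: lerD; first by apply: Hn'; exact: ltW.
        apply: le_trans (L t z tt0 (ltW tz) (ltW zT')) _; exact: ler_wpM2l.
      have h3 : CP * (`|xs n z - xi t| + (M z - M t)) <= CP * ((kap + 2) * e).
        by apply: ler_wpM2l => //; lra_with h2 Mz'.
      have h4 : (CP * (kap + 2) + 1) * e = th by rewrite mulrC mulfVK // gt_eqF.
      lra_with h3 h1 q2 en e_gt0.
    split.
      apply: (@dominated_increment _ (fun s => pr (xs n s)) (2 * kap)) => //.
      - by rewrite mulr_ge0.
      - by rewrite divr_ge0 ?(ltW c0) // mulr_ge0 // mulr_ge0 // ltW.
      - move=> x y x0 xy yT; rewrite prB; apply: le_trans (prn _) _.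
        by rewrite -mulrA ler_pM2l //; exact: Ln.
      apply: (ae_imply slope) => z Dz tz; have [v Dv [vk vS]] := Dz tz.
      exists (pr v); first exact: prD.
      have phz : 0 <= kap * phi z by exact: le_trans (normr_ge0 v) vk.
      case: vS => [->|[a [p [q1 q2 q3 E]]]].
        rewrite -(scale0r P) prZP normr0.
        have -> : 4 * th * kap / c * phi z = 4 * th / c * (kap * phi z) by ring.
        by rewrite mulr_ge0 // divr_ge0 ?(ltW c0) // mulr_ge0 // ltW.
      have -> : pr v = a *: pr (p - P).
        have : pr (p - P) = pr p by have := prZP 1; rewrite scale1r -prB => ->; rewrite subr0.
        by move=> ->; rewrite E /pr (ipZl hX); lmod.
      rewrite normrZ ger0_norm //.
      have h1 : a * c <= kap * phi z.
        apply: le_trans vk; rewrite E normrZ ger0_norm //; exact: ler_wpM2l.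
      have h2 : a * `|pr (p - P)| <= a * (4 * th).
        apply: ler_wpM2l => //; apply: le_trans (prn _) _; lra_with q2.
      apply: le_trans h2 _.
      have -> : 4 * th * kap / c * phi z = (kap * phi z / c) * (4 * th) by ring.
      by apply: ler_wpM2r; [lra_with th0 | rewrite ler_pdivlMr].
    apply: (@dominated_monotone (fun s => ip (xs n s) P) (kap * `|P|)) => //.
    - by rewrite mulr_ge0.
    - move=> x y x0 xy yT; rewrite -(ipBl hX); apply: le_trans (cauchy_schwarz hX _ _) _.
      by rewrite mulrAC; apply: ler_wpM2r => //; exact: Ln.
    apply: (ae_imply slope) => z Dz tz; have [v Dv [vk vS]] := Dz tz.
    exists (ip v P); first exact: has_derivative_ip.
    case: vS => [->|[a [p [q1 q2 q3 E]]]]; first by rewrite (ip0l hX).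
    rewrite E (ipZl hX); apply: mulr_ge0 => //.
    have -> : P = p - (p - P) by lmod.
    rewrite (ipBr hX) (ipxx hX).
    have := ip_le hX p (p - (p - (p - P))).
    have -> : p - (p - (p - P)) = p - P by lmod.
    have : `|p| * `|p - P| <= `|p| * `|p| by apply: ler_wpM2l => //; lra_with q3 q2 thc.
    rewrite -expr2; (drop_order_hyps; lra).
  split.
    apply/ler_addgt0Pr => e' e'0.
    have e4 : 0 < e' / 4 by rewrite divr_gt0.
    have [n2 Hn2] := Lim _ e4; pose n := maxn (maxn n0 n1) n2.
    have [_ q] := Hn2 n (leq_maxr _ _); have [h1 _] := inc n (leq_maxl _ _).
    have -> : pr (xi s) - pr (xi t) = (pr (xs n s) - pr (xs n t)) - (pr (xs n s - xi s) - pr (xs n t - xi t)).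
      by rewrite -!prB; lmod.
    apply: le_trans (ler_normB _ _) _.
    have h2 := ler_normB (pr (xs n s - xi s)) (pr (xs n t - xi t)).
    have h3 := prn (xs n s - xi s); have h4 := prn (xs n t - xi t).
    have h5 := q s s0 sT; have h6 := q t tt0 ttT; lra_with h6 h5 h4 h3 h2 h1.
  apply/ler_addgt0Pr => e' e'0.
  have e4 : 0 < e' / (2 * `|P|) by rewrite divr_gt0 // mulr_gt0.
  have [n2 Hn2] := Lim _ e4; pose n := maxn (maxn n0 n1) n2.
  have [_ q] := Hn2 n (leq_maxr _ _); have [_ h1] := inc n (leq_maxl _ _).
  have est z : 0 <= z -> z <= T -> `|ip (xs n z) P - ip (xi z) P| <= e' / 2.
    move=> z0 zT; rewrite -(ipBl hX); apply: le_trans (cauchy_schwarz hX _ _) _.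
    have -> : e' / 2 = e' / (2 * `|P|) * `|P| by field.
    by apply: ler_wpM2r => //; exact: q.
  have := est s s0 sT; have := est t tt0 ttT; rewrite !ler_norml => /andP[b1 b2] /andP[b3 b4].
  lra_with b4 b1 h1.
have ipd : 0 <= ip d P.
  have c4 : 0 < c / 4 by rewrite divr_gt0.
  have [|r r0 Hr] := local (c / 4) c4; first lra_with c4.
  apply: (has_derivative_ge0 r0 _ (has_derivative_ip hX P Dd)) => s ts sr.
  by have [] := Hr s ts sr.
have dE : pr d = 0.
  apply/eqP; rewrite -normr_le0; apply/ler_addgt0Pl => e e0; rewrite addr0.
  pose K := 4 * kap / c * `|phi t| + 1.
  have K0 : 0 < K by rewrite ltr_wpDl // mulr_ge0 // divr_ge0 ?mulr_ge0 // ltW.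
  pose th := Num.min (c / 2) (e / K).
  have th0 : 0 < th by rewrite lt_min !divr_gt0.
  have th1' : th <= c / 2 by rewrite ge_min lexx.
  have th1 : 2 * th <= c by lra_with th1'.
  have th2 : th * K <= e by rewrite -ler_pdivlMr // ge_min lexx orbT.
  have [r r0 Hr] := local th th0 th1.
  have : `|pr d| <= 4 * th * kap / c * phi t.
    apply: (has_derivative_dominated r0 _ _ (prD _ _ _ Dd) Mt).
      by rewrite divr_ge0 ?(ltW c0) // mulr_ge0 // mulr_ge0 // ltW.
    by move=> s ts sr; have [] := Hr s ts sr.
  have : 4 * th * kap / c * phi t <= th * (4 * kap / c * `|phi t|).
    have -> : 4 * th * kap / c * phi t = th * (4 * kap / c * phi t) by ring.
    apply: ler_wpM2l; first exact: ltW.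
    by apply: ler_wpM2l; [rewrite divr_ge0 ?mulr_ge0 // ltW | exact: ler_norm].
  move: th2; rewrite /K mulrDr mulr1; lra_with th0.
exists (ip d P / `|P| ^+ 2), P; split => //.
- by rewrite divr_ge0 ?sqr_ge0.
- by rewrite subrr normr0.
- by move/eqP: dE; rewrite /pr subr_eq0 => /eqP {1}->; rewrite NE scalerA.
Qed.

End limit.

(** Differentiability at every point gives [null_variation], so neither continuity nor integrability
    of the derivative is asked for. *)
Lemma mean_value_le (R : realType) (V : normedModType R) (f : R -> V) (a b K : R) : a <= b ->
  (forall t, a <= t <= b -> exists2 v, has_derivative f t v & `|v| <= K) ->
  `|f b - f a| <= K * (b - a).
Proof.
move=> ab H.
have K0 : 0 <= K.
  by have [|v _] := H a; [rewrite lexx | exact: le_trans].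
rewrite mulrBr; apply: (@ae_mean_value_ineq _ _ a b f (fun t => K * t)) => //.
- by apply: differentiable_null_variation => // t /H[v Dv _]; exists v.
- by move=> x y _ xy _; exact: ler_wpM2l.
apply: aeW => t /andP[at_ tb] e e0.
have [|v Dv vK] := H t; first by rewrite !ltW.
have [r r0 Hr] := has_derivative_norm_straddle Dv vK e0.
exists r => // x y ax xt ty yb h1 h2; apply: le_trans (Hr x y xt ty h1 h2) _.
by rewrite mulrDl mulrBr.
Qed.

Lemma has_derivative_lipschitz (R : realType) (V : normedModType R) (f : R -> V) t d :
  has_derivative f t d -> exists2 eta, 0 < eta & forall s, `|s - t| < eta ->
    `|f s - f t| <= (`|d| + 1) * `|s - t|.
Proof.
move=> D; have [eta eta0 He] := D 1 ltr01; exists eta => // s st.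
rewrite -[f s - f t](subrK ((s - t) *: d)); apply: le_trans (ler_normD _ _) _.
have := He s st; rewrite normrZ; lra.
Qed.

(** * Taylor expansion and chain rule for [G] *)

Section gradients.
Variables (R : realType) (X W : normedModType R) (ip : X -> X -> R).
Hypothesis hX : hilbert_inner ip.
Variables (G : X -> W -> R) (gx : X -> W -> X) (gw : X -> W -> W -> R) (K0 K1 C0 C1 : R).
Hypothesis grx : is_grad_x ip G gx.
Hypothesis grw : is_grad_w G gw.
Hypothesis C00 : 0 < C0.
Hypothesis C10 : 0 < C1.
Hypothesis K10 : 0 < K1.
Hypothesis K00 : 0 < K0.
Hypothesis gx_le : forall x w, `|gx x w| <= K0.
Hypothesis gw_le : forall x w v, `|gw x w v| <= K1 * `|v|.
Hypothesis gx_lip : forall x w x' w', `|gx x w - gx x' w'| <= C0 * (`|x - x'| + `|w - w'|).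
Hypothesis gw_lip : forall x w x' w' v,
  `|gw x w v - gw x' w' v| <= C1 * (`|x - x'| + `|w - w'|) * `|v|.

Lemma gwB x w v v' : gw x w (v - v') = gw x w v - gw x w v'.
Proof.
have [L _ _] := grw x w.
have := L (-1) v' v; rewrite scaleN1r [- v' + v]addrC => ->; ring.
Qed.

Lemma gwZ x w k v : gw x w (k *: v) = k * gw x w v.
Proof.
have [L _ _] := grw x w; have := L k v 0; rewrite addr0 => ->.
by have := gwB x w v v; rewrite !subrr => ->; rewrite addr0.
Qed.

Lemma G_line_x x w y s :
  has_derivative (fun s => G (x + s *: y) w) s (ip (gx (x + s *: y) w) y).
Proof.
pose f s := G (x + s *: y) w.
pose q h := h^-1 * (G (x + s *: y + h *: y) w - G (x + s *: y) w).
have qE h : q h = h^-1 *: (f (s + h) - f s).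
  by rewrite /q /f; have -> : x + (s + h) *: y = x + s *: y + h *: y by lmod.
have Hq : q @ 0^' --> ip (gx (x + s *: y) w) y by exact: grx.
exact ((cvg_quotientP _ qE).1 Hq).
Qed.

Lemma G_line_w x w v s :
  has_derivative (fun s => G x (w + s *: v)) s (gw x (w + s *: v) v).
Proof.
have [_ _ D] := grw x (w + s *: v).
pose f s := G x (w + s *: v).
pose q h := h^-1 * (G x (w + s *: v + h *: v) - G x (w + s *: v)).
have qE h : q h = h^-1 *: (f (s + h) - f s).
  by rewrite /q /f; have -> : w + (s + h) *: v = w + s *: v + h *: v by lmod.
have Hq : q @ 0^' --> gw x (w + s *: v) v by exact: D.
exact ((cvg_quotientP _ qE).1 Hq).
Qed.

Lemma G_lip_x x x' w : `|G x' w - G x w| <= K0 * `|x' - x|.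
Proof.
have := @mean_value_le R R^o (fun s => G (x + s *: (x' - x)) w) 0 1 (K0 * `|x' - x|) ler01.
rewrite scale1r scale0r addr0 subrKC subr0 mulr1; apply => s _.
exists (ip (gx (x + s *: (x' - x)) w) (x' - x)); first exact: G_line_x.
by apply: le_trans (cauchy_schwarz hX _ _) _; apply: ler_wpM2r.
Qed.

Lemma G_lip_w x w w' : `|G x w' - G x w| <= K1 * `|w' - w|.
Proof.
have := @mean_value_le R R^o (fun s => G x (w + s *: (w' - w))) 0 1 (K1 * `|w' - w|) ler01.
rewrite scale1r scale0r addr0 subrKC subr0 mulr1; apply => s _.
by exists (gw x (w + s *: (w' - w)) (w' - w)); [exact: G_line_w | exact: gw_le].
Qed.

Lemma has_derivative_sub_linear (f : R -> R) t d k : has_derivative f t d ->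
  has_derivative (fun s => f s - k * s) t (d - k).
Proof.
move=> D; have := has_derivativeD D (has_derivativeZ (- k) (has_derivative_id t)).
rewrite (_ : - k *: 1 = - k); last by rewrite /GRing.scale /= mulr1.
apply: (has_derivative_ext ltr01) => s _; by rewrite /GRing.scale /= mulNr.
Qed.

Lemma G_taylor_x x w h : `|G (x + h) w - G x w - ip (gx x w) h| <= C0 * `|h| ^+ 2.
Proof.
have := @mean_value_le R R^o (fun s => G (x + s *: h) w - ip (gx x w) h * s) 0 1 (C0 * `|h| ^+ 2) ler01.
rewrite scale1r scale0r addr0 subr0 mulr0 subr0 !mulr1 [_ - G x w]addrAC; apply => s /andP[s0 s1].
exists (ip (gx (x + s *: h) w) h - ip (gx x w) h).
  exact/has_derivative_sub_linear/G_line_x.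
rewrite -(ipBl hX); apply: le_trans (cauchy_schwarz hX _ _) _.
rewrite expr2 mulrA; apply: ler_wpM2r => //; apply: le_trans (gx_lip _ _ _ _) _.
rewrite subrr normr0 addr0; apply: ler_wpM2l; first exact: ltW.
have -> : x + s *: h - x = s *: h by lmod.
by rewrite normrZ ger0_norm // ler_piMl.
Qed.

Lemma G_taylor_w x w k : `|G x (w + k) - G x w - gw x w k| <= C1 * `|k| ^+ 2.
Proof.
have := @mean_value_le R R^o (fun s => G x (w + s *: k) - gw x w k * s) 0 1 (C1 * `|k| ^+ 2) ler01.
rewrite scale1r scale0r addr0 subr0 mulr0 subr0 !mulr1 [_ - G x w]addrAC; apply => s /andP[s0 s1].
exists (gw x (w + s *: k) k - gw x w k).
  exact/has_derivative_sub_linear/G_line_w.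
apply: le_trans (gw_lip _ _ _ _ _) _.
rewrite expr2 mulrA; apply: ler_wpM2r => //.
rewrite subrr normr0 add0r; apply: ler_wpM2l; first exact: ltW.
have -> : w + s *: k - w = s *: k by lmod.
by rewrite normrZ ger0_norm // ler_piMl.
Qed.

(** Lipschitz Gateaux gradients give a joint quadratic remainder: first [w] moves, then [x], and the
    cross term [<gx x (w + k) - gx x w, h>] is itself quadratic. *)
Lemma G_taylor x w h k :
  `|G (x + h) (w + k) - G x w - ip (gx x w) h - gw x w k| <= (C0 + C1) * (`|h| + `|k|) ^+ 2.
Proof.
have a1 := G_taylor_x x (w + k) h; have a2 := G_taylor_w x w k.
have a3 : `|ip (gx x (w + k) - gx x w) h| <= C0 * `|k| * `|h|.
  apply: le_trans (cauchy_schwarz hX _ _) _; apply: ler_wpM2r => //.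
  apply: le_trans (gx_lip _ _ _ _) _; rewrite subrr normr0 add0r.
  by have -> : w + k - w = k by lmod.
have -> : G (x + h) (w + k) - G x w - ip (gx x w) h - gw x w k
  = (G (x + h) (w + k) - G x (w + k) - ip (gx x (w + k)) h)
    + (G x (w + k) - G x w - gw x w k) + ip (gx x (w + k) - gx x w) h.
  by rewrite (ipBl hX); ring.
apply: le_trans (ler_normD _ _) _.
have := ler_normD (G (x + h) (w + k) - G x (w + k) - ip (gx x (w + k)) h) (G x (w + k) - G x w - gw x w k).
have hk : 0 <= `|h| * `|k| by rewrite mulr_ge0.
have q1 : 0 <= C0 * (`|h| * `|k|) by rewrite mulr_ge0 // ltW.
have q2 : 0 <= C1 * (`|h| * `|k|) by rewrite mulr_ge0 // ltW.
have q3 : 0 <= C0 * `|k| ^+ 2 by rewrite mulr_ge0 ?sqr_ge0 // ltW.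
have q4 : 0 <= C1 * `|h| ^+ 2 by rewrite mulr_ge0 ?sqr_ge0 // ltW.
have -> : (C0 + C1) * (`|h| + `|k|) ^+ 2 = C0 * `|h| ^+ 2 + C0 * `|k| * `|h| + C0 * (`|h| * `|k|)
  + C0 * `|k| ^+ 2 + C1 * `|h| ^+ 2 + 2 * (C1 * (`|h| * `|k|)) + C1 * `|k| ^+ 2 by ring.
lra.
Qed.

Lemma G_chain (x : R -> X) (w : R -> W) t x' w' :
  has_derivative x t x' -> has_derivative w t w' ->
  has_derivative (fun s => G (x s) (w s)) t (ip (gx (x t) (w t)) x' + gw (x t) (w t) w').
Proof.
move=> Dx Dw e e0.
pose L := (`|x'| + 1) + (`|w'| + 1).
have L0 : 0 < L by rewrite addr_gt0 // ltr_wpDl.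
have CC : 0 < C0 + C1 by rewrite addr_gt0.
have KK : 0 < K0 + K1 by rewrite addr_gt0.
have e1 : 0 < e / (2 * (K0 + K1)) by rewrite divr_gt0 // mulr_gt0.
have [r1 r10 H1] := has_derivative_lipschitz Dx; have [r2 r20 H2] := has_derivative_lipschitz Dw.
have [r3 r30 H3] := Dx _ e1; have [r4 r40 H4] := Dw _ e1.
(* Makes the quadratic remainder at most half of the tolerance; the other half goes to the linear
   remainders. *)
pose r5 := e / (2 * (C0 + C1) * L ^+ 2).
have CL : 0 < 2 * (C0 + C1) * L ^+ 2 by rewrite !mulr_gt0.
have r50 : 0 < r5 by rewrite divr_gt0.
exists (Num.min (Num.min (Num.min r1 r2) (Num.min r3 r4)) r5) => [|s].
  by rewrite !lt_min r10 r20 r30 r40 r50.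
rewrite !lt_min => /andP[/andP[/andP[h1 h2] /andP[h3 h4]] h5].
have {}H1 := H1 s h1; have {}H2 := H2 s h2; have {}H3 := H3 s h3; have {}H4 := H4 s h4.
set D := `|s - t| in H1 H2 H3 H4 h5 *.
have D0 : 0 <= D by exact: normr_ge0.
set p := gx (x t) (w t); set q := gw (x t) (w t).
have := G_taylor (x t) (w t) (x s - x t) (w s - w t); rewrite !subrKC -/p -/q => T1.
have sq : (`|x s - x t| + `|w s - w t|) ^+ 2 <= (L * D) ^+ 2.
  rewrite ler_sqr ?nnegrE ?addr_ge0 ?mulr_ge0 ?(ltW L0) //.
  by rewrite /L mulrDl; exact: lerD.
have T2 : (C0 + C1) * (`|x s - x t| + `|w s - w t|) ^+ 2 <= e / 2 * D.
  apply: (@le_trans _ _ ((C0 + C1) * (L * D) ^+ 2)); first by rewrite ler_pM2l.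
  have -> : (C0 + C1) * (L * D) ^+ 2 = (D * (2 * (C0 + C1) * L ^+ 2)) / 2 * D by field.
  apply: ler_wpM2r => //; rewrite ler_pM2r ?invr_gt0 //.
  by rewrite -ler_pdivlMr // ltW.
have T3 : `|ip p (x s - x t - (s - t) *: x')| <= K0 * (e / (2 * (K0 + K1)) * D).
  by apply: le_trans (cauchy_schwarz hX _ _) _; apply: ler_pM; [exact: normr_ge0 | exact: normr_ge0 | exact: gx_le | exact: H3].
have T4 : `|q (w s - w t - (s - t) *: w')| <= K1 * (e / (2 * (K0 + K1)) * D).
  by apply: le_trans (gw_le _ _ _) _; rewrite ler_pM2l.
have -> : G (x s) (w s) - G (x t) (w t) - (s - t) *: (ip p x' + q w')
  = (G (x s) (w s) - G (x t) (w t) - ip p (x s - x t) - q (w s - w t))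
    + ip p (x s - x t - (s - t) *: x') + q (w s - w t - (s - t) *: w').
  by rewrite (ipBr hX (x s - x t) ((s - t) *: x') p) (ipZr hX) /q (gwB _ _ (w s - w t)) gwZ /GRing.scale /=; ring.
have -> : e * D = e / 2 * D + (K0 * (e / (2 * (K0 + K1)) * D) + K1 * (e / (2 * (K0 + K1)) * D)).
  have KKn : K0 + K1 != 0 by rewrite gt_eqF.
  by field.
apply: le_trans (ler_normD _ _) _; rewrite addrA; apply: lerD => //.
by apply: le_trans (ler_normD _ _) _; apply: lerD => //; exact: le_trans T2.
Qed.

End gradients.

Lemma has_derivative_scale (R : realType) (W : normedModType R) (v : W) (s : R) :
  has_derivative (fun s => s *: v) s v.
Proof.
move=> e e0; exists 1 => // s' _.
have -> : s' *: v - s *: v - (s' - s) *: v = 0 by lmod.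
by rewrite normr0 mulr_ge0 // ltW.
Qed.

(** * Increments in time controlled by integrable bounds *)

Section time_dependence.
Variables (R : realType).

Lemma ae_dense (P : R -> Prop) a b : {ae @lebesgue_measure R, forall t, P t} -> a < b ->
  exists2 t, a < t < b & P t.
Proof.
move=> [N [mN N0 NP]] ab; apply: contrapT => no.
have : (lebesgue_measure `]a, b[%classic <= lebesgue_measure N)%E.
  apply: le_lebesgue_measure => // t /=; rewrite in_itv /= => tab; apply: NP => Pt; apply: no.
  by exists t.
rewrite [X in (_ <= X)%E]N0 lebesgue_measure_itv /= lte_fin ab -EFinB lee_fin; lra.
Qed.

Definition continuous_on (W : normedModType R) T (f : R -> W) :=
  forall t, 0 <= t -> t <= T -> forall e, 0 < e -> exists2 eta, 0 < eta &
    forall s, 0 <= s -> s <= T -> `|s - t| < eta -> `|f s - f t| < e.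

(** The derivative is available on the open interval only; compact subintervals are treated first,
    and continuity extends the bound to the end points. *)
Lemma increment_le_primitive (W : normedModType R) (T k : R) (f : R -> W) (psi : R -> R) :
  0 <= k -> L1T psi -> (forall x, 0 <= psi x) -> continuous_on T f ->
  (forall t, 0 < t < T -> exists d, has_derivative f t d) ->
  {ae @lebesgue_measure R, forall t, 0 < t < T -> forall d, has_derivative f t d -> `|d| <= k * psi t} ->
  forall s t, 0 <= s -> s <= t -> t <= T -> `|f t - f s| <= k * (primitive psi t - primitive psi s).
Proof.
move=> k0 Ip p0 cf df bf.
have int s t : 0 < s -> s <= t -> t < T -> `|f t - f s| <= k * (primitive psi t - primitive psi s).
  move=> s0 st tT; apply: (ae_increment_le (phi := psi)) => //.
  - apply: differentiable_null_variation => // r /andP[sr rt]; apply: df.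
    by rewrite (lt_le_trans s0 sr) (le_lt_trans rt tT).
  - by move=> x y _ xy _; exact: primitive_le.
  - by apply: (ae_imply (primitive_derivative Ip)) => r + _.
  apply: (ae_imply bf) => r Br /andP[sr rt].
  have rT : 0 < r < T by rewrite (lt_trans s0 sr) (lt_trans rt tT).
  by have [d Dd] := df r rT; exists d => //; exact: Br.
move=> s t s0; rewrite le_eqVlt => /orP[/eqP->|st] tT.
  by rewrite !subrr normr0 mulr0.
apply/ler_addgt0Pr => e e0.
have e2 : 0 < e / 2 by rewrite divr_gt0.
have [r1 r10 H1] := cf s s0 (le_trans (ltW st) tT) _ e2.
have [r2 r20 H2] := cf t (le_trans s0 (ltW st)) tT _ e2.
pose h := Num.min (Num.min r1 r2) (t - s) / 2.
have m0 : 0 < Num.min (Num.min r1 r2) (t - s) by rewrite !lt_min r10 r20 subr_gt0.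
have h0 : 0 < h by rewrite divr_gt0.
have h2 : h + h <= t - s.
  have : h * 2 <= t - s by rewrite /h mulfVK // ge_min lexx orbT.
  lra.
have : h < Num.min (Num.min r1 r2) (t - s) by rewrite /h; lra.
rewrite !lt_min => /andP[/andP[hr1 hr2] _].
have a1 : `|f (s + h) - f s| < e / 2.
  by apply: H1; rewrite ?(addrC s h) ?addrK ?gtr0_norm //; lra.
have a2 : `|f (t - h) - f t| < e / 2.
  apply: H2; [lra | lra |]; have -> : t - h - t = - h by ring.
  by rewrite normrN gtr0_norm.
have a3 := int (s + h) (t - h) ltac:(lra) ltac:(lra) ltac:(lra).
have a4 : k * (primitive psi (t - h) - primitive psi (s + h)) <= k * (primitive psi t - primitive psi s).
  apply: ler_wpM2l => //; apply: lerB; apply: primitive_le => //; lra.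
have -> : f t - f s = (f (t - h) - f (s + h)) + (f (s + h) - f s) - (f (t - h) - f t) by lmod.
apply: le_trans (ler_normB _ _) _.
have := ler_normD (f (t - h) - f (s + h)) (f (s + h) - f s); lra.
Qed.

Lemma within_continuous_time (X W : normedModType R) (T : R) (g : R -> X -> X -> W) :
  {within `[0, T]%classic `*` setT `*` setT, continuous (fun p : R * X * X => g p.1.1 p.1.2 p.2)} ->
  forall u xi, continuous_on T (fun t => g t u xi).
Proof.
move=> /subspace_continuousP H u xi t t0 tT e e0.
have At : (`[0, T]%classic `*` setT `*` setT) (t, u, xi).
  by split => //; split => //=; rewrite in_itv /= t0 tT.
have /cvgrPdist_lt/(_ e e0) := H _ At.
rewrite near_withinE => /nbhs_ballP[eta /= eta0 He]; exists eta => // s s0 sT st.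
rewrite distrC; apply: (He (s, u, xi)).
  split; last exact: ballxx.
  by split; [rewrite /= -ball_normE /= distrC | exact: ballxx].
by split => //; split => //=; rewrite in_itv /= s0 sT.
Qed.

End time_dependence.

(** * Proximal normals of a level set *)

Section normal_cone.
Variables (R : realType) (X : normedModType R) (ip : X -> X -> R).
Hypothesis hX : hilbert_inner ip.
Variables (F : X -> R) (gr : X -> X) (C0 : R).
Hypothesis C0_gt0 : 0 < C0.
Hypothesis taylor : forall x h, `|F (x + h) - F x - ip (gr x) h| <= C0 * `|h| ^+ 2.

(** Bridges the topological boundary in hypothesis (iii) and the level 1: a short move along a
    nonzero gradient raises [F] above 1. *)
Lemma level_set_bdry x : F x = 1 -> gr x != 0 -> bdry [set y | F y <= 1] x.
Proof.
move=> Fx g0; have C00 := C0_gt0; split; first by apply: subset_closure; rewrite /= Fx.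
move=> /nbhs_ballP[e /= e0 He].
have gp : 0 < `|gr x| by rewrite normr_gt0.
pose s := Num.min (e / (2 * `|gr x|)) (2 * C0)^-1.
have s0 : 0 < s by rewrite lt_min divr_gt0 ?invr_gt0 ?mulr_gt0.
have s1 : s * (2 * `|gr x|) <= e by rewrite -ler_pdivlMr ?mulr_gt0 // ge_min lexx.
have s2 : s * (2 * C0) <= 1.
  by rewrite -ler_pdivlMr ?mulr_gt0 // mul1r ge_min lexx orbT.
have sgr : 0 < s * `|gr x| by rewrite mulr_gt0.
have : F (x + s *: gr x) <= 1.
  apply: He; rewrite -ball_normE /=.
  have -> : x - (x + s *: gr x) = - (s *: gr x) by lmod.
  rewrite normrN normrZ gtr0_norm //; lra.
have := taylor x (s *: gr x); rewrite Fx (ipZr hX) (ipxx hX) normrZ gtr0_norm // exprMn ler_norml.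
move=> /andP[h1 _] h2.
have q : 0 < s * `|gr x| ^+ 2 by rewrite mulr_gt0 // exprn_gt0.
have : (s * (2 * C0)) * (s * `|gr x| ^+ 2) <= 1 * (s * `|gr x| ^+ 2) by rewrite ler_pM2r.
lra.
Qed.

Variable r : R.
Hypothesis r_gt0 : 0 < r.

Definition proximal_normal (x d : X) :=
  forall z, F z <= 1 -> 0 <= ip (x - z) d + `|d| / (2 * r) * `|x - z| ^+ 2.

(** Tested at [x - s v], the quadratic term is of order [s ^+ 2], so division by [s] leaves the
    linear inequality in the limit. *)
Lemma proximal_normal_feasible x d v s0 : proximal_normal x d -> 0 < s0 ->
  (forall s, 0 < s -> s <= s0 -> F (x - s *: v) <= 1) -> 0 <= ip v d.
Proof.
move=> H s00 Fe; have r0 := r_gt0; rewrite -oppr_le0; apply/ler_addgt0Pl => e e0; rewrite addr0.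
pose K := `|d| / (2 * r) * `|v| ^+ 2 + 1.
have k0 : 0 <= `|d| / (2 * r) * `|v| ^+ 2.
  by rewrite mulr_ge0 ?sqr_ge0 // divr_ge0 ?mulr_ge0 // ltW.
have K0 : 0 < K by rewrite /K; lra.
pose s := Num.min s0 (e / K).
have s_gt0 : 0 < s by rewrite lt_min s00 divr_gt0.
have s1 : s <= s0 by rewrite ge_min lexx.
have s2 : s * K <= e by rewrite -ler_pdivlMr // ge_min lexx orbT.
have := H _ (Fe s s_gt0 s1).
have -> : x - (x - s *: v) = s *: v by lmod.
rewrite (ipZl hX) normrZ (gtr0_norm s_gt0) exprMn.
have -> : s * ip v d + `|d| / (2 * r) * (s ^+ 2 * `|v| ^+ 2)
   = s * (ip v d + s * (`|d| / (2 * r) * `|v| ^+ 2)) by ring.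
rewrite pmulr_rge0 // => h.
have : s * K = s * (`|d| / (2 * r) * `|v| ^+ 2) + s by rewrite /K; ring.
lra.
Qed.

Lemma proximal_normal_interior x d : F x < 1 -> proximal_normal x d -> d = 0.
Proof.
move=> Fx H; have C00 := C0_gt0.
pose v := - d.
pose K := `|gr x| * `|v| + C0 * `|v| ^+ 2 + 1.
have k1 : 0 <= `|gr x| * `|v| by rewrite mulr_ge0.
have k2 : 0 <= C0 * `|v| ^+ 2 by rewrite mulr_ge0 ?sqr_ge0 // ltW.
have K0 : 0 < K by rewrite /K; lra.
pose s0 := Num.min 1 ((1 - F x) / K).
have s00 : 0 < s0 by rewrite lt_min ltr01 divr_gt0 // subr_gt0.
have : 0 <= ip v d.
  apply: (proximal_normal_feasible H s00) => s sp ss.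
  have s1 : s <= 1 by apply: le_trans ss _; rewrite ge_min lexx.
  have s2 : s * K <= 1 - F x.
    by rewrite -ler_pdivlMr //; apply: le_trans ss _; rewrite ge_min lexx orbT.
  have := taylor x (- (s *: v)); rewrite ler_norml => /andP[_].
  rewrite (ipNr hX) (ipZr hX) normrN normrZ (gtr0_norm sp) exprMn.
  have a1 : s * - ip (gr x) v <= s * (`|gr x| * `|v|).
    by rewrite ler_pM2l //; have := cauchy_schwarz hX (gr x) v; rewrite ler_norml => /andP[]; lra.
  have a2 : C0 * (s ^+ 2 * `|v| ^+ 2) <= s * (C0 * `|v| ^+ 2).
    have -> : C0 * (s ^+ 2 * `|v| ^+ 2) = s * (s * (C0 * `|v| ^+ 2)) by ring.
    by rewrite ler_pM2l // ler_piMl.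
  have a3 : s * K = s * (`|gr x| * `|v|) + s * (C0 * `|v| ^+ 2) + s by rewrite /K; ring.
  lra.
rewrite /v (ipNl hX) (ipxx hX) oppr_ge0 => h.
by apply/eqP; rewrite -normr_eq0 -sqrf_eq0 eq_le h sqr_ge0.
Qed.

(** Every [v] with [<P, v> > 0] is admissible. The test vector [eta P - w], with [w] the part of [d]
    orthogonal to [P], gives [|w| ^+ 2 <= eta <P, d>] for all small [eta], hence [w = 0]. *)
Lemma proximal_normal_gradient x d : F x = 1 -> gr x != 0 -> proximal_normal x d ->
  exists2 a, 0 <= a & d = a *: gr x.
Proof.
move=> Fx g0 H; have C00 := C0_gt0.
pose P := gr x; have P0 : 0 < `|P| by rewrite normr_gt0.
have pos v : 0 < ip P v -> 0 <= ip v d.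
  move=> pv; pose K := C0 * `|v| ^+ 2 + 1.
  have k2 : 0 <= C0 * `|v| ^+ 2 by rewrite mulr_ge0 ?sqr_ge0 // ltW.
  have K0 : 0 < K by rewrite /K; lra.
  have s00 : 0 < ip P v / K by rewrite divr_gt0.
  apply: (proximal_normal_feasible H s00) => s sp; rewrite ler_pdivlMr // => ss.
  have := taylor x (- (s *: v)); rewrite ler_norml => /andP[_].
  rewrite Fx (ipNr hX) (ipZr hX) normrN normrZ (gtr0_norm sp) exprMn -/P.
  have : s * (s * K) <= s * ip P v by rewrite ler_pM2l.
  have : 0 < s * s by rewrite mulr_gt0.
  have -> : s * (s * K) = C0 * (s ^+ 2 * `|v| ^+ 2) + s * s by rewrite /K; ring.
  lra.
have P2 : 0 < `|P| ^+ 2 by rewrite exprn_gt0.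
have Pn : `|P| ^+ 2 != 0 by rewrite gt_eqF.
have PE : P = gr x by [].
clearbody P.
have kd : 0 <= ip P d by apply: pos; rewrite (ipxx hX).
pose k := ip P d / `|P| ^+ 2.
have kE : k * `|P| ^+ 2 = ip P d by rewrite /k mulfVK.
pose w := d - k *: P.
have wP : ip P w = 0 by rewrite /w (ipBr hX) (ipZr hX) (ipxx hX) kE subrr.
have wd : ip w d = `|w| ^+ 2.
  have <- : ip w (w + k *: P) = ip w d by congr (ip _ _); rewrite /w; lmod.
  by rewrite (ipDr hX) (ipxx hX) (ipZr hX) (ipC hX w P) wP mulr0 addr0.
exists k; first by rewrite divr_ge0 // ltW.
apply/eqP; rewrite -PE -subr_eq0 -/w -normr_eq0 -sqrf_eq0 eq_le sqr_ge0 andbT.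
apply/ler_addgt0Pl => e e0; rewrite addr0.
pose eta := e / (ip P d + 1).
have eta0 : 0 < eta by rewrite divr_gt0 //; lra.
have := pos (eta *: P - w).
rewrite (ipBr hX) (ipZr hX) (ipxx hX) wP subr0 mulr_gt0 // => /(_ isT).
rewrite (ipBl hX) (ipZl hX) wd.
have : eta * (ip P d + 1) = e by rewrite /eta mulfVK // gt_eqF //; lra.
lra.
Qed.

End normal_cone.

Lemma differentiable_line (R : realType) (X W : normedModType R) (F : X -> W) (x y : X) (s : R) :
  differentiable F (x + s *: y) ->
  has_derivative (fun s => F (x + s *: y)) s ('d F (x + s *: y) y).
Proof.
move=> dF; rewrite -deriveE //.
pose f s := F (x + s *: y).
pose q h := h^-1 *: ((F \o shift (x + s *: y)) (h *: y) - F (x + s *: y)).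
have qE h : q h = h^-1 *: (f (s + h) - f s).
  by rewrite /q /f /=; have -> : x + (s + h) *: y = h *: y + (x + s *: y) by lmod.
have Hq : q @ 0^' --> 'D_y F (x + s *: y) by exact: (diff_derivable dF).
exact ((cvg_quotientP _ qE).1 Hq).
Qed.

(** * Regularity of the moving constraint in time and state *)

Section abs_restrict.
Variable R : realType.

(** Turns a bound integrable on [[0, T]], without sign outside a full set, into a nonnegative
    integrable function on the line, as [primitive] expects. *)
Definition abs_restrict (T : R) (f : R -> R) (x : R) : R := `|(f \_ `[0, T]) x|.

Lemma abs_restrict_ge0 T f x : 0 <= abs_restrict T f x.
Proof. exact: normr_ge0. Qed.

Lemma abs_restrictE T f x : 0 <= x -> x <= T -> abs_restrict T f x = `|f x|.
Proof.
by move=> x0 xT; rewrite /abs_restrict patchE mem_set //= in_itv /= x0 xT.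
Qed.

Lemma L1_abs_restrict T f : L1 T f -> L1T (abs_restrict T f).
Proof.
move=> If.
have I1 : L1T (f \_ `[0, T]).
  rewrite /L1T (_ : EFin \o (f \_ `[0, T]) = (EFin \o f) \_ `[0, T]); last first.
    by apply/funext => x; rewrite /patch /=; case: ifP.
  exact: (@integrable_mkcond _ _ _ lebesgue_measure _ (EFin \o f) (measurable_itv `[0, T])).1 If.
rewrite /L1T (_ : EFin \o _ = abse \o (EFin \o (f \_ `[0, T]))); last by apply/funext => x.
exact: integrable_abse.
Qed.

End abs_restrict.

Section moving_constraint.
Variables (R : realType) (X W : normedModType R) (T : R) (g : R -> X -> X -> W).
Variables (a b : R -> R) (gam om Cxi Cu : R).
Hypothesis T0 : 0 < T.
Hypothesis hg : hypg T g a b gam om Cxi Cu.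

Definition regular_time (t : R) := forall u v xi eta : X,
        [/\ [/\ forall h, `|'d (g t u) xi h| <= gam * `|h|,
                forall h, `|'d (fun u' => g t u' xi) u h| <= om * `|h| &
                `|'D_1 (fun s => g s u xi) t| <= a t],
            forall h, `|'d (g t u) xi h - 'd (g t v) eta h|
                        <= Cxi * (`|u - v| + `|xi - eta|) * `|h|,
            forall h, `|'d (fun u' => g t u' xi) u h - 'd (fun u' => g t u' eta) v h|
                        <= Cu * (`|u - v| + `|xi - eta|) * `|h| &
            `|'D_1 (fun s => g s u xi) t - 'D_1 (fun s => g s v eta) t|
              <= b t * (`|u - v| + `|xi - eta|)].

Lemma ae_regular_time : {ae @lebesgue_measure R, forall t, 0 < t < T -> regular_time t}.
Proof.
have [_ _ _ _ H] := hg; apply: (ae_imply H) => t Ht t0T; apply: Ht => /=.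
by rewrite in_itv.
Qed.

Lemma lip_xi_regular t u xi eta : 0 < t < T -> regular_time t ->
  `|g t u eta - g t u xi| <= gam * `|eta - xi|.
Proof.
move=> /andP[t0 tT] Rt; have [_ dg _ _ _] := hg.
have := @mean_value_le R W (fun s => g t u (xi + s *: (eta - xi))) 0 1 (gam * `|eta - xi|) ler01.
rewrite scale1r scale0r addr0 subrKC subr0 mulr1; apply => s _.
exists ('d (g t u) (xi + s *: (eta - xi)) (eta - xi)).
  apply: differentiable_line; apply: (dg t u _ _).1 => /=.
  by rewrite in_itv /= !ltW.
by have [[h _ _] _ _ _] := Rt u u (xi + s *: (eta - xi)) xi.
Qed.

Lemma lip_u_regular t u v xi : 0 < t < T -> regular_time t ->
  `|g t v xi - g t u xi| <= om * `|v - u|.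
Proof.
move=> /andP[t0 tT] Rt; have [_ dg _ _ _] := hg.
have := @mean_value_le R W (fun s => g t (u + s *: (v - u)) xi) 0 1 (om * `|v - u|) ler01.
rewrite scale1r scale0r addr0 subrKC subr0 mulr1; apply => s _.
exists ('d (fun u' => g t u' xi) (u + s *: (v - u)) (v - u)).
  apply: (@differentiable_line _ _ _ (fun u' => g t u' xi)); apply: (dg t _ _ _).2 => /=.
  by rewrite in_itv /= !ltW.
by have [[_ h _] _ _ _] := Rt (u + s *: (v - u)) u xi xi.
Qed.

Lemma g_continuous u xi : continuous_on T (fun t => g t u xi).
Proof. by have [H _ _ _ _] := hg; exact: within_continuous_time. Qed.

(* The a.e. Lipschitz bounds extend to every time by continuity, since a set
   of full measure is dense. *)
Lemma lip_extend (u v xi eta : X) (K : R) :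
  (forall t, 0 < t < T -> regular_time t -> `|g t u xi - g t v eta| <= K) ->
  forall t, 0 <= t -> t <= T -> `|g t u xi - g t v eta| <= K.
Proof.
move=> H t t0 tT; apply/ler_addgt0Pr => e e0.
have T0' := T0.
have e2 : 0 < e / 2 by rewrite divr_gt0.
have [r1 r10 H1] := g_continuous u xi t0 tT e2.
have [r2 r20 H2] := g_continuous v eta t0 tT e2.
pose r := Num.min r1 r2; have r0 : 0 < r by rewrite lt_min r10.
have ab : Num.max 0 (t - r) < Num.min T (t + r).
  by rewrite gt_max !lt_min; apply/andP; split; apply/andP; split; lra.
have [s] := ae_dense ae_regular_time ab.
rewrite gt_max lt_min => /andP[/andP[s0 s1] /andP[sT s2]] Rs.
have sT0 : 0 < s < T by rewrite s0.
have st : `|s - t| < r by rewrite ltr_norml; apply/andP; split; lra.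
move: st; rewrite lt_min => /andP[st1 st2].
have a1 := H1 s (ltW s0) (ltW sT) st1; have a2 := H2 s (ltW s0) (ltW sT) st2.
have a3 := H s sT0 (Rs sT0).
have -> : g t u xi - g t v eta = (g s u xi - g s v eta) - (g s u xi - g t u xi) + (g s v eta - g t v eta) by lmod.
apply: le_trans (ler_normD _ _) _.
have := ler_normB (g s u xi - g s v eta) (g s u xi - g t u xi); lra.
Qed.

Lemma lip_xi t u xi eta : 0 <= t -> t <= T -> `|g t u eta - g t u xi| <= gam * `|eta - xi|.
Proof. by apply: lip_extend => s s0 Rs; exact: lip_xi_regular. Qed.

Lemma lip_u t u v xi : 0 <= t -> t <= T -> `|g t v xi - g t u xi| <= om * `|v - u|.
Proof. by apply: lip_extend => s s0 Rs; exact: lip_u_regular. Qed.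

Lemma g_time_derivative t u xi : 0 < t < T ->
  has_derivative (fun s => g s u xi) t ('D_1 (fun s => g s u xi) t).
Proof.
move=> t0T; have [_ _ dt _ _] := hg; apply: derivable_has_derivative; apply: dt => /=.
by rewrite in_itv.
Qed.

Lemma lip_time u xi s t : 0 <= s -> s <= t -> t <= T ->
  `|g t u xi - g s u xi| <= primitive (abs_restrict T a) t - primitive (abs_restrict T a) s.
Proof.
have [_ _ _ [La _ _] _] := hg.
move=> s0 st tT; rewrite -[leRHS]mul1r.
apply: (increment_le_primitive (T := T) (f := fun s => g s u xi)) => //.
- exact: L1_abs_restrict.
- by move=> x; exact: abs_restrict_ge0.
- exact: g_continuous.
- by move=> r rT; exists ('D_1 (fun s => g s u xi) r); exact: g_time_derivative.
apply: (ae_imply ae_regular_time) => r Rr rT d Dd.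
have -> : d = 'D_1 (fun s => g s u xi) r by apply: (has_derivative_unique Dd); exact: g_time_derivative.
have /andP[r0 rT'] := rT; rewrite mul1r (abs_restrictE _ (ltW r0) (ltW rT')).
have [[_ _ h] _ _ _] := Rr rT u u xi xi; apply: le_trans h _; exact: ler_norm.
Qed.

(** The mixed increment is what the chain rule needs: it lets the time variation at a moving state
    be replaced by that at a frozen one. *)
Lemma lip_time_diff u v xi eta s t : 0 <= s -> s <= t -> t <= T ->
  `|(g t u xi - g t v eta) - (g s u xi - g s v eta)| <=
    (`|u - v| + `|xi - eta|) * (primitive (abs_restrict T b) t - primitive (abs_restrict T b) s).
Proof.
have [_ _ _ [_ Lb _] _] := hg.
have D r : 0 < r < T -> has_derivative (fun s => g s u xi - g s v eta) r
    ('D_1 (fun s => g s u xi) r - 'D_1 (fun s => g s v eta) r).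
  move=> rT; have := has_derivativeD (g_time_derivative u xi rT) (has_derivativeZ (-1) (g_time_derivative v eta rT)).
  by rewrite scaleN1r; apply: (has_derivative_ext ltr01) => s' _; rewrite scaleN1r.
move=> s0 st tT.
apply: (increment_le_primitive (T := T) (f := fun s => g s u xi - g s v eta)) => //.
- exact: L1_abs_restrict.
- by move=> x; exact: abs_restrict_ge0.
- move=> r r0 rT e e0; have e2 : 0 < e / 2 by rewrite divr_gt0.
  have [r1 r10 H1] := g_continuous u xi r0 rT e2.
  have [r2 r20 H2] := g_continuous v eta r0 rT e2.
  exists (Num.min r1 r2) => [|s' s'0 s'T]; first by rewrite lt_min r10.
  rewrite lt_min => /andP[h1 h2].
  have -> : g s' u xi - g s' v eta - (g r u xi - g r v eta)
     = (g s' u xi - g r u xi) - (g s' v eta - g r v eta) by lmod.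
  apply: le_lt_trans (ler_normB _ _) _.
  have := H1 s' s'0 s'T h1; have := H2 s' s'0 s'T h2; lra.
- by move=> r rT; eexists; exact: D.
apply: (ae_imply ae_regular_time) => r Rr rT d Dd.
have -> : d = 'D_1 (fun s => g s u xi) r - 'D_1 (fun s => g s v eta) r.
  by apply: (has_derivative_unique Dd); exact: D.
have /andP[r0 rT'] := rT; rewrite (abs_restrictE _ (ltW r0) (ltW rT')) mulrC.
have [_ _ _ h] := Rr rT u v xi eta; apply: le_trans h _.
by apply: ler_wpM2r; [rewrite addr_ge0 | exact: ler_norm].
Qed.

Definition g_velocity t (u xi du dxi : X) : W :=
  'D_1 (fun s => g s u xi) t + 'd (fun u' => g t u' xi) u du + 'd (g t u) xi dxi.

Lemma g_partial_taylor t (v v' z z' : X) : 0 < t < T -> regular_time t ->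
  `|g t v' z' - g t v z - 'd (fun u' => g t u' z) v (v' - v) - 'd (g t v) z (z' - z)|
   <= (Cxi + Cu) * (`|v' - v| + `|z' - z|) ^+ 2.
Proof.
move=> tT Rt; have [_ dg _ [_ _ [_ _ Cxi0 Cu0]] _] := hg; have /andP[t0 tT'] := tT.
have tin : `[0, T]%classic t by rewrite /= in_itv /= !ltW.
have s1 : `|g t v' z' - g t v' z - 'd (g t v) z (z' - z)| <= Cxi * (`|v' - v| + `|z' - z|) * `|z' - z|.
  have := @mean_value_le R W (fun s => g t v' (z + s *: (z' - z)) - s *: 'd (g t v) z (z' - z)) 0 1
    (Cxi * (`|v' - v| + `|z' - z|) * `|z' - z|) ler01.
  rewrite !scale1r !scale0r addr0 subrKC !subr0 mulr1 [_ - g t v' z]addrAC; apply => s /andP[s0 s1].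
  exists ('d (g t v') (z + s *: (z' - z)) (z' - z) - 'd (g t v) z (z' - z)).
    have D1 := differentiable_line ((dg t v' (z + s *: (z' - z)) tin).1).
    have := has_derivativeD D1 (has_derivative_scale (- 'd (g t v) z (z' - z)) s).
    by apply: (has_derivative_ext ltr01) => s' _; rewrite scalerN.
  have [_ h _ _] := Rt v' v (z + s *: (z' - z)) z; apply: le_trans (h _) _.
  apply: ler_wpM2r => //; rewrite ler_pM2l // lerD2l.
  have -> : z + s *: (z' - z) - z = s *: (z' - z) by lmod.
  by rewrite normrZ ger0_norm // ler_piMl.
have s2 : `|g t v' z - g t v z - 'd (fun u' => g t u' z) v (v' - v)| <= Cu * `|v' - v| * `|v' - v|.
  have := @mean_value_le R W (fun s => g t (v + s *: (v' - v)) z - s *: 'd (fun u' => g t u' z) v (v' - v)) 0 1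
    (Cu * `|v' - v| * `|v' - v|) ler01.
  rewrite !scale1r !scale0r addr0 subrKC !subr0 mulr1 [_ - g t v z]addrAC; apply => s /andP[s0 s1'].
  exists ('d (fun u' => g t u' z) (v + s *: (v' - v)) (v' - v) - 'd (fun u' => g t u' z) v (v' - v)).
    have D1 := @differentiable_line _ _ _ (fun u' => g t u' z) v (v' - v) s ((dg t (v + s *: (v' - v)) z tin).2).
    have := has_derivativeD D1 (has_derivative_scale (- 'd (fun u' => g t u' z) v (v' - v)) s).
    by apply: (has_derivative_ext ltr01) => s' _; rewrite scalerN.
  have [_ _ h _] := Rt (v + s *: (v' - v)) v z z; apply: le_trans (h _) _.
  apply: ler_wpM2r => //; rewrite ler_pM2l // subrr normr0 addr0.
  have -> : v + s *: (v' - v) - v = s *: (v' - v) by lmod.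
  by rewrite normrZ ger0_norm // ler_piMl.
have -> : g t v' z' - g t v z - 'd (fun u' => g t u' z) v (v' - v) - 'd (g t v) z (z' - z)
  = (g t v' z' - g t v' z - 'd (g t v) z (z' - z))
  + (g t v' z - g t v z - 'd (fun u' => g t u' z) v (v' - v)) by lmod.
apply: le_trans (ler_normD _ _) _; apply: le_trans (lerD s1 s2) _.
set A := `|v' - v|; set B := `|z' - z|.
have A0 : 0 <= A by exact: normr_ge0.
have B0 : 0 <= B by exact: normr_ge0.
have q1 : 0 <= Cxi * (A + B) * A by rewrite !mulr_ge0 ?addr_ge0 // ltW.
have q2 : 0 <= Cu * (A * B + A * B + B ^+ 2).
  by rewrite mulr_ge0 ?(ltW Cu0) // !addr_ge0 ?mulr_ge0 ?sqr_ge0.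
have -> : (Cxi + Cu) * (A + B) ^+ 2 = Cxi * (A + B) * B + Cu * A * A + Cxi * (A + B) * A
  + Cu * (A * B + A * B + B ^+ 2) by ring.
lra.
Qed.

(** No joint differentiability of [g] is assumed. The mixed increment is a product of two increments
    of order [|s - t|], one of the curves and one of the primitive of [|b|], hence negligible. The
    exceptional times do not depend on the curves. *)
Lemma g_chain t (v z : R -> X) v' z' : 0 < t < T -> regular_time t ->
  has_derivative (primitive (abs_restrict T b)) t (abs_restrict T b t) ->
  has_derivative v t v' -> has_derivative z t z' ->
  has_derivative (fun s => g s (v s) (z s)) t (g_velocity t (v t) (z t) v' z').
Proof.
move=> tT Rt Db Dv Dz e e0; have /andP[t0 tT'] := tT.
have [_ dg _ [_ _ [gam0 om0 Cxi0 Cu0]] _] := hg.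
pose Lc := (`|v'| + 1) + (`|z'| + 1).
have L0 : 0 < Lc by rewrite addr_gt0 // ltr_wpDl.
pose bb := `|abs_restrict T b t| + 1.
have bb0 : 0 < bb by rewrite ltr_wpDl.
(* One summand for each of the five error terms of the decomposition below. *)
pose K := 1 + om + gam + Lc * bb + (Cxi + Cu) * Lc ^+ 2.
have K0 : 0 < K.
  have : 0 < Lc * bb by rewrite mulr_gt0.
  have : 0 < (Cxi + Cu) * Lc ^+ 2 by rewrite mulr_gt0 ?exprn_gt0 // addr_gt0.
  have := gam0; have := om0; rewrite /K; lra.
pose e1 := e / K; have e10 : 0 < e1 by rewrite divr_gt0.
have e1K : e1 * K = e by rewrite /e1 mulfVK // gt_eqF.
have [r1 r10 H1] := has_derivative_lipschitz Dv; have [r2 r20 H2] := has_derivative_lipschitz Dz.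
have [r3 r30 H3] := Dv _ e10; have [r4 r40 H4] := Dz _ e10.
have [r5 r50 H5] := g_time_derivative (v t) (z t) tT e10.
have [r6 r60 H6] := has_derivative_lipschitz Db.
pose r7 := Num.min e1 (Num.min t (T - t)).
have r70 : 0 < r7 by rewrite !lt_min e10 t0 subr_gt0.
exists (Num.min (Num.min (Num.min r1 r2) (Num.min r3 r4)) (Num.min (Num.min r5 r6) r7)) => [|s].
  by rewrite !lt_min r10 r20 r30 r40 r50 r60 e10 t0 subr_gt0.
rewrite !lt_min => /andP[/andP[/andP[h1 h2] /andP[h3 h4]] /andP[/andP[h5 h6] /andP[h7 /andP[h8 h9]]]].
have {}H1 := H1 s h1; have {}H2 := H2 s h2; have {}H3 := H3 s h3; have {}H4 := H4 s h4.
have {}H5 := H5 s h5; have {}H6 := H6 s h6.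
have s0 : 0 <= s by move: h8; rewrite ltr_norml => /andP[]; lra.
have sT : s <= T by move: h9; rewrite ltr_norml => /andP[]; lra.
set D := `|s - t| in H1 H2 H3 H4 H5 H6 h7 *.
have D0 : 0 <= D by exact: normr_ge0.
have dL : `|v s - v t| + `|z s - z t| <= Lc * D by rewrite /Lc mulrDl; exact: lerD.
have dL0 : 0 <= `|v s - v t| + `|z s - z t| by rewrite addr_ge0.
have T1 : `|(g s (v s) (z s) - g s (v t) (z t)) - (g t (v s) (z s) - g t (v t) (z t))| <= Lc * bb * e1 * D.
  apply: (@le_trans _ _ ((`|v s - v t| + `|z s - z t|) *
     `|primitive (abs_restrict T b) s - primitive (abs_restrict T b) t|)).
    have [ts|/ltW st] := leP t s.
      apply: le_trans (lip_time_diff _ _ _ _ (ltW t0) ts sT) _.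
      by apply: ler_wpM2l => //; exact: ler_norm.
    rewrite distrC [X in _ * X]distrC; apply: le_trans (lip_time_diff _ _ _ _ s0 st (ltW tT')) _.
    by apply: ler_wpM2l => //; exact: ler_norm.
  apply: (@le_trans _ _ ((Lc * D) * (bb * D))); first exact: ler_pM.
  have -> : Lc * D * (bb * D) = Lc * bb * D * D by ring.
  by apply: ler_wpM2r => //; apply: ler_wpM2l; [rewrite mulr_ge0 // ltW | exact: ltW].
have T2 := g_partial_taylor (v t) (v s) (z t) (z s) tT Rt.
have T3 : (Cxi + Cu) * (`|v s - v t| + `|z s - z t|) ^+ 2 <= (Cxi + Cu) * Lc ^+ 2 * e1 * D.
  apply: (@le_trans _ _ ((Cxi + Cu) * (Lc * D) ^+ 2)).
    apply: ler_wpM2l; first by rewrite addr_ge0 // ltW.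
    by rewrite ler_sqr ?nnegrE // mulr_ge0 // ltW.
  have -> : (Cxi + Cu) * (Lc * D) ^+ 2 = (Cxi + Cu) * Lc ^+ 2 * D * D by ring.
  apply: ler_wpM2r => //; apply: ler_wpM2l; last exact: ltW.
  by rewrite mulr_ge0 ?sqr_ge0 // addr_ge0 // ltW.
have [[b1 b2 _] _ _ _] := Rt (v t) (v t) (z t) (z t).
have T4 : `|'d (fun u' => g t u' (z t)) (v t) (v s - v t - (s - t) *: v')| <= om * (e1 * D).
  by apply: le_trans (b2 _) _; rewrite ler_pM2l.
have T5 : `|'d (g t (v t)) (z t) (z s - z t - (s - t) *: z')| <= gam * (e1 * D).
  by apply: le_trans (b1 _) _; rewrite ler_pM2l.
rewrite linearB linearZ /= in T4; rewrite linearB linearZ /= in T5.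
rewrite /g_velocity.
set q0 := 'D_1 _ t in H5 *.
set q1 := 'd (fun u' => g t u' (z t)) (v t) v' in T4 *.
set q2 := 'd (g t (v t)) (z t) z' in T5 *.
set q3 := 'd (fun u' => g t u' (z t)) (v t) (v s - v t) in T2 T4 *.
set q4 := 'd (g t (v t)) (z t) (z s - z t) in T2 T5 *.
have -> : g s (v s) (z s) - g t (v t) (z t) - (s - t) *: (q0 + q1 + q2)
  = ((g s (v s) (z s) - g s (v t) (z t)) - (g t (v s) (z s) - g t (v t) (z t)))
   + (g s (v t) (z t) - g t (v t) (z t) - (s - t) *: q0)
   + (g t (v s) (z s) - g t (v t) (z t) - q3 - q4)
   + (q3 - (s - t) *: q1) + (q4 - (s - t) *: q2) by lmod.
have tri (p1 p2 p3 p4 p5 : W) :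
    `|p1 + p2 + p3 + p4 + p5| <= `|p1| + `|p2| + `|p3| + `|p4| + `|p5|.
  by do 4 (apply: le_trans (ler_normD _ _) _; rewrite lerD2r).
apply: le_trans (tri _ _ _ _ _) _.
have -> : e * D = Lc * bb * e1 * D + e1 * D + (Cxi + Cu) * Lc ^+ 2 * e1 * D + om * (e1 * D) + gam * (e1 * D).
  by rewrite -e1K /K; ring.
by apply: (lerD _ T5); apply: (lerD _ T4); apply: (lerD _ (le_trans T2 T3)); apply: (lerD T1 H5).
Qed.

End moving_constraint.

(** * Existence and uniqueness for the abstract process *)

Section primitives.
Variable R : realType.
Implicit Types f h : R -> R.

Lemma L1TD f h : L1T f -> L1T h -> L1T (fun x => f x + h x).
Proof.
move=> If Ih; rewrite /L1T (_ : EFin \o _ = (EFin \o f) \+ (EFin \o h))%E //.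
exact: integrableD.
Qed.

Lemma L1TZ k f : L1T f -> L1T (fun x => k * f x).
Proof.
move=> If; rewrite /L1T (_ : EFin \o _ = fun x => (k%:E * (EFin \o f) x)%E) //.
exact: integrableZl.
Qed.

Lemma primitiveZ k f t : L1T f -> primitive (fun x => k * f x) t = k * primitive f t.
Proof. by move=> If; rewrite /primitive RintegralZl //; exact: L1T_integrable. Qed.

Lemma primitive_mono f h s t : L1T f -> L1T h -> (forall x, f x <= h x) -> s <= t ->
  primitive f t - primitive f s <= primitive h t - primitive h s.
Proof.
move=> If Ih fh st; rewrite !primitiveB //; apply: le_Rintegral => //; exact: L1T_integrable.
Qed.

Lemma primitive_uniform_continuous f : L1T f -> (forall x, 0 <= f x) ->
  forall e, 0 < e -> exists2 d, 0 < d & forall s t, s <= t -> t - s < d ->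
    primitive f t - primitive f s < e.
Proof.
move=> If f0 e e0; have [d d0 H] := Rintegral_abs_continuous If f0 e0.
exists d => // s t st std; rewrite primitiveB //; apply: H => //.
rewrite lebesgue_measure_itv /= lte_fin; case: ifP => _; last by rewrite lte_fin.
by rewrite -EFinB lte_fin.
Qed.

End primitives.

Lemma harmonic_cauchy_limit (R : realType) (X : completeNormedModType R) (u : nat -> X) (C : R) :
  0 <= C -> (forall n m, `|u n - u m| <= C * (n.+1%:R^-1 + m.+1%:R^-1)) ->
  exists l, forall n, `|u n - l| <= C * n.+1%:R^-1.
Proof.
move=> C0 H.
have small e : 0 < e -> exists n0, forall n, (n0 <= n)%N -> C * n.+1%:R^-1 <= e.
  move=> e0; exists (Num.truncn (C / e)).+1 => n n0.
  rewrite ler_pdivrMr // mulrC -ler_pdivrMr //.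
  apply: (@le_trans _ _ (Num.truncn (C / e)).+1%:R); first by rewrite ltW // truncnS_gt.
  by rewrite ler_nat; exact: leqW.
have cv : cvg (u n @[n --> \oo]).
  apply/cauchy_cvgP; apply/cauchy_exP => e e0.
  have e4 : 0 < e / 4 by rewrite divr_gt0.
  have [n0 Hn] := small _ e4; exists (u n0); exists n0 => // n /= n0n.
  rewrite -ball_normE /=; apply: le_lt_trans (H n0 n) _; rewrite mulrDr.
  apply: (@le_lt_trans _ _ (e / 4 + e / 4)); last lra.
  by apply: lerD; apply: Hn.
exists (lim (u n @[n --> \oo])) => n; apply/ler_addgt0Pr => e e0.
have e2 : 0 < e / 2 by rewrite divr_gt0.
have [n0 Hn] := small _ e2.
have /cvgrPdist_le/(_ _ e2)[n1 _ H1] := cv.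
have a1 := H1 (maxn n0 n1) (leq_maxr _ _); have a2 := Hn (maxn n0 n1) (leq_maxl _ _).
have := H n (maxn n0 n1); rewrite mulrDr; move: a1 a2.
set l := lim _; set m := maxn n0 n1; rewrite distrC; set p := C * n.+1%:R^-1.
set q := C * m.+1%:R^-1; clearbody p q => a1 a2 a3.
have -> : u n - l = (u n - u m) + (u m - l) by lmod.
apply: le_trans (ler_normD _ _) _; lra.
Qed.

Section process.
Variables (R : realType) (X : completeNormedModType R) (ip : X -> X -> R).
Hypothesis hX : hilbert_inner ip.
Variables (T c K0 delta CG CP C4 CB kap : R) (phi : R -> R).
Variables (Gam : R -> X -> R) (Pg : R -> X -> X) (B : R -> X -> X -> R).
Local Notation M := (primitive phi).
Hypothesis T0 : 0 < T.
Hypothesis c0 : 0 < c.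
Hypothesis K00 : 0 <= K0.
Hypothesis delta0 : 0 <= delta.
Hypothesis delta1 : delta < 1.
Hypothesis CG0 : 0 <= CG.
Hypothesis CP0 : 0 <= CP.
Hypothesis C40 : 0 <= C4.
Hypothesis CB0 : 0 <= CB.
Hypothesis kap_ge : step_rate c delta CG <= kap.
Hypothesis Iphi : L1T phi.
Hypothesis phi0 : forall t, 0 <= phi t.
Hypothesis Gam_lip : forall s t xi ze, 0 <= s -> s <= t -> t <= T ->
  `|Gam t xi - Gam s ze| <= CG * (`|xi - ze| + (M t - M s)).
Hypothesis P_lip : forall s t xi ze, 0 <= s -> s <= t -> t <= T ->
  `|Pg t xi - Pg s ze| <= CP * (`|xi - ze| + (M t - M s)).
Hypothesis P_ge : forall t xi, 0 <= t -> t <= T -> Gam t xi = 1 -> c <= `|Pg t xi|.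
Hypothesis P_le : forall t xi, `|Pg t xi| <= K0.
Hypothesis Gam_dec : forall t xi v, 0 <= t -> t <= T ->
  Gam t (xi + v) <= Gam t xi - ip (Pg t xi) v + delta * c * `|v| + C4 * `|v| ^+ 2.
Hypothesis chain : {ae @lebesgue_measure R, forall t, 0 < t < T -> forall ze d,
  has_derivative ze t d ->
  has_derivative (fun s => Gam s (ze s)) t (B t (ze t) d - ip (Pg t (ze t)) d)}.
Hypothesis B_lip : {ae @lebesgue_measure R, forall t, 0 < t < T -> forall x1 x2 d1 d2,
  `|d1| <= kap * phi t ->
  `|B t x1 d1 - B t x2 d2| <= delta * c * `|d1 - d2| + CB * phi t * `|x1 - x2|}.

Lemma step_rate_ge0 : 0 <= step_rate c delta CG.
Proof. by rewrite /step_rate divr_ge0 // mulr_ge0 ?divr_ge0 ?subr_ge0 // ltW. Qed.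

Lemma rate_ge0 : 0 <= kap.
Proof. exact: le_trans step_rate_ge0 kap_ge. Qed.

Lemma M_nd s t : 0 <= s -> s <= t -> t <= T -> M s <= M t.
Proof. by move=> _ st _; exact: primitive_le. Qed.

Lemma M_null : null_variation 0 T M.
Proof. exact: primitive_null_variation. Qed.

Lemma M_der : {ae @lebesgue_measure R, forall t, 0 < t < T -> has_derivative M t (phi t)}.
Proof. by apply: (ae_imply (primitive_derivative Iphi)) => t + _. Qed.

Lemma dominated_derivable (xi : R -> X) k : 0 <= k ->
  (forall s t, 0 <= s -> s <= t -> t <= T -> `|xi t - xi s| <= k * (M t - M s)) ->
  {ae @lebesgue_measure R, forall t, 0 < t < T -> exists d, has_derivative xi t d}.
Proof.
move=> k0 H; apply: (hilbert_radon_nikodym hX (phi := fun x => k * phi x)) => //.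
- exact: L1TZ.
- by move=> x; rewrite mulr_ge0.
- by move=> s t s0 st tT; rewrite !primitiveZ // -mulrBr; exact: H.
Qed.

Lemma process_comparison : exists2 C, 0 <= C & forall eps1 eps2 x1 x2,
  0 <= eps1 -> 0 <= eps2 -> approx_sol T c kap M Gam Pg eps1 x1 ->
  approx_sol T c kap M Gam Pg eps2 x2 -> x1 0 = x2 0 ->
  forall t, 0 <= t -> t <= T -> `|x1 t - x2 t| <= C * (eps1 + eps2).
Proof.
exact: (approx_sol_comparison hX T0 c0 K00 delta1 CG0 CP0 CB0 rate_ge0 phi0 M_nd M_null M_der
  Gam_lip P_lip P_ge P_le chain B_lip).
Qed.

Lemma process_unique x1 x2 : approx_sol T c kap M Gam Pg 0 x1 -> approx_sol T c kap M Gam Pg 0 x2 ->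
  x1 0 = x2 0 -> forall t, 0 <= t -> t <= T -> x1 t = x2 t.
Proof.
move=> h1 h2 x12 t t0 tT; have [C C0 H] := process_comparison.
have := H _ _ _ _ (lexx 0) (lexx 0) h1 h2 x12 t t0 tT.
by rewrite addr0 mulr0 normr_le0 subr_eq0 => /eqP.
Qed.

Lemma process_approx x0 eps : Gam 0 x0 <= 1 -> 0 < eps ->
  exists2 ze, ze 0 = x0 & approx_sol T c kap M Gam Pg eps ze.
Proof.
move=> G0 e0.
have M_unif e : 0 < e -> exists2 d, 0 < d & forall s t, 0 <= s -> s <= t -> t <= T ->
    t - s < d -> M t - M s < e.
  move=> /(primitive_uniform_continuous Iphi phi0)[d d0 H]; exists d => // s t _ st _.
  exact: H.
have [ze [ze0 zl zG zs]] := exists_approx hX c0 delta0 delta1 CG0 CP0 C40 M_nd M_unif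
  Gam_lip P_lip P_ge Gam_dec T0 G0 e0.
exists ze => //; split => //.
  move=> s t s0 st tT; apply: le_trans (zl s t s0 st tT) _.
  by apply: ler_wpM2r => //; rewrite subr_ge0; exact: primitive_le.
apply: (ae_imply (dominated_derivable step_rate_ge0 zl)) => t H tT.
have [d Dd] := H tT; have /andP[t0 tT'] := tT; exists d => //.
by apply: zs => //; [exact: ltW | exact: has_derivative_right].
Qed.

(** Approximations with tolerance [n.+1%:R^-1] are uniformly Cauchy by the comparison estimate; the
    limit keeps the domination by [kap * M], so it has derivatives almost everywhere and
    [approx_sol_limit] applies. *)
Lemma process_exists x0 : Gam 0 x0 <= 1 ->
  exists2 xi, xi 0 = x0 & approx_sol T c kap M Gam Pg 0 xi.
Proof.
move=> G0; have [C C0 cmp] := process_comparison.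
have en n : 0 < (n.+1%:R^-1 : R) by rewrite invr_gt0.
have /choice[xs Hxs] n : exists ze : R -> X, ze 0 = x0 /\ approx_sol T c kap M Gam Pg n.+1%:R^-1 ze.
  by have [ze h1 h2] := process_approx G0 (en n); exists ze.
(* Outside [[0, T]] the limit is given the arbitrary value 0. *)
have /choice[xi Hxi] t : exists l, 0 <= t -> t <= T -> forall n, `|xs n t - l| <= C * n.+1%:R^-1.
  have [/andP[t0 tT]|tn] := boolP (0 <= t <= T); last first.
    by exists 0 => t0 tT; rewrite t0 tT in tn.
  have [n m|l Hl] := @harmonic_cauchy_limit R X (fun n => xs n t) C C0; last by exists l.
  have [h1 h2] := Hxs n; have [h3 h4] := Hxs m.
  by apply: cmp => //; rewrite h1 h3.
have small e : 0 < e -> exists n0, forall n, (n0 <= n)%N -> (C + 1) * n.+1%:R^-1 <= e.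
  move=> e0; exists (Num.truncn ((C + 1) / e)).+1 => n n0.
  rewrite ler_pdivrMr // mulrC -ler_pdivrMr //.
  apply: (@le_trans _ _ (Num.truncn ((C + 1) / e)).+1%:R); first by rewrite ltW // truncnS_gt.
  by rewrite ler_nat; exact: leqW.
have xs_cvg e : 0 < e -> exists n0, forall n, (n0 <= n)%N -> n.+1%:R^-1 <= e /\
    forall t, 0 <= t -> t <= T -> `|xs n t - xi t| <= e.
  move=> /small[n0 H]; exists n0 => n /H h; rewrite mulrDl mul1r in h.
  have Ce : 0 <= C * n.+1%:R^-1 by rewrite mulr_ge0 // ltW.
  split; first by apply: le_trans h; rewrite lerDr.
  move=> t t0 tT; apply: le_trans (Hxi t t0 tT n) _; apply: le_trans h.
  by rewrite lerDl ltW.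
have xi_dom s t : 0 <= s -> s <= t -> t <= T -> `|xi t - xi s| <= kap * (M t - M s).
  move=> s0 st tT; apply/ler_addgt0Pr => e e0.
  have e2 : 0 < e / 2 by rewrite divr_gt0.
  have [n0 /(_ n0 (leqnn _))[_ H]] := xs_cvg _ e2.
  have a1 := H t (le_trans s0 st) tT; have a2 := H s s0 (le_trans st tT).
  have [_ [h _ _]] := Hxs n0; have a3 := h s t s0 st tT.
  have -> : xi t - xi s = (xs n0 t - xs n0 s) - (xs n0 t - xi t) + (xs n0 s - xi s) by lmod.
  apply: le_trans (ler_normD _ _) _.
  have := ler_normB (xs n0 t - xs n0 s) (xs n0 t - xi t); lra.
exists xi.
  apply/eqP; rewrite -subr_eq0 -normr_le0; apply/ler_addgt0Pr => e /xs_cvg[n0 /(_ n0 (leqnn _))[_ H]].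
  by rewrite add0r -(Hxs n0).1 distrC; apply: H => //; exact: ltW.
apply: (approx_sol_limit hX c0 CG0 CP0 rate_ge0 M_nd M_null M_der Gam_lip P_lip P_ge
  (fun n => (Hxs n).2) xs_cvg).
exact: dominated_derivable rate_ge0 xi_dom.
Qed.

End process.

(** * The sweeping process as an instance of the abstract process *)

Section model.
Variables (R : realType) (X : completeNormedModType R) (ip : X -> X -> R).
Hypothesis hX : hilbert_inner ip.
Variables (W : normedModType R) (G : X -> W -> R) (gx : X -> W -> X) (gw : X -> W -> W -> R).
Variables (lam c L : R) (mu1 : W -> R -> R) (mu2 : R -> R).
Hypothesis hH : hypH ip G gx lam c L mu1 mu2.
Variables (K0 K1 C0 C1 : R).
Hypothesis hL : hypL G gx gw K0 K1 C0 C1.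
Variables (T : R) (g : R -> X -> X -> W) (a b : R -> R) (gam om Cxi Cu : R).
Hypothesis T_gt0 : 0 < T.
Hypothesis hg : hypg T g a b gam om Cxi Cu.
Hypothesis hdelta : K1 * gam / c < 1.
Variables (u : R -> X) (phiu : R -> R).
Hypothesis hu : W11 T u.
Hypothesis Iphiu : L1T phiu.
Hypothesis phiu_ge0 : forall x, 0 <= phiu x.
Hypothesis u_dom : forall s t, 0 <= s -> s <= t -> t <= T ->
  `|u t - u s| <= primitive phiu t - primitive phiu s.

Let delta := K1 * gam / c.
(** One density for the speed of the input and for both bounds of the constraint, so that a single
    clock drives all estimates. *)
Let phi x := phiu x + (abs_restrict T a x + abs_restrict T b x).
Let M := primitive phi.
Let Gam t xi := G (u t - xi) (g t (u t) xi).
Let Pg t xi := gx (u t - xi) (g t (u t) xi).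
Let B t xi d := ip (Pg t xi) ('D_1 u t)
  + gw (u t - xi) (g t (u t) xi) (g_velocity g t (u t) xi ('D_1 u t) d).
Let CG := K0 + K1 * (1 + om + gam).
Let CP := C0 * (2 + om + gam).
Let speed := (1 - delta)^-1 * (1 + om * K1 / c + K1 / c).
(** At least [step_rate], for the approximations, and at least [speed], for arbitrary solutions in
    [Omega]: both fall into the same class [approx_sol]. *)
Let kap := step_rate c delta CG + speed.
(** The summands stem from the change of [gx], the change of [gw] on a velocity of norm at most
    [(1 + om + gam * kap) * phi], and the change of that velocity with the state. *)
Let CB := C0 * (1 + gam) + C1 * (1 + gam) * (1 + om + gam * kap) + K1 * (1 + Cu + Cxi * kap).

Lemma constants_gt0 : [/\ [/\ 0 < lam, 0 < c & 0 < K0], [/\ 0 < K1, 0 < C0 & 0 < C1] &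
  [/\ 0 < gam, 0 < om, 0 < Cxi & 0 < Cu]].
Proof. by have [_ [? ? _] _ _] := hH; have [[_ ? ? ? ?] _] := hL; have [_ _ _ [_ _ [? ? ? ?]] _] := hg. Qed.

Lemma deltaE : delta * c = K1 * gam.
Proof. by have [[_ c0 _] _ _] := constants_gt0; rewrite /delta mulfVK // gt_eqF. Qed.

Lemma delta_ge0 : 0 <= delta.
Proof.
have [[_ c0 _] [K10 _ _] [gam0 _ _ _]] := constants_gt0.
by rewrite /delta divr_ge0 ?mulr_ge0 // ltW.
Qed.

Lemma speed_ge0 : 0 <= speed.
Proof.
have [[_ c0 _] [K10 _ _] [gam0 om0 _ _]] := constants_gt0.
rewrite /speed mulr_ge0 ?invr_ge0 ?subr_ge0 ?(ltW hdelta) //.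
by rewrite !addr_ge0 // divr_ge0 ?mulr_ge0 // ltW.
Qed.

Lemma CG_ge0 : 0 <= CG.
Proof.
have [[_ _ K00] [K10 _ _] [gam0 om0 _ _]] := constants_gt0.
by rewrite /CG addr_ge0 ?mulr_ge0 ?addr_ge0 // ltW.
Qed.

Lemma CP_ge0 : 0 <= CP.
Proof.
have [_ [_ C00 _] [gam0 om0 _ _]] := constants_gt0.
by rewrite /CP ?mulr_ge0 ?addr_ge0 // ltW.
Qed.

Lemma kap_ge_step : step_rate c delta CG <= kap.
Proof. by rewrite /kap lerDl speed_ge0. Qed.

Lemma kap_ge_speed : speed <= kap.
Proof.
have [[_ c0 _] _ _] := constants_gt0.
by rewrite /kap lerDr; apply: step_rate_ge0 => //; exact: CG_ge0.
Qed.

Lemma kap_ge0 : 0 <= kap.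
Proof. exact: le_trans speed_ge0 kap_ge_speed. Qed.

Lemma CB_ge0 : 0 <= CB.
Proof.
have [_ [K10 C00 C10] [gam0 om0 Cxi0 Cu0]] := constants_gt0; have k0 := kap_ge0.
have gk : 0 <= gam * kap by rewrite mulr_ge0 // ltW.
have ck : 0 <= Cxi * kap by rewrite mulr_ge0 // ltW.
have g1 : 0 <= 1 + gam by lra.
have g2 : 0 <= 1 + om + gam * kap by lra.
have g3 : 0 <= 1 + Cu + Cxi * kap by lra.
by rewrite /CB !addr_ge0 ?mulr_ge0 ?(ltW K10) ?(ltW C00) ?(ltW C10).
Qed.

Lemma L1T_phi : L1T phi.
Proof.
have [_ _ _ [La Lb _] _] := hg.
by apply: L1TD => //; apply: L1TD; exact: L1_abs_restrict.
Qed.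

Lemma phi_ge0 t : 0 <= phi t.
Proof. by rewrite /phi !addr_ge0 ?abs_restrict_ge0. Qed.

Lemma input_increment s t : 0 <= s -> s <= t -> t <= T -> `|u t - u s| <= M t - M s.
Proof.
move=> s0 st tT; apply: le_trans (u_dom s0 st tT) _; apply: primitive_mono => //.
  exact: L1T_phi.
by move=> x; rewrite /phi lerDl addr_ge0 ?abs_restrict_ge0.
Qed.

Lemma constraint_lip s t xi ze : 0 <= s -> s <= t -> t <= T ->
  `|g t (u t) xi - g s (u s) ze| <= (om + 1) * (M t - M s) + gam * `|xi - ze|.
Proof.
move=> s0 st tT; have t0 := le_trans s0 st.
have [_ _ [_ om0 _ _]] := constants_gt0.
have [_ _ _ [La Lb _] _] := hg.
have a1 := lip_u T_gt0 hg (u s) (u t) xi t0 tT.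
have a2 := lip_xi T_gt0 hg (u s) ze xi t0 tT.
have a3 := lip_time hg (u s) ze s0 st tT.
have a4 : primitive (abs_restrict T a) t - primitive (abs_restrict T a) s <= M t - M s.
  apply: primitive_mono => //; [exact: L1_abs_restrict | exact: L1T_phi |].
  by move=> x; have := abs_restrict_ge0 T b x; have := phiu_ge0 x; rewrite /phi; lra.
have a5 : om * `|u t - u s| <= om * (M t - M s) by rewrite ler_pM2l //; exact: input_increment.
have -> : g t (u t) xi - g s (u s) ze = (g t (u t) xi - g t (u s) xi)
  + (g t (u s) xi - g t (u s) ze) + (g t (u s) ze - g s (u s) ze) by lmod.
apply: le_trans (ler_normD _ _) _.
have := ler_normD (g t (u t) xi - g t (u s) xi) (g t (u s) xi - g t (u s) ze).
rewrite mulrDl mul1r; lra.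
Qed.

Lemma state_lip s t (xi ze : X) : 0 <= s -> s <= t -> t <= T ->
  `|u t - xi - (u s - ze)| <= (M t - M s) + `|xi - ze|.
Proof.
move=> s0 st tT; have -> : u t - xi - (u s - ze) = (u t - u s) - (xi - ze) by lmod.
by apply: le_trans (ler_normB _ _) _; rewrite lerD2r; exact: input_increment.
Qed.

Lemma M_incr s t : s <= t -> 0 <= M t - M s.
Proof. by move=> st; rewrite subr_ge0; apply: primitive_le => //; [exact: L1T_phi | exact: phi_ge0]. Qed.

Lemma Gam_lipschitz s t xi ze : 0 <= s -> s <= t -> t <= T ->
  `|Gam t xi - Gam s ze| <= CG * (`|xi - ze| + (M t - M s)).
Proof.
move=> s0 st tT; have [grx _ _ _] := hH; have [[grw K00 K10 C00 C10] [gxK gwK gxl gwl]] := hL.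
have [_ _ [gam0 om0 _ _]] := constants_gt0.
have a1 := G_lip_x hX grx gxK (u s - ze) (u t - xi) (g t (u t) xi).
have a2 := G_lip_w grw gwK (u s - ze) (g s (u s) ze) (g t (u t) xi).
have a3 := state_lip xi ze s0 st tT; have a4 := constraint_lip xi ze s0 st tT.
rewrite /Gam.
have -> : G (u t - xi) (g t (u t) xi) - G (u s - ze) (g s (u s) ze) =
   (G (u t - xi) (g t (u t) xi) - G (u s - ze) (g t (u t) xi)) +
   (G (u s - ze) (g t (u t) xi) - G (u s - ze) (g s (u s) ze)) by ring.
apply: le_trans (ler_normD _ _) _; apply: le_trans (lerD a1 a2) _.
apply: (@le_trans _ _ (K0 * ((M t - M s) + `|xi - ze|) + K1 * ((om + 1) * (M t - M s) + gam * `|xi - ze|))).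
  by apply: lerD; rewrite ler_pM2l.
have m0 := M_incr st; set m := M t - M s in m0 *; set d := `|xi - ze|.
have d0 : 0 <= d by exact: normr_ge0.
have q1 : 0 <= K1 * (1 + om) * d by rewrite !mulr_ge0 ?addr_ge0 // ltW.
have q2 : 0 <= K1 * gam * m by rewrite !mulr_ge0 // ltW.
have -> : CG * (d + m) = K0 * (m + d) + K1 * ((om + 1) * m + gam * d) + (K1 * (1 + om) * d + K1 * gam * m).
  by rewrite /CG; ring.
by rewrite lerDl addr_ge0.
Qed.

Lemma Pg_lipschitz s t xi ze : 0 <= s -> s <= t -> t <= T ->
  `|Pg t xi - Pg s ze| <= CP * (`|xi - ze| + (M t - M s)).
Proof.
move=> s0 st tT; have [[grw K00 K10 C00 C10] [gxK gwK gxl gwl]] := hL.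
have [_ _ [gam0 om0 _ _]] := constants_gt0.
have a3 := state_lip xi ze s0 st tT; have a4 := constraint_lip xi ze s0 st tT.
apply: le_trans (gxl _ _ _ _) _.
apply: (@le_trans _ _ (C0 * ((M t - M s) + `|xi - ze| + ((om + 1) * (M t - M s) + gam * `|xi - ze|)))).
  by rewrite ler_pM2l //; exact: lerD.
have m0 := M_incr st; set m := M t - M s in m0 *; set d := `|xi - ze|.
have d0 : 0 <= d by exact: normr_ge0.
have q1 : 0 <= C0 * (1 + om) * d by rewrite !mulr_ge0 ?addr_ge0 // ltW.
have q2 : 0 <= C0 * gam * m by rewrite !mulr_ge0 // ltW.
have -> : CP * (d + m) = C0 * (m + d + ((om + 1) * m + gam * d)) + (C0 * (1 + om) * d + C0 * gam * m).
  by rewrite /CP; ring.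
by rewrite lerDl addr_ge0.
Qed.

Lemma Pg_ge t xi : 0 <= t -> t <= T -> Gam t xi = 1 -> c <= `|Pg t xi|.
Proof. by have [_ _ _ [H _ _ _ _]] := hH => _ _; exact: H. Qed.

Lemma Gam_decrease t xi v : 0 <= t -> t <= T ->
  Gam t (xi + v) <= Gam t xi - ip (Pg t xi) v + delta * c * `|v| + C0 * `|v| ^+ 2.
Proof.
move=> t0 tT; have [grx _ _ _] := hH; have [[grw K00 K10 C00 C10] [gxK gwK gxl gwl]] := hL.
have := G_lip_w grw gwK (u t - (xi + v)) (g t (u t) xi) (g t (u t) (xi + v)).
have := G_taylor_x hX grx C00 gxl (u t - xi) (g t (u t) xi) (- v).
have a1 := lip_xi T_gt0 hg (u t) xi (xi + v) t0 tT.
have a2 : K1 * `|g t (u t) (xi + v) - g t (u t) xi| <= K1 * gam * `|v|.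
  rewrite -mulrA ler_pM2l //; apply: le_trans a1 _.
  by have -> : xi + v - xi = v by lmod.
have -> : u t - xi - v = u t - (xi + v) by lmod.
rewrite deltaE (ipNr hX) normrN /Gam /Pg !ler_norml => /andP[_ h1] /andP[_ h2]; lra.
Qed.

Definition good_time t := [/\ has_derivative u t ('D_1 u t), `|'D_1 u t| <= phi t,
  regular_time g a b gam om Cxi Cu t &
  has_derivative (primitive (abs_restrict T b)) t (abs_restrict T b t)].

Lemma ae_good_time : {ae @lebesgue_measure R, forall t, 0 < t < T -> good_time t}.
Proof.
have [_ _ _ [La Lb _] _] := hg; have [_ Du] := hu.
have A1 := ae_and (ae_regular_time hg) (primitive_derivative (L1_abs_restrict Lb)).
have A2 := ae_and Du (primitive_derivative L1T_phi).
apply: (ae_imply (ae_and A1 A2)) => t [[h1 h2] [h3 h4]] tT; have /andP[t0 tT'] := tT.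
have D : has_derivative u t ('D_1 u t).
  by apply: derivable_has_derivative; apply: h3; rewrite /= in_itv.
split => //; last exact: h1.
have tr : 0 < T - t by rewrite subr_gt0.
rewrite -[phi t]mul1r; apply: (has_derivative_dominated tr ler01 _ D h4) => s ts st.
by rewrite mul1r; apply: input_increment; [exact: ltW | | lra].
Qed.

Lemma Gam_chain t (ze : R -> X) d : 0 < t < T -> good_time t -> has_derivative ze t d ->
  has_derivative (fun s => Gam s (ze s)) t (B t (ze t) d - ip (Pg t (ze t)) d).
Proof.
move=> tT [Du _ Rt Db] Dz.
have [grx _ _ _] := hH; have [[grw K00 K10 C00 C10] [gxK gwK gxl gwl]] := hL.
have Dx : has_derivative (fun s => u s - ze s) t ('D_1 u t - d).
  have := has_derivativeD Du (has_derivativeZ (-1) Dz); rewrite scaleN1r.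
  by apply: (has_derivative_ext ltr01) => s _; rewrite scaleN1r.
have := G_chain hX grx grw C00 C10 K10 K00 gxK gwK gxl gwl Dx (g_chain hg tT Rt Db Du Dz).
by rewrite (ipBr hX) addrAC.
Qed.

Lemma B_bound t xi d : good_time t ->
  B t xi d <= `|Pg t xi| * `|'D_1 u t| + K1 * (a t + om * `|'D_1 u t| + gam * `|d|).
Proof.
move=> [_ _ Rt _]; have [[grw K00 K10 C00 C10] [gxK gwK gxl gwl]] := hL.
apply: lerD; first exact: (ip_le hX).
apply: le_trans (ler_norm _) _; apply: le_trans (gwK _ _ _) _; rewrite ler_pM2l //.
have [[b1 b2 b3] _ _ _] := Rt (u t) (u t) xi xi.
apply: le_trans (ler_normD _ _) _; apply: lerD => //.
by apply: le_trans (ler_normD _ _) _; apply: lerD.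
Qed.

(** The state is changed first with [d1] fixed; the change from [d1] to [d2] is then linear and
    contributes exactly [K1 * gam = delta * c]. *)
Lemma B_lipschitz t x1 x2 d1 d2 : 0 < t < T -> good_time t -> `|d1| <= kap * phi t ->
  `|B t x1 d1 - B t x2 d2| <= delta * c * `|d1 - d2| + CB * phi t * `|x1 - x2|.
Proof.
move=> /andP[t0 tT] [_ up Rt _] dk; have [[grw K00 K10 C00 C10] [gxK gwK gxl gwl]] := hL.
have [_ _ [gam0 om0 Cxi0 Cu0]] := constants_gt0.
set e := `|x1 - x2|; have e0 : 0 <= e by exact: normr_ge0.
set p := phi t in up dk *; have p0 : 0 <= p by exact: phi_ge0.
set v := 'D_1 u t in up *.
have ap : a t <= p.
  apply: le_trans (ler_norm _) _; rewrite -(abs_restrictE a (ltW t0) (ltW tT)) /p /phi.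
  by have := phiu_ge0 t; have := abs_restrict_ge0 T b t; lra.
have bp : b t <= p.
  apply: le_trans (ler_norm _) _; rewrite -(abs_restrictE b (ltW t0) (ltW tT)) /p /phi.
  by have := phiu_ge0 t; have := abs_restrict_ge0 T a t; lra.
have xx : `|u t - x1 - (u t - x2)| + `|g t (u t) x1 - g t (u t) x2| <= (1 + gam) * e.
  rewrite mulrDl mul1r; apply: lerD; last exact: (lip_xi T_gt0 hg _ _ _ (ltW t0) (ltW tT)).
  have -> : u t - x1 - (u t - x2) = - (x1 - x2) by lmod.
  by rewrite normrN.
have s1 : `|ip (Pg t x1) v - ip (Pg t x2) v| <= C0 * (1 + gam) * p * e.
  rewrite -(ipBl hX); apply: le_trans (cauchy_schwarz hX _ _) _.
  have -> : C0 * (1 + gam) * p * e = C0 * ((1 + gam) * e) * p by ring.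
  apply: ler_pM => //; apply: le_trans (gxl _ _ _ _) _; by rewrite ler_pM2l.
set V1 := g_velocity g t (u t) x1 v d1; set V2 := g_velocity g t (u t) x2 v d2.
have [[b1 b2 b3] b4 b5 b6] := Rt (u t) (u t) x1 x2.
have [[b1' _ _] _ _ _] := Rt (u t) (u t) x2 x2.
have nV1 : `|V1| <= (1 + om + gam * kap) * p.
  have -> : (1 + om + gam * kap) * p = p + om * p + gam * (kap * p) by ring.
  apply: le_trans (ler_normD _ _) _; apply: lerD.
    apply: le_trans (ler_normD _ _) _; apply: lerD; first exact: le_trans b3 ap.
    by apply: le_trans (b2 _) _; rewrite ler_pM2l.
  by apply: le_trans (b1 _) _; rewrite ler_pM2l.
rewrite subrr normr0 add0r -/e in b4 b5 b6.
have nV12 : `|V1 - V2| <= (1 + Cu + Cxi * kap) * p * e + gam * `|d1 - d2|.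
  have -> : V1 - V2 = ('D_1 (fun s => g s (u t) x1) t - 'D_1 (fun s => g s (u t) x2) t)
    + ('d (fun u' => g t u' x1) (u t) v - 'd (fun u' => g t u' x2) (u t) v)
    + ('d (g t (u t)) x1 d1 - 'd (g t (u t)) x2 d1) + 'd (g t (u t)) x2 (d1 - d2).
    have split3 (p1 q1 r1 p2 q2 r2 r3 : W) : p1 + q1 + r1 - (p2 + q2 + r2)
      = (p1 - p2) + (q1 - q2) + (r1 - r3) + (r3 - r2) by lmod.
    by rewrite linearB; exact: split3.
  apply: le_trans (ler_normD _ _) _; apply: lerD; last exact: b1'.
  have -> : (1 + Cu + Cxi * kap) * p * e = p * e + Cu * e * p + Cxi * e * (kap * p) by ring.
  apply: le_trans (ler_normD _ _) _; apply: lerD.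
    apply: le_trans (ler_normD _ _) _; apply: lerD.
      by apply: le_trans b6 _; apply: ler_wpM2r.
    by apply: le_trans (b5 _) _; apply: ler_wpM2l => //; rewrite mulr_ge0 // ltW.
  by apply: le_trans (b4 _) _; apply: ler_wpM2l => //; rewrite mulr_ge0 // ltW.
have s2 : `|gw (u t - x1) (g t (u t) x1) V1 - gw (u t - x2) (g t (u t) x2) V1|
    <= C1 * (1 + gam) * (1 + om + gam * kap) * p * e.
  apply: le_trans (gwl _ _ _ _ _) _.
  have -> : C1 * (1 + gam) * (1 + om + gam * kap) * p * e
    = C1 * ((1 + gam) * e) * ((1 + om + gam * kap) * p) by ring.
  apply: ler_pM => //; last by rewrite ler_pM2l.
  by rewrite mulr_ge0 ?addr_ge0 // ltW.
have s3 : `|gw (u t - x2) (g t (u t) x2) (V1 - V2)|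
    <= K1 * (1 + Cu + Cxi * kap) * p * e + delta * c * `|d1 - d2|.
  apply: le_trans (gwK _ _ _) _; rewrite deltaE.
  have -> : K1 * (1 + Cu + Cxi * kap) * p * e + K1 * gam * `|d1 - d2|
    = K1 * ((1 + Cu + Cxi * kap) * p * e + gam * `|d1 - d2|) by ring.
  by rewrite ler_pM2l.
rewrite (gwB grw) in s3.
have -> : B t x1 d1 - B t x2 d2 = (ip (Pg t x1) v - ip (Pg t x2) v)
  + (gw (u t - x1) (g t (u t) x1) V1 - gw (u t - x2) (g t (u t) x2) V1)
  + (gw (u t - x2) (g t (u t) x2) V1 - gw (u t - x2) (g t (u t) x2) V2).
  by rewrite /B -/v -/V1 -/V2; ring.
have -> : delta * c * `|d1 - d2| + CB * p * e = C0 * (1 + gam) * p * e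
  + C1 * (1 + gam) * (1 + om + gam * kap) * p * e
  + (K1 * (1 + Cu + Cxi * kap) * p * e + delta * c * `|d1 - d2|) by rewrite /CB; ring.
apply: le_trans (ler_normD _ _) _; apply: lerD => //.
by apply: le_trans (ler_normD _ _) _; apply: lerD.
Qed.

Lemma gradient_monotone w x z : G x w = 1 -> G z w <= 1 ->
  - lam * `|x - z| ^+ 2 <= ip (gx x w - gx z w) (x - z).
Proof.
have [grx [_ c0 _] _ [Hi _ Hiii _ _]] := hH; have [[_ _ _ C00 _] [_ _ gxl _]] := hL.
move=> Gx Gz; apply: Hiii => //.
apply: (@level_set_bdry R X ip hX (G^~ w) (gx^~ w) C0 C00) => //.
  by move=> y h /=; have := G_taylor_x hX grx C00 gxl y w h.
by rewrite -normr_gt0; exact: lt_le_trans c0 (Hi _ _ Gx).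
Qed.

(** On an active point [d] is a multiple of the gradient, and prox-regularity with radius [c / lam]
    is the variational inequality for that multiple. *)
Lemma slope_cond_prox t xi d : Gam t xi <= 1 -> slope_cond c Gam Pg 0 t xi d ->
  proximal_normal ip (G^~ (g t (u t) xi)) (c / lam) (u t - xi) d.
Proof.
have [[lam0 c0 _] [_ C00 _] _] := constants_gt0.
have [grx _ _ [Hi _ _ _ _]] := hH; have [_ [_ _ gxl _]] := hL.
rewrite le_eqVlt => /orP[/eqP G1|G1] [S0 S1] z Gz; last first.
  by rewrite (S0 G1) (ip0r hX) normr0 !mul0r addr0.
have [k [p [k0 pP cp ->]]] := S1 G1.
have {}pP : p = Pg t xi by apply/eqP; rewrite -subr_eq0 -normr_le0.
move: pP cp => {p}-> _; set w := g t (u t) xi in Gz *; set x := u t - xi.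
have PR : ip (gx x w) (z - x) <= `|gx x w| * (lam / (2 * c)) * `|z - x| ^+ 2.
  apply: (@prox_regular R X ip hX (G^~ w) (gx^~ w) c lam C0) => //.
  - by move=> y h /=; have := G_taylor_x hX grx C00 gxl y w h.
  - by move=> y y'; have := gxl y w y' w; rewrite subrr normr0 addr0.
  - by move=> y; exact: Hi.
  - by move=> y y'; exact: gradient_monotone.
rewrite (ipZr hX) normrZ ger0_norm // (ipC hX) -/x -/w -[Pg t xi]/(gx x w) distrC.
have -> : x - z = - (z - x) by lmod.
rewrite (ipNr hX).
have -> : k * - ip (gx x w) (z - x) + k * `|gx x w| / (2 * (c / lam)) * `|z - x| ^+ 2
  = k * (`|gx x w| * (lam / (2 * c)) * `|z - x| ^+ 2 - ip (gx x w) (z - x)).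
  by field; rewrite !gt_eqF.
by rewrite mulr_ge0 // subr_ge0.
Qed.

Lemma prox_slope_cond t xi d :
  proximal_normal ip (G^~ (g t (u t) xi)) (c / lam) (u t - xi) d -> slope_cond c Gam Pg 0 t xi d.
Proof.
have [[lam0 c0 _] [_ C00 _] _] := constants_gt0.
have [grx _ _ [Hi _ _ _ _]] := hH; have [_ [_ _ gxl _]] := hL.
have r0 : 0 < c / lam by rewrite divr_gt0.
have tay y h : `|G (y + h) (g t (u t) xi) - G y (g t (u t) xi) - ip (gx y (g t (u t) xi)) h| <= C0 * `|h| ^+ 2.
  by have := G_taylor_x hX grx C00 gxl y (g t (u t) xi) h.
move=> H; split => G1.
  exact: (@proximal_normal_interior R X ip hX (G^~ (g t (u t) xi)) (gx^~ (g t (u t) xi)) C0 C00 tay (c / lam) r0 _ _ G1 H).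
have cP := Hi _ _ G1.
have P0 : gx (u t - xi) (g t (u t) xi) != 0 by rewrite -normr_gt0; exact: lt_le_trans cP.
have [k k0 dE] := @proximal_normal_gradient R X ip hX (G^~ (g t (u t) xi)) (gx^~ (g t (u t) xi)) C0 C00 tay (c / lam) r0 _ _ G1 P0 H.
by exists k, (Pg t xi); split => //; rewrite subrr normr0.
Qed.

(** The bound defining [Omega] is automatic: at active times [Gam'] vanishes, so
    [|P| |d| = <P, d> = B], and [B_bound] contains [|d|] only with the coefficient
    [K1 * gam = delta * c]. *)
Lemma slope_speed t (xi : R -> X) d : 0 < t < T -> good_time t ->
  (forall s, 0 <= s -> s <= T -> Gam s (xi s) <= 1) ->
  has_derivative xi t d -> slope_cond c Gam Pg 0 t (xi t) d ->
  `|d| <= (1 - delta)^-1 * ((1 + om * K1 / c) * `|'D_1 u t| + K1 / c * a t).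
Proof.
move=> tT gt feas Dd [S0 S1]; have /andP[t0 tT'] := tT.
have [[_ c0 _] [K10 _ _] [gam0 om0 _ _]] := constants_gt0.
have [_ _ Rt _] := gt; have [[_ _ b3] _ _ _] := Rt (u t) (u t) (xi t) (xi t).
have a0 : 0 <= a t by exact: le_trans (normr_ge0 _) b3.
have d1 : 0 < 1 - delta by rewrite subr_gt0.
have kc : 0 < K1 / c by rewrite divr_gt0.
set v := `|'D_1 u t|; have v0 : 0 <= v by exact: normr_ge0.
have q1 : 0 <= om * (K1 / c) * v by rewrite mulr_ge0 // mulr_ge0 // ltW.
have q2 : 0 <= K1 / c * a t by rewrite mulr_ge0 // ltW.
have := feas t (ltW t0) (ltW tT'); rewrite le_eqVlt => /orP[/eqP G1|G1]; last first.
  rewrite (S0 G1) normr0 mulr_ge0 ?invr_ge0 ?(ltW d1) // -mulrA; lra.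
rewrite mulrC ler_pdivlMr //.
have [vd|vd] := leP `|d| v.
  have : `|d| * (1 - delta) <= `|d| by rewrite ler_piMr // lerBlDr lerDl delta_ge0.
  rewrite -mulrA; lra.
have [k [p [k0 pP _ dE]]] := S1 G1.
have {}pP : p = Pg t (xi t) by apply/eqP; rewrite -subr_eq0 -normr_le0.
have r0 : 0 < Num.min t (T - t) by rewrite lt_min t0 subr_gt0.
have : B t (xi t) d - ip (Pg t (xi t)) d = 0.
  apply: (has_derivative_max r0 _ (Gam_chain tT gt Dd)) => s; rewrite lt_min !ltr_norml.
  by move=> /andP[/andP[h1 h2] /andP[h3 h4]]; rewrite G1; apply: feas; lra.
have -> : ip (Pg t (xi t)) d = `|Pg t (xi t)| * `|d|.
  by rewrite dE pP (ipZr hX) (ipxx hX) normrZ ger0_norm //; ring.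
have := B_bound (xi t) d gt; rewrite -/v.
have := Pg_ge (ltW t0) (ltW tT') G1; set P := `|Pg t (xi t)| => cP h1 h2.
have h3 : c * (`|d| - v) <= P * (`|d| - v) by apply: ler_wpM2r => //; rewrite subr_ge0 ltW.
have h4 : c * (`|d| - v) <= K1 * (a t + om * v + gam * `|d|) by lra.
have : `|d| - v <= K1 / c * a t + om * (K1 / c) * v + delta * `|d|.
  rewrite -(ler_pM2l c0); apply: le_trans h4 _.
  by rewrite le_eqVlt; apply/orP; left; apply/eqP; rewrite /delta; field; rewrite gt_eqF.
rewrite -mulrA mulrBr mulr1; lra.
Qed.

Lemma speed_bound t : 0 < t < T -> good_time t ->
  (1 - delta)^-1 * ((1 + om * K1 / c) * `|'D_1 u t| + K1 / c * a t) <= kap * phi t.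
Proof.
move=> /andP[t0 tT] [_ up _ _].
have [[_ c0 _] [K10 _ _] [gam0 om0 _ _]] := constants_gt0.
apply: (@le_trans _ _ (speed * phi t)); last by apply: ler_wpM2r; [exact: phi_ge0 | exact: kap_ge_speed].
rewrite /speed -[leRHS]mulrA; apply: ler_wpM2l; first by rewrite invr_ge0 subr_ge0 ltW.
rewrite [leRHS]mulrDl; apply: lerD; apply: ler_wpM2l => //.
- by rewrite addr_ge0 // divr_ge0 ?mulr_ge0 // ltW.
- by rewrite divr_ge0 // ltW.
apply: le_trans (ler_norm _) _; rewrite -(abs_restrictE a (ltW t0) (ltW tT)) /phi.
by have := phiu_ge0 t; have := abs_restrict_ge0 T b t; lra.
Qed.

Lemma slope_cond_solution x0 xi : xi 0 = u 0 - x0 -> approx_sol T c kap M Gam Pg 0 xi ->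
  Omega T u x0 K1 c om delta a xi /\ is_solution ip G g T (c / lam) u x0 xi.
Proof.
move=> xi0 [xl xf xs].
have xiW : W11 T xi.
  split.
    apply: (@primitive_abs_cont _ _ _ _ (fun x => kap * phi x)); first exact: L1TZ L1T_phi.
      by move=> x; rewrite mulr_ge0 ?kap_ge0 ?phi_ge0.
    by move=> s t s0 st tT; rewrite !(primitiveZ _ _ L1T_phi) -mulrBr; exact: xl.
  apply: (ae_imply xs) => t H; rewrite /= in_itv => tT.
  by have [d /has_derivativeE[]] := H tT.
have pt : {ae @lebesgue_measure R, forall t, 0 < t < T -> good_time t /\
    exists2 d, 'D_1 xi t = d & has_derivative xi t d /\ slope_cond c Gam Pg 0 t (xi t) d}.
  apply: (ae_imply (ae_and ae_good_time xs)) => t [h1 h2] tT; split; first exact: h1.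
  by have [d Dd Sd] := h2 tT; exists d => //; have [_ ->] := has_derivativeE Dd.
split.
  split => //; apply: (ae_imply pt) => t H; rewrite /= in_itv => tT.
  by have [gt [d -> [Dd Sd]]] := H tT; exact: slope_speed Dd Sd.
split => //.
- by move=> t; rewrite /= in_itv => /andP[t0 tT]; exact: xf.
- apply: (ae_imply pt) => t H; rewrite /= in_itv => tT.
  have [gt [d -> [Dd Sd]]] := H tT; have /andP[t0 tT'] := tT.
  by apply: slope_cond_prox => //; exact: xf (ltW t0) (ltW tT').
by rewrite xi0; lmod.
Qed.

(** Membership in [Omega] supplies the domination by [kap * M] that uniqueness works with, through
    the mean value inequality for absolutely continuous functions. *)
Lemma solution_slope_cond x0 xi : Omega T u x0 K1 c om delta a xi ->
  is_solution ip G g T (c / lam) u x0 xi -> approx_sol T c kap M Gam Pg 0 xi.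
Proof.
move=> [[ac dx] _ sp] [_ xf vi _].
have dx' : {ae @lebesgue_measure R, forall t, 0 < t < T -> has_derivative xi t ('D_1 xi t)}.
  apply: (ae_imply dx) => t H tT; apply: derivable_has_derivative; apply: H.
  by rewrite /= in_itv.
split.
- move=> s t s0 st tT.
  have sub r : s < r < t -> 0 < r < T.
    by move=> /andP[sr rt]; rewrite (le_lt_trans s0 sr) (lt_le_trans rt tT).
  apply: (ae_increment_le st kap_ge0 (phi := phi)).
  + exact: null_variation_sub s0 st tT (abs_cont_null_variation (ltW T_gt0) ac).
  + by move=> x y _ xy _; rewrite -subr_ge0; exact: M_incr.
  + by apply: (ae_imply (primitive_derivative L1T_phi)) => r + _.
  apply: (ae_imply (ae_and ae_good_time (ae_and dx' sp))) => r [h1 [h2 h3]] /sub rT.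
  exists ('D_1 xi r); first exact: h2.
  apply: le_trans (speed_bound rT (h1 rT)); apply: h3.
  by rewrite /= in_itv.
- by move=> t t0 tT; apply: xf; rewrite /= in_itv /= t0 tT.
apply: (ae_imply (ae_and dx' vi)) => t [h1 h2] tT; exists ('D_1 xi t); first exact: h1.
by apply: prox_slope_cond => z Gz; apply: h2 => //; rewrite /= in_itv.
Qed.

Lemma model_solution x0 : G x0 (g 0 (u 0) (u 0 - x0)) <= 1 ->
  exists xi : R -> X,
    [/\ Omega T u x0 K1 c om delta a xi, is_solution ip G g T (c / lam) u x0 xi &
        forall xi' : R -> X, Omega T u x0 K1 c om delta a xi' ->
          is_solution ip G g T (c / lam) u x0 xi' ->
          forall t, `[0, T]%classic t -> xi' t = xi t].
Proof.
have [[lam0 c0 K00] [K10 C00 _] _] := constants_gt0; have [_ [gxK _ _ _]] := hL.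
move=> G0; have Gam0 : Gam 0 (u 0 - x0) <= 1.
  by rewrite /Gam; have -> : u 0 - (u 0 - x0) = x0 by lmod.
have ch : {ae @lebesgue_measure R, forall t, 0 < t < T -> forall ze d,
  has_derivative ze t d ->
  has_derivative (fun s => Gam s (ze s)) t (B t (ze t) d - ip (Pg t (ze t)) d)}.
  by apply: (ae_imply ae_good_time) => t H tT ze d; exact: Gam_chain (H tT).
have Bl : {ae @lebesgue_measure R, forall t, 0 < t < T -> forall x1 x2 d1 d2,
  `|d1| <= kap * phi t ->
  `|B t x1 d1 - B t x2 d2| <= delta * c * `|d1 - d2| + CB * phi t * `|x1 - x2|}.
  by apply: (ae_imply ae_good_time) => t H tT x1 x2 d1 d2; exact: B_lipschitz (H tT).
have PK t xi : `|Pg t xi| <= K0 by exact: gxK.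
have [xi xi0 Sxi] := process_exists hX T_gt0 c0 (ltW K00) delta_ge0 hdelta CG_ge0 CP_ge0 (ltW C00)
  CB_ge0 kap_ge_step L1T_phi phi_ge0 Gam_lipschitz Pg_lipschitz Pg_ge PK Gam_decrease ch Bl Gam0.
have [Om sol] := slope_cond_solution xi0 Sxi; exists xi; split => // xi' Om' sol' t.
rewrite /= in_itv => /andP[t0 tT]; have Sxi' := solution_slope_cond Om' sol'.
apply: (process_unique hX T_gt0 c0 (ltW K00) hdelta CG_ge0 CP_ge0
  CB_ge0 kap_ge_step L1T_phi phi_ge0 Gam_lipschitz Pg_lipschitz Pg_ge PK ch Bl Sxi' Sxi) => //.
by have [_ -> _] := Om'.
Qed.

End model.

Theorem theorem4p4 (R : realType)
  (X : completeNormedModType R) (ip : X -> X -> R) (hX : hilbert_inner ip)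
  (W : completeNormedModType R)
  (G : X -> W -> R) (G_ge0 : forall x w, 0 <= G x w) (G_lip : loc_lipschitz2 G)
  (gx : X -> W -> X) (gw : X -> W -> W -> R)
  (lam c L : R) (mu1 : W -> R -> R) (mu2 : R -> R)
  (hH : hypH ip G gx lam c L mu1 mu2)
  (K0 K1 C0 C1 : R) (hL : hypL G gx gw K0 K1 C0 C1)
  (T : R) (T_gt0 : 0 < T)
  (g : R -> X -> X -> W) (a b : R -> R) (gam om Cxi Cu : R)
  (hg : hypg T g a b gam om Cxi Cu)
  (hdelta : K1 * gam / c < 1)
  (u : R -> X) (x0 : X) (hu : W11 T u)
  (hx0 : Zset G (g 0 (u 0) (u 0 - x0)) x0) :
  exists xi : R -> X,
    [/\ Omega T u x0 K1 c om (K1 * gam / c) a xi,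
        is_solution ip G g T (c / lam) u x0 xi &
        forall xi' : R -> X,
          Omega T u x0 K1 c om (K1 * gam / c) a xi' ->
          is_solution ip G g T (c / lam) u x0 xi' ->
          forall t, `[0, T]%classic t -> xi' t = xi t].
Proof.
(* The integrable density of the input, the first ingredient of the clock. *)
have [phi [Iphi phi0 u_dom]] := W11_dominated T_gt0 hu.
exact: (model_solution hX hH hL T_gt0 hg hdelta hu Iphi phi0 u_dom hx0).
Qed.
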